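(* Let $n\geq1$ and let $X$ be a normal $G/\mu_n$-embedding, $G=\mathrm{SL}_2$, such that no $G$-stable prime divisor of $X$ dominates $\mathbb{P}^1$ under the rational quotient $\pi: X\dashrightarrow\mathbb{P}^1$ by $B$, and whose exceptional points are exactly two points $x_0,x_\infty$. Let $\varphi:S:=\mathrm{Sym}_k(V_{E^{x_0}}\oplus V_{E^{x_\infty}})\otimes_kk[(r_{0j})_j,(r_{\infty j})_j]\to\mathrm{Cox}(X)$ be the natural surjective morphism of graded $k$-algebras. Then the ideal $\ker\varphi$ is principal, generated by the $G$-invariant relation $$s_\infty t_0-s_0t_\infty=\prod_jr_{0j}^{m_{0j}}\prod_jr_{\infty j}^{m_{\infty j}},$$ where $(m_{0j})_j$, $(m_{\infty j})_j$ are the families of non-negative integers defined by $[E^{x_0}]+[E^{x_\infty}]=\sum_jm_{0j}[X^{x_0}_j]+\sum_jm_{\infty j}[X^{x_\infty}_j]$ in $\mathrm{Cl}(X)$.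
   Context: $k$ is an algebraically closed field of characteristic zero; $G=\mathrm{SL}_2$ with matrix coordinates $g=\begin{bmatrix} g_1 & g_2 \\ g_3 & g_4 \end{bmatrix}$; $B$ upper triangular, $T$ diagonal, $\mu_n\subset T$ cyclic of order $n$; $\bar n=n$ if $n$ is odd, $\bar n=n/2$ if $n$ is even. A normal $G/\mu_n$-embedding is a normal $G$-variety $X$ with a $G$-equivariant open immersion $G/\mu_n\hookrightarrow X$. $\pi:X\dashrightarrow\mathbb{P}^1$ restricts on $G/\mu_n$ to the geometric quotient $G/\mu_n\to B\backslash G/\mu_n\simeq\mathbb{P}^1$, $g\mapsto[g_3^{\bar n}:g_4^{\bar n}]$; for $x\in\mathbb{P}^1$, $\pi^*(x)$ is the pullback Weil divisor, extended by closure from the domain of definition of $\pi$. A $B$-stable prime divisor is exceptional if it is not of the form $\pi^*(x)$; the images of the exceptional divisors are the exceptional points. Up to a $G$-equivariant automorphism, $x_0=[0:1]$ and $x_\infty=[1:0]$. For $i\in\{0,\infty\}$, $E^{x_i}$ is the unique $B$-stable non-$G$-stable prime divisor over $x_i$, and $(X^{x_i}_j)_j$ are the $G$-stable prime divisors over $x_i$ (their classes are linearly independent in $\mathrm{Cl}(X)$). $\mathrm{Cox}(X)=\bigoplus_{[D]\in\mathrm{Cl}(X)}H^0(X,\mathcal{O}_X(D))$ carries a natural $G$-action and embeds as a $\mathrm{Cl}(X)$-graded $G$-subalgebra in $\bigoplus_{[D]}\mathcal{O}(G)_{[D]}\,e^{[D]}$, where $e^{[D]}$ is the character attached to $[D]$,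 $\mathcal{O}(G)_{[D]}$ is the space of functions on $G$ of weight $[D]|_{G/\mu_n}\in\mathrm{Cl}(G/\mu_n)=\mathbb{Z}/n\mathbb{Z}$ under right multiplication by $\mu_n$, and $G$ acts by left multiplication. The canonical sections of $E^{x_0},E^{x_\infty},X^{x_i}_j$ are $s_0=g_3e^{[E^{x_0}]}$, $s_\infty=g_4e^{[E^{x_\infty}]}$, $r_{ij}=e^{[X^{x_i}_j]}$. $V_{E^{x_i}}\subset\mathrm{Cox}(X)$ denotes the simple two-dimensional $G$-module spanned by $G\cdot s_i$, with bases $(s_0,t_0):=(g_3e^{[E^{x_0}]},g_1e^{[E^{x_0}]})$ and $(s_\infty,t_\infty):=(g_4e^{[E^{x_\infty}]},g_2e^{[E^{x_\infty}]})$. The $r_{ij}$ are algebraically independent. *)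

(* Defs.v *)
From HB Require Import structures.
From mathcomp Require Import all_boot all_order all_algebra.
From mathcomp Require Import boolp classical_sets.
From mathcomp.multinomials Require Import freeg mpoly.

Set Implicit Arguments.
Unset Strict Implicit.
Unset Printing Implicit Defensive.

Import Order.TTheory GRing.Theory Num.Theory.

Local Open Scope classical_set_scope.
Local Open Scope ring_scope.
Local Open Scope quotient_scope.

(* -------------------------------------------------------------------------- *)
(* The group algebra R[M] of an abelian group M, written additively: finitely *)
(* supported functions M -> R, with convolution as product.  << f *g c >> is  *)
(* the element f e^c and coeff c u is the component of u in degree c.         *)

Definition galg (R : comNzRingType) (M : zmodType) := {freeg M / R}.

Section GroupAlgebra.
Variables (R : comNzRingType) (M : zmodType).
Local Notation A := (galg R M).

HB.instance Definition _ := GRing.Lmodule.on (galg R M).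

Definition galg_mul (u v : A) : A :=
  fglift (fun c => fglift (fun d => << c + d >> : A) v) u.

Definition galg_one : A := << 0 >>.

Lemma fgliftD (V : lmodType R) (f : M -> V) : {morph fglift f : u v / u + v}.
Proof.
have H := lift_is_additive f.
have H0 : fglift f 0 = 0 by rewrite -[X in fglift f X](subrr 0) H subrr.
have HN x : fglift f (- x) = - fglift f x by rewrite -sub0r H H0 sub0r.
by move=> u v; rewrite -{1}[v]opprK H HN opprK.
Qed.

Lemma fglift0 (V : lmodType R) (f : M -> V) : fglift f 0 = 0.
Proof. by apply: (addrI (fglift f 0)); rewrite -fgliftD !addr0. Qed.

Lemma galg_ind (P : A -> Prop) :
    P 0 -> (forall u v, P u -> P v -> P (u + v)) ->
    (forall a c, P << a *g c >>) -> forall u, P u.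
Proof. by move=> P0 PD PU u; rewrite -[u]freeg_sumE; apply: big_ind. Qed.

Lemma galg_mulDl : left_distributive galg_mul +%R.
Proof. by move=> u v w; rewrite /galg_mul fgliftD. Qed.

Lemma galg_mul0l v : galg_mul 0 v = 0.
Proof. by rewrite /galg_mul fglift0. Qed.

Lemma galg_mulUU a b c d :
  galg_mul << a *g c >> << b *g d >> = << a * b *g c + d >>.
Proof.
rewrite /galg_mul liftU liftU.
by apply/eqP/freeg_eqP => x; rewrite !coeffZ !coeffU mul1r mulrA.
Qed.

Lemma galg_mulUDr a c v w :
  galg_mul << a *g c >> (v + w)
  = galg_mul << a *g c >> v + galg_mul << a *g c >> w.
Proof. by rewrite /galg_mul !liftU fgliftD scalerDr. Qed.

Lemma galg_mulDr u v w : galg_mul u (v + w) = galg_mul u v + galg_mul u w.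
Proof.
elim/galg_ind: u => [|u1 u2 H1 H2|a c]; first by rewrite !galg_mul0l addr0.
  by rewrite !galg_mulDl H1 H2 addrACA.
exact: galg_mulUDr.
Qed.

Lemma galg_mul0r u : galg_mul u 0 = 0.
Proof. by apply: (addrI (galg_mul u 0)); rewrite -galg_mulDr !addr0. Qed.

Lemma galg_mulC : commutative galg_mul.
Proof.
move=> u v; elim/galg_ind: u => [|u1 u2 H1 H2|a c].
- by rewrite galg_mul0l galg_mul0r.
- by rewrite galg_mulDl galg_mulDr H1 H2.
elim/galg_ind: v => [|v1 v2 H1 H2|b d].
- by rewrite galg_mul0l galg_mul0r.
- by rewrite galg_mulDl galg_mulDr H1 H2.
by rewrite !galg_mulUU mulrC addrC.
Qed.

Lemma galg_mulA : associative galg_mul.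
Proof.
move=> u v w; elim/galg_ind: u => [|u1 u2 H1 H2|a c].
- by rewrite !galg_mul0l.
- by rewrite !galg_mulDl H1 H2.
elim/galg_ind: v => [|v1 v2 H1 H2|b d].
- by rewrite !(galg_mul0l, galg_mul0r).
- by rewrite !(galg_mulDl, galg_mulDr) H1 H2.
elim/galg_ind: w => [|w1 w2 H1 H2|e f].
- by rewrite !galg_mul0r.
- by rewrite !galg_mulDr H1 H2.
by rewrite !galg_mulUU mulrA addrA.
Qed.

Lemma galg_mul1 : left_id galg_one galg_mul.
Proof.
elim/galg_ind => [|u v Hu Hv|a c]; first exact: galg_mul0r.
  by rewrite galg_mulDr Hu Hv.
by rewrite galg_mulUU mul1r add0r.
Qed.

Lemma galg_one_neq0 : galg_one != 0.
Proof. by rewrite freegU_eq0 oner_eq0. Qed.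

HB.instance Definition _ := GRing.Zmodule_isComNzRing.Build (galg R M)
  galg_mulA galg_mulC galg_mul1 galg_mulDl galg_one_neq0.
End GroupAlgebra.

(* -------------------------------------------------------------------------- *)
(* G = SL_2 and its function field.                                           *)

Section FunctionField.
Variable k : closedFieldType.

(* The value at the matrix A of a polynomial in the four coordinates. *)
Definition evalmx (L : comNzRingType) (iota : k -> L) (A : 'M[L]_2)
    (P : {mpoly k[2 * 2]}) : L :=
  mmap iota (fun i => mxvec A 0 i) P.

(* The function field k(G), with the generic point of G: a polynomial         *)
(* vanishes at that matrix iff it vanishes on G, and its entries generate     *)
(* k(G) over k.  This determines k(G) and the matrix up to a unique           *)
(* isomorphism.                                                               *)
Record sl2_field := SL2Field {
  ff_sort :> fieldType;
  ff_cst : {rmorphism k -> ff_sort};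
  ff_gmx : 'M[ff_sort]_2;
  gmx_generic : forall P, evalmx ff_cst ff_gmx P = 0 <->
    forall h : 'M[k]_2, \det h = 1 -> evalmx idfun h P = 0;
  gmx_generate : forall f : ff_sort, exists P Q,
    evalmx ff_cst ff_gmx Q != 0 /\
    f = evalmx ff_cst ff_gmx P / evalmx ff_cst ff_gmx Q
}.

Variable F : sl2_field.

Local Notation cst := (ff_cst F).
Local Notation gmx := (ff_gmx F).

Definition g1 : F := gmx 0 0.
Definition g2 : F := gmx 0 1.
Definition g3 : F := gmx 1 0.
Definition g4 : F := gmx 1 1.

(* The pullback f(A) of f in k(G) along a dominant L-point A of G. *)
Definition pull (L : fieldType) (iota : k -> L) (A : 'M[L]_2) (f : F) : L :=
  xget 0 [set y | exists P Q,
    [/\ evalmx cst gmx Q != 0, f = evalmx cst gmx P / evalmx cst gmx Q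
      & y = evalmx iota A P / evalmx iota A Q]].

(* (h . f)(g) = f (h^-1 g) *)
Definition ltrans (h : 'M[k]_2) (f : F) : F :=
  pull cst (map_mx cst (invmx h) *m gmx) f.

Definition OG : set F := range (evalmx cst gmx).

Definition mat2 (L : Type) (a b c d : L) : 'M[L]_2 :=
  \matrix_(i, j) if i == 0 then (if j == 0 then a else b)
                 else (if j == 0 then c else d).

(* O(G / mu_n) : the functions in O(G) invariant under right multiplication   *)
(* by mu_n.                                                                   *)
Definition OGmu (n : nat) : set F :=
  [set f | exists2 P, f = evalmx cst gmx P &
     forall z : k, z ^+ n = 1 ->
       evalmx cst (gmx *m map_mx cst (mat2 z 0 0 z^-1)) P = f].

(* -------------------------------------------------------------------------- *)
(* Local rings in k(G).                                                       *)

Definition frac_of (A : set F) : set F :=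
  [set f | exists a b, [/\ A a, A b, b != 0 & f = a / b]].

(* k(G / mu_n) *)
Definition Kmu (n : nat) : set F := frac_of (OGmu n).

Definition affine_alg (A : set F) : Prop :=
  exists (r : nat) (x : 'I_r -> F), A = range (mmap cst x).

Definition prime_ideal (A p : set F) : Prop :=
  [/\ p `<=` A, p 0 /\ ~ p 1,
      forall a b, p a -> p b -> p (a + b),
      forall a b, A a -> p b -> p (a * b) &
      forall a b, A a -> A b -> p (a * b) -> p a \/ p b].

Definition loc (A p : set F) : set F :=
  [set f | exists a b, [/\ A a, A b, ~ p b & f = a / b]].

(* The local rings of the points of Spec A. *)
Definition locals (A : set F) : set (set F) :=
  [set O | exists2 p, prime_ideal A p & O = loc A p].

Definition unit_in (O : set F) (f : F) : Prop := [/\ f != 0, O f & O f^-1].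

Definition maxid (O : set F) : set F := [set f | O f /\ ~ unit_in O f].

Definition dominates (V O : set F) : Prop :=
  O `<=` V /\ maxid O `<=` maxid V.

Definition valuation_ring (K V : set F) : Prop :=
  [/\ V `<=` K, range cst `<=` V,
      forall a b, V a -> V b -> V (a - b) /\ V (a * b) &
      forall f, K f -> f != 0 -> V f \/ V f^-1].

Definition integral_over (O : set F) (f : F) : Prop :=
  exists p : {poly F}, [/\ p \is monic, forall i, O p`_i & root p f].

(* Discrete valuation rings of K and their valuations (ord K O 0 is junk). *)
Definition uniformizer (K O : set F) (t : F) : Prop :=
  [/\ t != 0, O t, ~ unit_in O t &
      forall f, K f -> f != 0 ->
        exists (u : F) (z : int), unit_in O u /\ f = u * t ^ z].

Definition is_dvr (K O : set F) : Prop := exists t, uniformizer K O t.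

Definition ord (K O : set F) (f : F) : int :=
  xget 0 [set z | exists t u, [/\ uniformizer K O t, unit_in O u
                                & f = u * t ^ z]].

(* -------------------------------------------------------------------------- *)
(* k(G x G) as the function field of G over F = k(G): hmx1 is the generic     *)
(* point of the first factor, with entries x, y, z, (1 + y z) / x, and hmx2   *)
(* that of the second one.                                                    *)

Definition FF : fieldType := {fraction {mpoly F[3]}}.
Definition inFF (f : F) : FF := tofrac (f%:MP_[3]).
Definition varFF (i : 'I_3) : FF := tofrac ('X_i : {mpoly F[3]}).

Definition hmx1 : 'M[FF]_2 :=
  let: (x, y, z) := (varFF 0, varFF 1, varFF 2%:R) in
  mat2 x y z ((1 + y * z) / x).
Definition hmx2 : 'M[FF]_2 := map_mx inFF gmx.

Definition pr1 : F -> FF := pull (inFF \o cst) hmx1.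
Definition pr2 : F -> FF := inFF.

(* The local ring of G x X at the point (h, x), where O is the local ring of  *)
(* X at x : the localization of O(G) (x) O at the prime m_h + m_x.            *)

Definition vanish_at (h : 'M[k]_2) : set F :=
  [set f | exists2 P, f = evalmx cst gmx P & evalmx idfun h P = 0].

Definition tens (O : set F) : set FF :=
  [set f | exists (r : nat) (a b : 'I_r -> F),
     (forall i, OG (a i) /\ O (b i)) /\ f = \sum_i pr1 (a i) * pr2 (b i)].

Definition tens_ideal (h : 'M[k]_2) (O : set F) : set FF :=
  [set f | exists (r : nat) (a b : 'I_r -> F),
     (forall i, [/\ OG (a i), O (b i) & vanish_at h (a i) \/ maxid O (b i)])
     /\ f = \sum_i pr1 (a i) * pr2 (b i)].

Definition local_prod (h : 'M[k]_2) (O : set F) : set FF :=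
  [set f | exists a b, [/\ tens O a, tens O b, ~ tens_ideal h O b
                         & f = a / b]].

(* -------------------------------------------------------------------------- *)
(* Normal G/mu_n-embeddings, as models of the function field k(G / mu_n): an  *)
(* integral separated k-scheme of finite type is the set of its local rings   *)
(* in its function field (Zariski, Chevalley), points of the scheme being     *)
(* identified with their local rings.  The open immersion of G/mu_n is an     *)
(* inclusion and the point h x has the local ring h . O_x.  The last field    *)
(* says that (h, x) |-> h x is a morphism G x X -> X: the pullback of         *)
(* O_{X, h x} is contained in O_{G x X, (h, x)}.                              *)
Record embedding (n : nat) := Embedding {
  pts :> set (set F);
  emb_charts : exists (r : nat) (A : 'I_r -> set F),
    [/\ forall i, affine_alg (A i), forall i, frac_of (A i) = Kmu n
      & pts = [set O | exists i, locals (A i) O]];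
  emb_separated : forall V O1 O2, valuation_ring (Kmu n) V ->
    pts O1 -> pts O2 -> dominates V O1 -> dominates V O2 -> O1 = O2;
  emb_normal : forall O f, pts O -> Kmu n f -> integral_over O f -> O f;
  emb_open : locals (OGmu n) `<=` pts;
  emb_stable : forall h O, \det h = 1 -> pts O -> pts (ltrans h @` O);
  emb_regular : forall h O f, \det h = 1 -> pts O -> (ltrans h @` O) f ->
    local_prod h O (pull (inFF \o cst) (hmx1 *m hmx2) f)
}.

End FunctionField.

Arguments OG {k} F _.
Arguments OGmu {k} F n _.
Arguments Kmu {k} F n _.

(* -------------------------------------------------------------------------- *)
(* Prime divisors: as X is normal, the points of codimension one are those    *)
(* whose local ring is a discrete valuation ring.                             *)

Section Divisors.
Variables (k : closedFieldType) (F : sl2_field k) (n : nat).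
Variable X : embedding F n.

Record prime_divisor := PrimeDivisor {
  pd_ring :> set F;
  pd_point : pts X pd_ring;
  pd_dvr : is_dvr (Kmu F n) pd_ring
}.

HB.instance Definition _ := gen_eqMixin prime_divisor.
HB.instance Definition _ := gen_choiceMixin prime_divisor.

Definition ordP (P : prime_divisor) (f : F) : int := ord (Kmu F n) P f.

Definition div_group := {freeg prime_divisor}.
HB.instance Definition _ := GRing.Lmodule.on div_group.

Definition principal (D : div_group) : bool :=
  `[< exists f, [/\ Kmu F n f, f != 0 & forall P, coeff P D = ordP P f] >].

End Divisors.

(* Valuations of discrete valuation rings are additive, whence principal      *)
(* divisors form a subgroup.                                                  *)
Section PrincipalClosed.
Variables (k : closedFieldType) (F : sl2_field k) (n : nat).
Variable X : embedding F n.
Implicit Types (P : prime_divisor X).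

Lemma evalmxM (L : comNzRingType) (iota : {rmorphism k -> L}) A :
  {morph evalmx iota A : P Q / P * Q}.
Proof. by move=> P Q; rewrite /evalmx rmorphM. Qed.

Lemma OGmuM : forall a b, OGmu F n a -> OGmu F n b -> OGmu F n (a * b).
Proof.
move=> a b [P -> HP] [Q -> HQ]; exists (P * Q); first by rewrite evalmxM.
by move=> z zn; rewrite evalmxM (HP z zn) (HQ z zn).
Qed.

Lemma OGmu1 : OGmu F n 1.
Proof. by exists 1 => *; rewrite /evalmx rmorph1. Qed.

Lemma Kmu1 : Kmu F n 1.
Proof.
by exists 1, 1; split; rewrite ?oner_eq0 ?divr1 //; exact: OGmu1.
Qed.

Lemma Kmu_div f g : Kmu F n f -> Kmu F n g -> g != 0 -> Kmu F n (f / g).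
Proof.
move=> [a [b [Ha Hb b0 ->]]] [c [d [Hc Hd d0 ->]]] g0.
have c0 : c != 0 by apply: contra_neq g0 => ->; rewrite mul0r.
exists (a * d), (b * c); split.
- exact: OGmuM.
- exact: OGmuM.
- exact: mulf_neq0.
by rewrite invf_div mulf_div.
Qed.

Lemma pd_ringM P a b : pd_ring P a -> pd_ring P b -> pd_ring P (a * b).
Proof.
have [r [A [Aaff _ XE]]] := emb_charts X.
have := pd_point P; rewrite XE => -[i [p [_ _ _ _ pP] ->]].
have AM c d : A i c -> A i d -> A i (c * d).
  by have [s [x ->]] := Aaff i; move=> [Q _ <-] [Q' _ <-];
     exists (Q * Q'); rewrite ?rmorphM.
move=> [a1 [a2 [Ha1 Ha2 pa2 ->]]] [b1 [b2 [Hb1 Hb2 pb2 ->]]].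
exists (a1 * b1), (a2 * b2); split.
- exact: AM.
- exact: AM.
- by move=> /(pP _ _ Ha2 Hb2) [].
by rewrite mulf_div.
Qed.

Lemma pd_ringK P : P `<=` Kmu F n.
Proof.
have [r [A [_ Afr XE]]] := emb_charts X.
have := pd_point P; rewrite XE => -[i [p [_ [p0 _] _ _ _] ->]].
move=> f [a [b [Ha Hb pb ->]]]; rewrite -(Afr i).
by exists a, b; split=> //; apply/eqP => b0; apply: pb; rewrite b0.
Qed.

Lemma unit_inM P a b : unit_in P a -> unit_in P b -> unit_in P (a * b).
Proof.
move=> [a0 Ha Ha'] [b0 Hb Hb']; split; first exact: mulf_neq0.
  exact: pd_ringM.
by rewrite invfM; exact: pd_ringM.
Qed.

Lemma unit_inV P a : unit_in P a -> unit_in P a^-1.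
Proof. by move=> [a0 Ha Ha']; split; rewrite ?invr_eq0 ?invrK. Qed.

Lemma unit_in1 P : unit_in P 1.
Proof.
have [t [t0 _ _ /(_ 1 Kmu1 (oner_neq0 _)) [u [z [Hu _]]]]] := pd_dvr P.
by rewrite -(mulfV (let: And3 h _ _ := Hu in h)); apply/unit_inM/unit_inV.
Qed.

Lemma unit_inX P u (z : int) : unit_in P u -> unit_in P (u ^ z).
Proof.
have H m v : unit_in P v -> unit_in P (v ^+ m).
  move=> Uv; elim: m => [|m IH]; first exact: unit_in1.
  by rewrite exprS; apply: unit_inM.
by move=> Uu; case: z => m; [exact: H|exact/unit_inV/H].
Qed.

Lemma pd_exprn P t m : pd_ring P t -> pd_ring P (t ^+ m).
Proof.
move=> Pt; elim: m => [|m IH]; first by case: (unit_in1 P).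
by rewrite exprS; exact: pd_ringM.
Qed.

Lemma unit_exp_eq0 P t (z : int) :
  uniformizer (Kmu F n) P t -> unit_in P (t ^ z) -> z = 0.
Proof.
move=> [t0 Pt tN _].
have H m : ~ unit_in P (t ^+ m.+1).
  move=> [_ _ H]; apply: tN; split=> //.
  have -> : t^-1 = t ^+ m * (t ^+ m.+1)^-1.
    by rewrite exprS invfM mulrCA mulfV ?mulr1 // expf_neq0.
  exact/pd_ringM/H/pd_exprn.
case: z => [[|m] //|m] Hz; first by case: (H m).
by case: (H m); rewrite -[_ ^+ _]invrK; apply: unit_inV.
Qed.

Lemma uniformizer_exp P t t' : uniformizer (Kmu F n) P t ->
  uniformizer (Kmu F n) P t' ->
  exists2 u, unit_in P u & t' = u * t.
Proof.
move=> Ht Ht'; have [t0 Pt tN Hd] := Ht; have [t0' Pt' tN' Hd'] := Ht'.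
have Kt := pd_ringK Pt; have Kt' := pd_ringK Pt'.
have [v [e [Uv E]]] := Hd t' Kt' t0'.
have [w [e' [Uw E']]] := Hd' t Kt t0.
have v0 : v != 0 by case: Uv.
have w0 : w != 0 by case: Uw.
have ee : e * e' = 1.
  apply/eqP; rewrite -subr_eq0; apply/eqP.
  apply: (unit_exp_eq0 Ht).
  have -> : t ^ (e * e' - 1) = (w * v ^ e')^-1.
    apply: (mulIf t0); rewrite -[X in _ * X = _](expr1z t) -expfzDr // subrK.
    rewrite -exprz_exp; apply: (mulfI (mulf_neq0 w0 (expfz_neq0 e' v0))).
    rewrite mulrA mulfV ?mul1r; last by rewrite mulf_neq0 ?expfz_neq0.
    by rewrite -mulrA -expfzMl -E -E'.
  by apply/unit_inV/unit_inM => //; apply: unit_inX.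
have : e = 1 \/ e = -1.
  have : e \is a GRing.unit by apply/unitrPr; exists e'.
  by move=> /orP[] /eqP ->; [left|right].
case=> ee1; exists v => //; first by rewrite {1}E ee1 expr1z.
exfalso; apply: tN; split=> //.
have -> : t^-1 = t' * v^-1 by rewrite E ee1 mulrAC mulfV // mul1r.
by apply: pd_ringM => //; case: Uv.
Qed.

Lemma ordPE P t u (z : int) : uniformizer (Kmu F n) P t -> unit_in P u ->
  ordP P (u * t ^ z) = z.
Proof.
move=> Ht Hu; rewrite /ordP /ord.
case: xgetP => [y _ [t' [u' [Ht' Hu' E]]]|/(_ z) /=]; last first.
  by case; exists t, u.
have t0 : t != 0 by case: Ht.
have [v Hv Ev] := uniformizer_exp Ht Ht'.
suff : y - z = 0 by move/eqP; rewrite subr_eq0 => /eqP.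
apply: (unit_exp_eq0 Ht).
have v0 : v != 0 by case: Hv.
have u0 : u' != 0 by case: Hu'.
set w := u' * v ^ y; have w0 : w != 0 by rewrite mulf_neq0 ?expfz_neq0.
have -> : t ^ (y - z) = u * w^-1.
  apply: (mulIf (expfz_neq0 z t0)); rewrite -expfzDr // subrK.
  apply: (mulfI w0); rewrite [RHS]mulrA (mulrC w (u / w)) mulfVK //.
  by rewrite E Ev expfzMl mulrA.
apply: unit_inM => //; apply: unit_inV; apply: unit_inM => //.
exact: unit_inX.
Qed.

Lemma ordP_div P f g : Kmu F n f -> Kmu F n g -> f != 0 -> g != 0 ->
  ordP P (f / g) = ordP P f - ordP P g.
Proof.
move=> Kf Kg f0 g0; have [t Ht] := pd_dvr P.
have [t0 _ _ Hd] := Ht.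
have [u [y [Hu ->]]] := Hd f Kf f0; have [v [z [Hv ->]]] := Hd g Kg g0.
have -> : u * t ^ y / (v * t ^ z) = u / v * t ^ (y - z).
  by rewrite invfM mulrACA expfzDr // invr_expz.
rewrite !ordPE //; apply: unit_inM => //; exact: unit_inV.
Qed.

Lemma principal_zmod_closed : zmod_closed (@principal k F n X).
Proof.
split=> [|D E /asboolP [f [Kf f0 Df]] /asboolP [g [Kg g0 Eg]]]; apply/asboolP.
  exists 1; split; [exact: Kmu1|exact: oner_neq0|move=> P].
  rewrite coeff0 -[X in ordP P X](divr1 1) ordP_div ?oner_neq0 ?subrr //;
  exact: Kmu1.
exists (f / g); split; first exact: Kmu_div.
  by rewrite mulf_neq0 ?invr_eq0.
by move=> P; rewrite coeffB Df Eg ordP_div.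
Qed.

HB.instance Definition _ :=
  GRing.isZmodClosed.Build (div_group X) (@principal k F n X)
    principal_zmod_closed.
End PrincipalClosed.

Section Embeddings.
Variables (k : closedFieldType) (F : sl2_field k) (n : nat).
Variable X : embedding F n.
Implicit Types (P Q E : prime_divisor X) (D : div_group X).

Definition class_group : zmodType := Quotient.quot
  (GRing.ZmodClosed.clone (div_group X) (@principal k F n X) _).

Definition cls D : class_group := \pi_class_group D.

Definition class_of P : class_group := cls << P >>.

(* -------------------------------------------------------------------------- *)
(* The rational quotient pi by B.  A point [c : 1] of P^1 is Some c, and      *)
(* [1 : 0] is None, for the coordinates [g_3 ^ nbar : g_4 ^ nbar].            *)

Definition nbar : nat := if odd n then n else n./2.

Definition P1 : Type := option k.
Definition x_zero : P1 := Some 0.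
Definition x_infty : P1 := None.

Definition ycoord : F := (g3 F / g4 F) ^+ nbar.

Definition local_param (x : P1) : F :=
  if x is Some c then ycoord - ff_cst F c else ycoord^-1.

(* pi is defined at the generic point of P; it maps it to x iff the local     *)
(* parameter at x has positive order along P, which is then the coefficient   *)
(* of P in the pullback of x.                                                 *)
Definition pi_star (x : P1) : prime_divisor X -> int :=
  fun P => Num.max 0 (ordP P (local_param x)).

Definition over (x : P1) P : Prop := 0 < pi_star x P.

(* The generic point of P is mapped to that of P^1: the local ring of P       *)
(* contains the function field k(y) of P^1.                                   *)
Definition dominates_P1 P : Prop := forall q : {poly k}, q != 0 ->
  unit_in (pd_ring P) (map_poly (ff_cst F) q).[ycoord].

Definition stable_under (h : 'M[k]_2) P : Prop :=
  ltrans h @` pd_ring P = pd_ring P.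

Definition G_stable P : Prop := forall h, \det h = 1 -> stable_under h P.

Definition B_stable P : Prop :=
  forall h : 'M[k]_2, \det h = 1 -> h 1 0 = 0 -> stable_under h P.

Definition exceptional P : Prop :=
  B_stable P /\ ~ exists x, pi_star x = (fun Q => (Q == P)%:Z).

Definition exceptional_point (x : P1) : Prop :=
  exists2 P, exceptional P & over x P.

Definition color_over (x : P1) E : Prop :=
  [/\ B_stable E, ~ G_stable E & over x E].

Definition enum_G_stable_over (x : P1) (m : nat)
    (Y : 'I_m -> prime_divisor X) : Prop :=
  injective Y /\ forall P, (G_stable P /\ over x P) <-> exists j, P = Y j.

(* -------------------------------------------------------------------------- *)
(* The Cox ring, as a graded subalgebra of the group algebra of Cl(X) over    *)
(* k(G).  The divisor D restricted to G/mu_n pulls back to a principal        *)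
(* divisor div(f_D) of G (there is no ramification, G -> G/mu_n being etale), *)
(* and a section s in H^0(X, O(D)) is mapped to s f_D e^[D]; the image of     *)
(* H^0(X, O(D)) only depends on the class of D, and the canonical section of  *)
(* an effective D is mapped to f_D e^[D].                                     *)

Definition sections D : set F :=
  [set s | Kmu F n s /\ (s != 0 -> forall P, 0 <= ordP P s + coeff P D)].

Definition equation_on_G D (f : F) : Prop :=
  f != 0 /\ forall O P, locals (OG F) O -> is_dvr setT O ->
    pd_ring P = O `&` Kmu F n -> ord setT O f = coeff P D.

Definition cox_part (c : class_group) : set F :=
  [set f | exists D s fD,
     [/\ cls D = c, sections D s, equation_on_G D fD & f = s * fD]].

Definition cox_ambient : comNzRingType := galg F class_group.

Definition cox : set cox_ambient :=
  [set u | forall c, c \in dom u -> cox_part c (coeff c u)].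

Definition echar (f : F) (c : class_group) : cox_ambient := << f *g c >>.

(* -------------------------------------------------------------------------- *)
(* S = Sym(V_0 (+) V_infty) (x) k[r_0, r_infty], as a polynomial ring.  The   *)
(* bases (t, s) of V_0 and V_infty are indexed by the rows of the generic     *)
(* matrix, of which V_0 is the first column and V_infty the second one:       *)
(* phi t_0 = g_1 e^[E_0], phi s_0 = g_3 e^[E_0], phi t_infty = g_2 e^[E_inf], *)
(* phi s_infty = g_4 e^[E_inf], and phi r_ij = e^[Y_ij].                      *)

Variables (p q : nat).

Definition cases (T : Type) (a b : nat) (f : 'I_a -> T) (f' : 'I_b -> T)
    (i : 'I_(a + b)) : T :=
  match split i with inl j => f j | inr j => f' j end.

Definition symS : comNzRingType := {mpoly k[(2 + 2) + (p + q)]}.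

Definition v_zero (i : 'I_2) : symS := 'X_(lshift (p + q) (lshift 2 i)).
Definition v_infty (i : 'I_2) : symS := 'X_(lshift (p + q) (rshift 2 i)).
Definition r_zero (j : 'I_p) : symS := 'X_(rshift (2 + 2) (lshift q j)).
Definition r_infty (j : 'I_q) : symS := 'X_(rshift (2 + 2) (rshift p j)).

Definition t_zero : symS := v_zero 0.
Definition s_zero : symS := v_zero 1.
Definition t_infty : symS := v_infty 0.
Definition s_infty : symS := v_infty 1.

Definition phi (E0 Einf : prime_divisor X)
    (Y0 : 'I_p -> prime_divisor X) (Yinf : 'I_q -> prime_divisor X) :
    symS -> cox_ambient :=
  mmap (fun c => echar (ff_cst F c) 0)
    (cases (cases (fun i => echar (ff_gmx F i 0) (class_of E0))
                  (fun i => echar (ff_gmx F i 1) (class_of Einf)))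
           (cases (fun j => echar 1 (class_of (Y0 j)))
                  (fun j => echar 1 (class_of (Yinf j))))).

(* The action of h in G on S, from (h . f)(g) = f (h^-1 g). *)
Definition symS_act (h : 'M[k]_2) : symS -> symS :=
  mmap (fun c => c%:MP)
    (cases (cases (fun i => \sum_j (invmx h i j)%:MP * v_zero j)
                  (fun i => \sum_j (invmx h i j)%:MP * v_infty j))
           (cases r_zero r_infty)).

Definition cox_relation (m0 : 'I_p -> nat) (minf : 'I_q -> nat) : symS :=
  s_infty * t_zero - s_zero * t_infty
  - (\prod_j r_zero j ^+ m0 j) * (\prod_j r_infty j ^+ minf j).

Definition multiplicities (E0 Einf : prime_divisor X)
    (Y0 : 'I_p -> prime_divisor X) (Yinf : 'I_q -> prime_divisor X)
    (m0 : 'I_p -> nat) (minf : 'I_q -> nat) : Prop :=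
  class_of E0 + class_of Einf
  = \sum_j class_of (Y0 j) *+ m0 j + \sum_j class_of (Yinf j) *+ minf j.

End Embeddings.

(* Main.v *)
(* A prime divisor P of X which does not meet the open orbit is G-stable: the
   boundary divisors are finitely many (the coordinate rings of the charts are
   noetherian), and the unipotent one-parameter groups, which generate SL_2, are
   divisible and so permute them trivially.  The Weyl group inverts g_1/g_3 and
   g_2/g_4 up to sign, hence these have order 0 along a G-stable P, and
   1 = g_1 g_4 - g_2 g_3 forces ord_P(g_3 g_4) <= 0.  Since g_3 g_4 is a
   uniformizer along E_0 and E_infty and invertible on the rest of the open orbit,
   div(g_3 g_4) = E_0 + E_infty - (boundary), which gives the multiplicities; the
   boundary divisors over a point c other than 0 and infinity are excluded because
   the color over c would be a second component of pi^*(c).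

   Units of O(G) are constant: writing k(G) = L(g_3) with L the field of invariants
   of the unipotent group g_3 |-> g_3 + t g_1, a function without zeros or poles at
   the irreducible polynomials of L[g_3] lies in L; doing this for two opposite
   groups leaves the SL_2-invariants only.  Hence the classes of the boundary
   divisors are linearly independent.

   For the kernel, division by the relation (with leading monomial t_0 s_infty)
   leaves polynomials without monomials divisible by t_0 s_infty.  The remaining ones
   of a given degree in Cl(X) have distinct images among the monomials
   g_1^a g_2^c g_3^b g_4^d with a d = 0, which form a basis of O(G). *)
Require Import Defs.
From HB Require Import structures.
From mathcomp Require Import all_boot all_order all_algebra.
From mathcomp Require Import cyclic separable cyclotomic.
From mathcomp Require Import boolp classical_sets.
From mathcomp.multinomials Require Import freeg mpoly.
From mathcomp Require Import ring zify.

Set Implicit Arguments.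
Unset Strict Implicit.
Unset Printing Implicit Defensive.
Import Order.TTheory GRing.Theory Num.Theory.
Local Open Scope ring_scope.
Local Open Scope classical_set_scope.

(** * Discrete valuation rings as subsets of the function field *)

Section Subrings.
Variables (k : closedFieldType) (F : sl2_field k).
Implicit Types (A O K p q : set F) (a b f t u : F).

(** The obstacle is that X is given only by local rings inside k(G/mu_n), while g_3 and g_4 live in
    k(G) and are not mu_n-invariant in general. Rings, fields and divisors are therefore predicates
    on the one field [F], and two bridges join the levels. An invariant fraction can be rewritten
    with invariant numerator and denominator without entering a given prime, by decomposition into
    mu_n-weights; so a place of G restricts to a point of G/mu_n. And separatedness identifies a
    prime divisor whose ring contains O(G/mu_n) with the local ring of its centre there; the
    boundary consists of the other prime divisors. The places of G that are needed come from
    coordinate systems in which a unipotent group moves only two of the four coordinates; there x_3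
    generates a prime of O(G), which recognizes a color by its equation alone. That phi takes values
    in Cox(X) rests on t_0 being g_1/g_3 times the equation g_3 of E_0, where g_1/g_3 has at most a
    simple pole, along E_0. Sums of sections of linearly equivalent divisors require comparing
    orders on G and on G/mu_n, hence absence of ramification along the two colors. *)

Definition subring A : Prop :=
  [/\ A 1, forall a b, A a -> A b -> A (a - b) &
      forall a b, A a -> A b -> A (a * b)].

Definition subfield K : Prop := subring K /\ forall a, K a -> K a^-1.

Section SubringTheory.
Variables (A : set F) (Ar : subring A).

Lemma subr_1 : A 1. Proof. by case: Ar. Qed.
Lemma subr_B a b : A a -> A b -> A (a - b). Proof. by case: Ar => _ h _; apply: h. Qed.
Lemma subr_M a b : A a -> A b -> A (a * b). Proof. by case: Ar => _ _; apply. Qed.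
Lemma subr_0 : A 0. Proof. by rewrite -(subrr 1); apply: subr_B; exact: subr_1. Qed.
Lemma subr_N a : A a -> A (- a).
Proof. by move=> ?; rewrite -sub0r; apply: subr_B => //; exact: subr_0. Qed.
Lemma subr_D a b : A a -> A b -> A (a + b).
Proof. by move=> ? ?; rewrite -[b]opprK; apply: subr_B => //; exact: subr_N. Qed.
Lemma subr_X a m : A a -> A (a ^+ m).
Proof.
by move=> Aa; elim: m => [|m IH]; [exact: subr_1|rewrite exprS; exact: subr_M].
Qed.
Lemma subr_sum I (r : seq I) (P : pred I) (f : I -> F) :
  (forall i, P i -> A (f i)) -> A (\sum_(i <- r | P i) f i).
Proof. by move=> H; apply: big_ind => //; [exact: subr_0|exact: subr_D]. Qed.
Lemma subr_prod I (r : seq I) (P : pred I) (f : I -> F) :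
  (forall i, P i -> A (f i)) -> A (\prod_(i <- r | P i) f i).
Proof. by move=> H; apply: big_ind => //; [exact: subr_1|exact: subr_M]. Qed.

End SubringTheory.

Lemma subfield_div K a b : subfield K -> K a -> K b -> K (a / b).
Proof. by move=> [Kr Ki] Ka Kb; apply: subr_M => //; exact: Ki. Qed.

Lemma subfieldT : subfield (@setT F). Proof. by split. Qed.

Lemma subringI A B : subring A -> subring B -> subring (A `&` B).
Proof.
move=> Ar Br; split.
- by split; exact: subr_1.
- by move=> a b [? ?] [? ?]; split; exact: subr_B.
- by move=> a b [? ?] [? ?]; split; exact: subr_M.
Qed.

Lemma frac_of_sub A : subring A -> A `<=` frac_of A.
Proof.
move=> Ar a Aa; exists a, 1; split; rewrite ?oner_neq0 ?divr1 //.
exact: subr_1.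
Qed.

Lemma frac_of_subfield A : subring A -> subfield (frac_of A).
Proof.
move=> Ar; split; [split|].
- by apply: frac_of_sub => //; exact: subr_1.
- move=> _ _ [a [b [Aa Ab b0 ->]]] [c [d [Ac Ad d0 ->]]].
  exists (a * d - c * b), (b * d); split; rewrite ?mulf_neq0 //.
  - by apply: subr_B => //; exact: subr_M.
  - exact: subr_M.
  - by rewrite -mulNr addf_div // mulNr.
- move=> _ _ [a [b [Aa Ab b0 ->]]] [c [d [Ac Ad d0 ->]]].
  exists (a * c), (b * d); split; rewrite ?mulf_neq0 ?mulf_div //; exact: subr_M.
move=> _ [a [b [Aa Ab b0 ->]]]; have [->|a0] := eqVneq a 0.
  by rewrite mul0r invr0; apply: frac_of_sub => //; exact: subr_0.
by exists b, a; rewrite invf_div.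
Qed.

Lemma prime_ideal_notin A p a b :
  prime_ideal A p -> A a -> A b -> ~ p a -> ~ p b -> ~ p (a * b).
Proof. by move=> [_ _ _ _ H] Aa Ab pa pb /(H _ _ Aa Ab) []. Qed.

Lemma prime_idealX A p a m : subring A ->
  prime_ideal A p -> A a -> p (a ^+ m) -> p a.
Proof.
move=> Ar Pp Aa; elim: m => [|m IH].
  by rewrite expr0; case: Pp => _ [].
by rewrite exprS; case: Pp => _ _ _ _ H /(H _ _ Aa (subr_X Ar m Aa)) [].
Qed.

Lemma loc_sub A p : subring A -> prime_ideal A p -> A `<=` loc A p.
Proof.
move=> Ar [_ [_ p1] _ _ _] a Aa; exists a, 1; split; rewrite ?divr1 //.
exact: subr_1.
Qed.

Lemma loc_subring A p : subring A -> prime_ideal A p -> subring (loc A p).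
Proof.
move=> Ar Pp; have p0 b : ~ p b -> b != 0.
  by case: Pp => _ [p0 _] _ _ _; apply: contra_notN => /eqP ->.
split.
- by apply: loc_sub => //; exact: subr_1.
- move=> _ _ [a [b [Aa Ab b0 ->]]] [c [d [Ac Ad d0 ->]]].
  exists (a * d - c * b), (b * d); split.
  - by apply: subr_B => //; exact: subr_M.
  - exact: subr_M.
  - exact: prime_ideal_notin Pp _ _ _ _.
  - by rewrite -mulNr addf_div ?p0 // mulNr.
- move=> _ _ [a [b [Aa Ab b0 ->]]] [c [d [Ac Ad d0 ->]]].
  exists (a * c), (b * d); split; rewrite ?mulf_div //; try exact: subr_M.
  exact: prime_ideal_notin Pp _ _ _ _.
Qed.

Lemma loc_frac A p : prime_ideal A p -> loc A p `<=` frac_of A.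
Proof.
move=> [_ [p0 _] _ _ _] _ [a [b [Aa Ab pb ->]]]; exists a, b; split=> //.
by apply/eqP => b0; apply: pb; rewrite b0.
Qed.

Lemma loc_maxid A p f : subring A -> prime_ideal A p -> A f ->
  maxid (loc A p) f <-> p f.
Proof.
move=> Ar Pp Af; have [pA [p0 p1] pD pM pP] := Pp; split.
  move=> [_ H]; apply: contrapT => pf; apply: H.
  have f0 : f != 0 by apply/eqP => f0; apply: pf; rewrite f0.
  split=> //; first exact: loc_sub.
  by exists 1, f; rewrite div1r; split=> //; exact: subr_1.
move=> pf; split; first exact: loc_sub.
move=> [f0 _ [a [b [Aa Ab pb E]]]]; apply: pb.
have b0 : b != 0.
  by apply/eqP => b0; move: E; rewrite b0 invr0 mulr0 => /eqP; rewrite invr_eq0 (negPf f0).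
suff -> : b = a * f by exact: pM.
by move/(congr1 (fun x => x * b * f)): E; rewrite divfK // mulrAC mulVf // mul1r.
Qed.

(** [is_dvr] only prescribes how the nonzero elements of [K] factor; that [O] is a ring contained in
    [K] is recorded apart. *)
Definition dvr K O : Prop := [/\ subfield K, subring O, O `<=` K & is_dvr K O].

(** * Orders and maximal ideals of a discrete valuation ring *)

Section DVR.
Variables (K O : set F) (D : dvr K O).

Let Kf : subfield K. Proof. by case: D. Qed.
Let Kr : subring K. Proof. by case: Kf. Qed.
Let Or : subring O. Proof. by case: D. Qed.

Lemma dvr_sub f : O f -> K f. Proof. by case: D => _ _ H _; exact: H. Qed.

Lemma unit_in_1 : unit_in O 1.
Proof. by split; rewrite ?oner_neq0 ?invr1 //; exact: subr_1. Qed.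
Lemma unit_in_M a b : unit_in O a -> unit_in O b -> unit_in O (a * b).
Proof.
move=> [a0 Oa Oa'] [b0 Ob Ob']; split; rewrite ?mulf_neq0 ?invfM //; exact: subr_M.
Qed.
Lemma unit_in_V a : unit_in O a -> unit_in O a^-1.
Proof. by move=> [a0 Oa Oa']; split; rewrite ?invr_eq0 ?invrK. Qed.
Lemma unit_in_Xn a m : unit_in O a -> unit_in O (a ^+ m).
Proof.
move=> Ua; elim: m => [|m IH]; first exact: unit_in_1.
by rewrite exprS; exact: unit_in_M.
Qed.
Lemma unit_in_Xz a (z : int) : unit_in O a -> unit_in O (a ^ z).
Proof.
by move=> Ua; case: z => m; [exact: unit_in_Xn|exact/unit_in_V/unit_in_Xn].
Qed.
Lemma unit_in_N a : unit_in O a -> unit_in O (- a).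
Proof. by move=> [a0 Oa Oa']; split; rewrite ?oppr_eq0 ?invrN //; exact: subr_N. Qed.
Lemma unit_in_div a b : unit_in O a -> unit_in O b -> unit_in O (a / b).
Proof. by move=> Ua Ub; apply/unit_in_M/unit_in_V. Qed.
Lemma unit_in_mull a b : O a -> O b -> unit_in O (a * b) -> unit_in O a.
Proof.
move=> Oa Ob [ab0 _ H]; have [a0 b0] : a != 0 /\ b != 0.
  by move: ab0; rewrite mulf_eq0 negb_or => /andP.
split=> //; suff -> : a^-1 = b * (a * b)^-1 by exact: subr_M.
by field; rewrite a0 b0.
Qed.

Lemma maxidM a b : O a -> maxid O b -> maxid O (a * b).
Proof.
move=> Oa [Ob bN]; split; first exact: subr_M.
by rewrite mulrC => /(unit_in_mull Ob Oa).
Qed.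

Lemma uniformizer_maxid t : uniformizer K O t -> maxid O t.
Proof. by move=> []. Qed.

Lemma uniformizer_Xz_eq0 t (z : int) :
  uniformizer K O t -> unit_in O (t ^ z) -> z = 0.
Proof.
move=> [t0 Ot tN _].
have H m : ~ unit_in O (t ^+ m.+1).
  by rewrite exprS => /(unit_in_mull Ot (subr_X Or m Ot)).
by case: z => [[|m] //|m] Hz; [case: (H m)|case: (H m); rewrite -[_ ^+ _]invrK; exact: unit_in_V].
Qed.

(** Each of [t], [t'] is a unit times a power of the other, with exponents [e'], [e]; then
    [t ^ (e * e' - 1)] is a unit, so [e * e' = 1]. The case [e = -1] would put [t^-1] in [O]. *)
Lemma uniformizer_assoc t t' : uniformizer K O t -> uniformizer K O t' ->
  exists2 u, unit_in O u & t' = u * t.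
Proof.
move=> Ht Ht'; have [t0 Ot tN Hd] := Ht; have [t0' Ot' tN' Hd'] := Ht'.
have [v [e [Uv E]]] := Hd t' (dvr_sub Ot') t0'.
have [w [e' [Uw E']]] := Hd' t (dvr_sub Ot) t0.
have v0 : v != 0 by case: Uv.
have w0 : w != 0 by case: Uw.
have ee : e * e' = 1.
  apply/eqP; rewrite -subr_eq0; apply/eqP; apply: (uniformizer_Xz_eq0 Ht).
  have -> : t ^ (e * e' - 1) = (w * v ^ e')^-1.
    have Et : t ^ e = v^-1 * t' by rewrite E mulKf.
    have Et' : t' ^ e' = w^-1 * t by rewrite [in RHS]E' mulKf.
    rewrite expfzDr // -exprz_exp Et expfzMl Et' exprz_inv -invr_expz.
    rewrite exprN1; by field; rewrite w0 t0 !expfz_neq0.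
  by apply/unit_in_V/unit_in_M => //; apply: unit_in_Xz.
have : e = 1 \/ e = -1.
  have : e \is a GRing.unit by apply/unitrPr; exists e'.
  by move=> /orP[] /eqP ->; [left|right].
case=> ee1; exists v => //; first by rewrite {1}E ee1 expr1z.
exfalso; apply: tN; split=> //.
have -> : t^-1 = t' * v^-1 by rewrite E ee1 mulrAC mulfV // mul1r.
by apply: subr_M => //; case: Uv.
Qed.

(** [ord] takes its value from an arbitrarily chosen factorization; as uniformizers agree up to
    units, any factorization computes it. *)
Lemma ordE t u (z : int) : uniformizer K O t -> unit_in O u ->
  ord K O (u * t ^ z) = z.
Proof.
move=> Ht Hu; rewrite /ord.
case: xgetP => [y _ [t' [u' [Ht' Hu' E]]]|/(_ z) /=]; last first.
  by case; exists t, u.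
have t0 : t != 0 by case: Ht.
have [v Hv Ev] := uniformizer_assoc Ht Ht'.
suff : y - z = 0 by move/eqP; rewrite subr_eq0 => /eqP.
apply: (uniformizer_Xz_eq0 Ht).
have v0 : v != 0 by case: Hv.
have u0 : u' != 0 by case: Hu'.
have -> : t ^ (y - z) = u / (u' * v ^ y).
  have : u * t ^ z / (u' * v ^ y) = t ^ y.
    by rewrite E Ev expfzMl; field; rewrite u0 expfz_neq0.
  rewrite expfzDr // -invr_expz => <-.
  by field; rewrite u0 !expfz_neq0.
by apply: unit_in_div => //; apply: unit_in_M => //; exact: unit_in_Xz.
Qed.

Lemma uniformizer_mul t u : uniformizer K O t -> unit_in O u ->
  uniformizer K O (u * t).
Proof.
move=> Ht Uu; have [t0 Ot Nt H] := Ht; have [u0 Ou Ou'] := Uu.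
split; [by rewrite mulf_neq0|exact: subr_M| |].
  by rewrite mulrC => /(unit_in_mull Ot Ou).
move=> f Kf0 f0; have [v [z [Uv ->]]] := H f Kf0 f0.
exists (v / u ^ z), z; split; first by apply: unit_in_div => //; exact: unit_in_Xz.
by rewrite expfzMl; field; rewrite expfz_neq0.
Qed.

Lemma ord_decomp f : K f -> f != 0 ->
  exists t u, [/\ uniformizer K O t, unit_in O u & f = u * t ^ ord K O f].
Proof.
move=> Kf0 f0; have [_ _ _ [t Ht]] := D; have [_ _ _ H] := Ht.
have [u [z [Hu E]]] := H f Kf0 f0; exists t, u; split=> //.
by rewrite [in RHS]E ordE.
Qed.

Lemma ord_uniformizer t : uniformizer K O t -> ord K O t = 1.
Proof.
by move=> Ht; rewrite -[t]mul1r -[t]expr1z ordE //; exact: unit_in_1.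
Qed.

Lemma ord_unit u : unit_in O u -> ord K O u = 0.
Proof.
move=> Hu; have [_ _ _ [t Ht]] := D.
by rewrite -[u]mulr1 -[1](expr0z t) ordE.
Qed.

Lemma ord_uniformizerE t f : uniformizer K O t -> K f -> f != 0 ->
  exists2 u, unit_in O u & f = u * t ^ ord K O f.
Proof.
move=> Ht Kf0 f0; have [_ _ _ H] := Ht.
by have [u [z [Hu E]]] := H f Kf0 f0; exists u => //; rewrite [in RHS]E ordE.
Qed.

Lemma ordM f g : K f -> K g -> f != 0 -> g != 0 ->
  ord K O (f * g) = ord K O f + ord K O g.
Proof.
move=> Kf0 Kg f0 g0; have [_ _ _ [t Ht]] := D; have [t0 _ _ _] := Ht.
have [u Hu Ef] := ord_uniformizerE Ht Kf0 f0.
have [v Hv Eg] := ord_uniformizerE Ht Kg g0.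
rewrite {1}Ef {1}Eg mulrACA -expfzDr // ordE //; exact: unit_in_M.
Qed.

Lemma ordV f : K f -> f != 0 -> ord K O f^-1 = - ord K O f.
Proof.
move=> Kf0 f0; have Kf' : K f^-1 by case: Kf => _; exact.
apply/eqP; rewrite -addr_eq0; apply/eqP.
by rewrite -ordM ?invr_eq0 // mulVf // ord_unit; last exact: unit_in_1.
Qed.

Lemma ordX f m : K f -> f != 0 -> ord K O (f ^+ m) = ord K O f *+ m.
Proof.
move=> Kf0 f0; elim: m => [|m IH]; first by rewrite expr0 ord_unit; last exact: unit_in_1.
by rewrite exprS ordM ?expf_neq0 ?IH ?mulrS //; exact: subr_X.
Qed.


Lemma ord_ge0 f : K f -> f != 0 -> 0 <= ord K O f <-> O f.
Proof.
move=> Kf0 f0; have [_ _ _ [t Ht]] := D; have [t0 Ot Nt _] := Ht.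
have [u Hu E] := ord_uniformizerE Ht Kf0 f0; have [u0 Ou Ou'] := Hu; split.
  by case: (ord K O f) E => // z -> _; apply: subr_M => //; exact: subr_X.
move=> Of; rewrite leNgt; apply/negP => lt0; apply: Nt.
case: (ord K O f) E lt0 => // z E _.
have E1 : t^-1 = u^-1 * f * t ^+ z.
  rewrite E NegzE -invr_expz -exprnP exprS.
  by field; rewrite u0 t0 expf_neq0.
split=> //; rewrite E1; apply: subr_M; [|exact: subr_M|exact: subr_X] => //.
Qed.

Lemma ord_eq0 f : K f -> f != 0 -> ord K O f = 0 <-> unit_in O f.
Proof.
move=> Kf0 f0; split; last exact: ord_unit.
move=> E; have [t [u [Ht Hu ->]]] := ord_decomp Kf0 f0.
by rewrite E expr0z mulr1.
Qed.

Lemma ord_gt0 f : K f -> f != 0 -> 0 < ord K O f <-> maxid O f.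
Proof.
move=> Kf0 f0; rewrite lt0r; split.
  by move=> /andP[/eqP N0 /(ord_ge0 Kf0 f0) Of]; split=> // /(ord_eq0 Kf0 f0).
by move=> [/(ord_ge0 Kf0 f0) -> Nu]; rewrite andbT; apply/eqP => /(ord_eq0 Kf0 f0).
Qed.

(** Divide by the term of smaller order: the quotient plus 1 is then in [O]. The bounds are guarded
    by nonvanishing because the order of 0 is a junk value. *)
Lemma ordD_ge f g (m : int) : K f -> K g -> f + g != 0 ->
  (f != 0 -> m <= ord K O f) -> (g != 0 -> m <= ord K O g) -> m <= ord K O (f + g).
Proof.
move=> Kf0 Kg fg0 Hf Hg.
have [f0|f0] := eqVneq f 0; first by rewrite f0 add0r in fg0 *; exact: Hg.
have [g0|g0] := eqVneq g 0; first by rewrite g0 addr0 in fg0 *; exact: Hf.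
have H a b : K a -> K b -> a + b != 0 -> a != 0 -> b != 0 ->
    ord K O b <= ord K O a -> ord K O b <= ord K O (a + b).
  move=> Ka Kb ab0 a0 b0 le; have Kab : K (a / b) by exact: subfield_div.
  have nab : a / b != 0 by rewrite mulf_neq0 ?invr_eq0.
  have Oab : O (a / b).
    apply/ord_ge0 => //; rewrite ordM ?invr_eq0 //; last by case: Kf => _; exact.
    by rewrite ordV // subr_ge0.
  have E : a + b = (a / b + 1) * b by field.
  have n1 : a / b + 1 != 0 by apply: contra_neq ab0 => E1; rewrite E E1 mul0r.
  have K1 : K (a / b + 1) by apply: (subr_D Kr) => //; exact: subr_1.
  rewrite E ordM // lerDr; apply/ord_ge0 => //.
  by apply: (subr_D Or) => //; exact: subr_1.
case: (leP (ord K O g) (ord K O f)) => [le|/ltW le].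
  by apply: le_trans (Hg g0) _; exact: H.
by apply: le_trans (Hf f0) _; rewrite addrC in fg0 *; exact: H.
Qed.

Lemma maxid_0 : maxid O 0.
Proof. by split; [exact: subr_0|case; rewrite eqxx]. Qed.

Lemma dvr_total f : K f -> O f \/ maxid O f^-1.
Proof.
move=> Kf0; have [->|f0] := eqVneq f 0; first by left; exact: subr_0.
have K' : K f^-1 by case: Kf => _; apply.
case: (leP 0 (ord K O f)) => H; first by left; apply/ord_ge0.
by right; apply/ord_gt0; rewrite ?invr_eq0 // ordV // oppr_gt0.
Qed.

Lemma maxidD a b : maxid O a -> maxid O b -> maxid O (a + b).
Proof.
wlog H : a b / O (a / b).
  move=> H Ma Mb.
  have [Ka Kb] : K a /\ K b by case: Ma Mb => [? _] [? _]; split; exact: dvr_sub.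
  have [|[]] := dvr_total (subfield_div Kf Ka Kb); first by move=> ?; exact: H.
  by rewrite invf_div => ? _; rewrite addrC; exact: H.
move=> Ma Mb; have [->|b0] := eqVneq b 0; first by rewrite addr0.
have -> : a + b = (a / b + 1) * b by field.
by apply: maxidM => //; apply: subr_D => //; exact: subr_1.
Qed.

Lemma maxidN a : maxid O a -> maxid O (- a).
Proof. by move=> Ha; rewrite -mulN1r; exact: maxidM (subr_N Or (subr_1 Or)) Ha. Qed.

Lemma maxidB a b : maxid O a -> maxid O b -> maxid O (a - b).
Proof. by move=> Ha Hb; apply/maxidD/maxidN. Qed.

Lemma maxid_1 : ~ maxid O 1.
Proof. by case=> _; apply; exact: unit_in_1. Qed.

Lemma dvr_unit_or_max f : O f -> unit_in O f \/ maxid O f.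
Proof. by move=> Of; case: (pselect (unit_in O f)) => H; [left|right]. Qed.

Lemma maxid_prime a b : O a -> O b -> maxid O (a * b) -> maxid O a \/ maxid O b.
Proof.
move=> Oa Ob [_ H]; case: (dvr_unit_or_max Oa) => Ha; last by left.
case: (dvr_unit_or_max Ob) => Hb; last by right.
by case: H; exact: unit_in_M.
Qed.

Lemma maxidX a m : O a -> maxid O (a ^+ m) -> maxid O a.
Proof.
move=> Oa [_ H]; split=> // Ua; apply: H; exact: unit_in_Xn.
Qed.

Lemma maxidXn a m : maxid O a -> (0 < m)%N -> maxid O (a ^+ m).
Proof.
case: m => // m Ma _; rewrite exprSr; apply: maxidM => //.
by apply: subr_X => //; case: Ma.
Qed.

(** Integral closedness in the form suited to functions known through their n-th powers: otherwise
    [f^-1], and with it [1 = f ^+ m * f^-1 ^+ m], would be in the maximal ideal. *)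
Lemma dvr_root f m : (0 < m)%N -> K f -> O (f ^+ m) -> O f.
Proof.
move=> m0 Kf0 Of; have [->|f0] := eqVneq f 0; first exact: subr_0.
have [//|/maxidXn /(_ m0)] := dvr_total Kf0.
rewrite exprVn => M; case: maxid_1.
by rewrite -(mulfV (expf_neq0 m f0)); exact: maxidM.
Qed.

Lemma unit_in_root f m : (0 < m)%N -> O f -> unit_in O (f ^+ m) -> unit_in O f.
Proof.
by case: m => // m _ Of; rewrite exprS; apply: unit_in_mull => //; exact: subr_X.
Qed.

Lemma maxid_prime_ideal A : subring A -> A `<=` O -> prime_ideal A (A `&` maxid O).
Proof.
move=> Ar AO; split.
- by move=> a [].
- by split; [split; [exact: subr_0|exact: maxid_0]|move=> [_ /maxid_1]].
- by move=> a b [Aa Ma] [Ab Mb]; split; [exact: subr_D|exact: maxidD].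
- by move=> a b Aa [Ab Mb]; split; [exact: subr_M|apply: maxidM => //; exact: AO].
- move=> a b Aa Ab [_ /maxid_prime] []; try exact: AO; by [left|right].
Qed.

Lemma loc_sub_dvr A : subring A -> A `<=` O -> loc A (A `&` maxid O) `<=` O.
Proof.
move=> Ar AO _ [a [b [Aa Ab Mb ->]]]; apply: subr_M; [by []|exact: AO|].
by have [[]|Mb'] := dvr_unit_or_max (AO _ Ab); [|case: Mb].
Qed.

End DVR.

Lemma maxid_setI K O f : subfield K -> maxid (O `&` K) f <-> K f /\ maxid O f.
Proof.
move=> [_ Ki]; split.
  move=> [[Of Kf] H]; split=> //; split=> // -[f0 _ Of']; apply: H.
  by split=> //; split=> //; exact: Ki.
by move=> [Kf [Of H]]; split=> // -[f0 _ [Of' _]]; apply: H.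
Qed.

Lemma unit_in_setI K O f : subfield K -> unit_in (O `&` K) f <-> K f /\ unit_in O f.
Proof.
move=> [_ Ki]; split; first by move=> [f0 [? ?] [? ?]].
by move=> [Kf [f0 Of Of']]; do 2!split=> //; exact: Ki.
Qed.

(** For [g] in [q] and [m] the order of [f], the quotient [g ^+ m / f] is in [loc A q]; so
    [g ^+ m * b] is a multiple of [f], hence in [p], for some [b] outside [q]. As [b] is then
    outside [p], it is [g] that lies in [p]. *)
Lemma dvr_loc_height1 K A p q : subring A -> prime_ideal A q -> dvr K (loc A q) ->
  prime_ideal A p -> p `<=` q -> (exists2 f, p f & f != 0) -> p = q.
Proof.
move=> Ar Pq D Pp pq [f pf f0]; apply/seteqP; split=> // g qg.
have [qA _ _ _ _] := Pq; have [pA _ _ pM pP] := Pp.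
have [->|g0] := eqVneq g 0; first by case: Pp => _ [].
have Lf h : A h -> loc A q h by exact: loc_sub.
have Kl h : A h -> K h by move=> Ah; apply: (dvr_sub D); exact: Lf.
have Kf0 := Kl _ (pA _ pf); have Kg := Kl _ (qA _ qg).
have Og := Lf _ (qA _ qg).
have og : 0 < ord K (loc A q) g by apply/(ord_gt0 D) => //; apply/loc_maxid => //; exact: qA.
have of0 : 0 <= ord K (loc A q) f by apply/(ord_ge0 D) => //; apply/Lf/pA.
pose m := `|ord K (loc A q) f|%N.
have : loc A q (g ^+ m / f).
  have [Kf _ _ _] := D; have [Kr Ki] := Kf.
  apply/(ord_ge0 D); rewrite ?mulf_neq0 ?expf_neq0 ?invr_eq0 //.
    by apply: subfield_div => //; exact: subr_X.
  rewrite (ordM D) ?(ordX D) ?(ordV D) ?expf_neq0 ?invr_eq0 //; last 2 first.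
  - exact: subr_X.
  - exact: Ki.
  by rewrite subr_ge0 -[X in X <= _](gez0_abs of0) -mulr_natl natz ler_peMr.
move=> [a [b [Aa Ab qb E]]].
have b0 : b != 0 by apply/eqP => b0; apply: qb; rewrite b0; case: Pq => _ [].
have : p (g ^+ m * b).
  have -> : g ^+ m * b = a * f.
    by move/(congr1 (fun x => x * f * b)): E; rewrite divfK // => ->; field.
  exact: pM.
by case/(pP _ _ (subr_X Ar m (qA _ qg)) Ab) => [/(prime_idealX Ar Pp (qA _ qg))|/pq].
Qed.

(** The orders of the elements of [K] form a nonzero subgroup of the integers; an element of least
    positive order is a uniformizer of the restriction. This least order, [m.+1] below, is the
    ramification index. *)
Lemma dvr_restrict K O : subfield K -> dvr setT O ->
  (exists2 f, K f & f != 0 /\ maxid O f) -> dvr K (O `&` K).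
Proof.
move=> Kf D [f Kf0 [f0 Mf]]; have [Kr Ki] := Kf; have [_ Or _ _] := D.
pose v := ord setT O.
have T x : setT x by [].
have vf : 0 < v f by apply/(ord_gt0 D).
pose P m := `[< exists2 x, K x & x != 0 /\ v x = m.+1%:Z >].
have exP : exists m, P m.
  exists `|v f|.-1; apply/asboolP; exists f => //; split=> //.
  by rewrite prednK ?gtz0_abs // absz_gt0 gt_eqF.
have [m /asboolP [t Kt [t0 vt]] mmin] := ex_minnP exP.
have Uin x : K x -> unit_in O x -> unit_in (O `&` K) x.
  by move=> Kx [x0 Ox Ox']; do 2!split=> //; exact: Ki.
split=> //; first exact: subringI.
exists t; split=> //.
- by split=> //; apply/(ord_ge0 D) => //; rewrite -/v vt.
- move=> [_ [Ot _] [Ot' _]].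
  by have := ord_unit D (And3 t0 Ot Ot'); rewrite -/v vt.
move=> x Kx x0; have [Kfx Kfxi] := Kf.
pose q := (v x %/ m.+1)%Z; pose r := (v x %% m.+1)%Z.
have Ktz : K (t ^ q).
  by case: q => j; [exact: (subr_X Kr)|apply/Ki; exact: (subr_X Kr)].
have tq0 : t ^ q != 0 by exact: expfz_neq0.
have vtq : v (t ^ q) = q * m.+1%:Z.
  have H j : v (t ^+ j) = j%:Z * m.+1%:Z by rewrite /v (ordX D) // -/v vt -mulr_natl natz.
  case: q {Ktz tq0} => j; first exact: H.
  rewrite NegzE -invr_expz -exprnP /v (ordV D) ?expf_neq0 // -/v H; ring.
have vr : v (x / t ^ q) = r.
  rewrite /v (ordM D) ?invr_eq0 // (ordV D) // -/v vtq.
  by rewrite {1}(divz_eq (v x) m.+1) -/q -/r; ring.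
have Kr' : K (x / t ^ q) by exact: subfield_div.
have r0 : r = 0.
  have rge0 : 0 <= r by exact: modz_ge0.
  have rlt : r < m.+1%:Z by exact: ltz_pmod.
  case E : r rge0 rlt => [[|j]|] // _ jm.
  have : P j by apply/asboolP; exists (x / t ^ q) => //; rewrite mulf_neq0 ?invr_eq0 // vr E.
  by move/mmin; rewrite leqNgt; move: jm; rewrite ltz_nat ltnS => ->.
exists (x / t ^ q), q; split; last by rewrite divfK.
apply: Uin => //; apply/(ord_eq0 D); rewrite ?mulf_neq0 ?invr_eq0 //.
by rewrite -/v vr.
Qed.

Lemma valuation_ring_dvr K O : dvr K O -> range (ff_cst F) `<=` O -> valuation_ring K O.
Proof.
move=> D cO; have [[Kr Ki] Or OK _] := D; split=> //.
- by move=> a b Oa Ob; split; [exact: subr_B|exact: subr_M].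
- by move=> f Kf _; case: (dvr_total D Kf) => [|[]]; [left|right].
Qed.

End Subrings.

(** * Substitutions *)

Lemma mpoly_ring_ind (R : comNzRingType) (m : nat) (P : {mpoly R[m]} -> Prop) :
  (forall c, P c%:MP) -> (forall i, P 'X_i) ->
  (forall a b, P a -> P b -> P (a + b)) ->
  (forall a b, P a -> P b -> P (a * b)) -> forall a, P a.
Proof.
move=> PC PX PD PM; elim/mpolyind => [|c mm q _ _ Pq].
  by rewrite -mpolyC0; exact: PC.
apply: PD => //; rewrite -mul_mpolyC mpolyXE_id; apply: (PM); first exact: PC.
apply: (big_ind P); [by rewrite -mpolyC1; exact: PC|exact: PM|].
move=> i _; elim: (mm i) => [|j IH]; first by rewrite expr0 -mpolyC1; exact: PC.
by rewrite exprS; apply: PM => //; exact: PX.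
Qed.

Lemma det2E (R : comNzRingType) (M : 'M[R]_2) :
  \det M = M 0 0 * M 1 1 - M 0 1 * M 1 0.
Proof.
rewrite (expand_det_row _ ord0) !big_ord_recl big_ord0 /cofactor !det_mx11 !mxE /=.
have -> : fintype.lift 0 0 = 1 :> 'I_2 by exact/val_inj.
have -> : fintype.lift 1 0 = 0 :> 'I_2 by exact/val_inj.
by rewrite expr0 expr1; ring.
Qed.

Lemma ord2_ind (P : 'I_2 -> Prop) : P 0 -> P 1 -> forall i, P i.
Proof.
move=> P0 P1 [[|[|//]] Hi]; [move: P0|move: P1]; congr P; exact/val_inj.
Qed.

Section Substitution.
Variables (k : closedFieldType) (F : sl2_field k).
Local Notation cst := (ff_cst F).
Local Notation gmx := (ff_gmx F).
Local Notation evg := (evalmx cst gmx).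

Definition Xmx : 'M[{mpoly k[2 * 2]}]_2 := \matrix_(i, j) 'X_(mxvec_index i j).

Section Eval.
Variables (L : comNzRingType) (iota : {rmorphism k -> L}) (M : 'M[L]_2).

Lemma evalmxC c : evalmx iota M c%:MP = iota c.
Proof. by rewrite /evalmx mmapC. Qed.
Lemma evalmxX i j : evalmx iota M (Xmx i j) = M i j.
Proof. by rewrite /evalmx mxE mmapX mmap1U mxvecE. Qed.
Lemma evalmxD : {morph evalmx iota M : P Q / P + Q}.
Proof. by move=> P Q; rewrite /evalmx rmorphD. Qed.
Lemma evalmxB : {morph evalmx iota M : P Q / P - Q}.
Proof. by move=> P Q; rewrite /evalmx rmorphB. Qed.
Lemma evalmxN : {morph evalmx iota M : P / - P}.
Proof. by move=> P; rewrite /evalmx rmorphN. Qed.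
Lemma evalmx_mul : {morph evalmx iota M : P Q / P * Q}.
Proof. by move=> P Q; rewrite /evalmx rmorphM. Qed.
Lemma evalmx1 : evalmx iota M 1 = 1.
Proof. by rewrite /evalmx rmorph1. Qed.
Lemma evalmx0 : evalmx iota M 0 = 0.
Proof. by rewrite /evalmx rmorph0. Qed.
Lemma evalmxXn P m : evalmx iota M (P ^+ m) = evalmx iota M P ^+ m.
Proof. by rewrite /evalmx rmorphXn. Qed.
End Eval.

Definition evalmxE := (evalmx1, evalmx0, evalmxD, evalmxB, evalmxN, evalmx_mul,
  evalmxXn, evalmxC, evalmxX).

Lemma evalmx_ind (P : {mpoly k[2 * 2]} -> Prop) :
  (forall c, P c%:MP) -> (forall i j, P (Xmx i j)) ->
  (forall a b, P a -> P b -> P (a + b)) ->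
  (forall a b, P a -> P b -> P (a * b)) -> forall a, P a.
Proof.
move=> PC PX PD PM; apply: mpoly_ring_ind => // l.
by case/mxvec_indexP: l => i j; have := PX i j; rewrite mxE.
Qed.

Lemma evalmx_morph (L L' : comNzRingType) (iota : {rmorphism k -> L})
    (iota' : {rmorphism k -> L'}) (th : {rmorphism L -> L'}) (M : 'M[L]_2) P :
  (forall c, th (iota c) = iota' c) ->
  th (evalmx iota M P) = evalmx iota' (map_mx th M) P.
Proof.
move=> th_cst; elim/evalmx_ind: P => [c|i j|a b Ha Hb|a b Ha Hb].
- by rewrite !evalmxC.
- by rewrite !evalmxX mxE.
- by rewrite !evalmxD rmorphD Ha Hb.
- by rewrite !evalmx_mul rmorphM Ha Hb.
Qed.

(** [Q] is chosen before the ring [L], so that one polynomial computes the translate both at the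
    generic point and at every matrix over [k]. *)
Lemma evalmx_transl (U V : 'M[k]_2) P : exists Q,
  forall (L : comNzRingType) (iota : {rmorphism k -> L}) (M : 'M[L]_2),
    evalmx iota M Q = evalmx iota (map_mx iota U *m M *m map_mx iota V) P.
Proof.
elim/evalmx_ind: P => [c|i j|a b [Qa Ha] [Qb Hb]|a b [Qa Ha] [Qb Hb]].
- by exists c%:MP => L iota M; rewrite !evalmxC.
- exists (\sum_l (\sum_l' (U i l')%:MP * Xmx l' l) * (V l j)%:MP) => L iota M.
  rewrite evalmxX mxE /evalmx rmorph_sum; apply: eq_bigr => l _ /=.
  rewrite -/(evalmx iota M _) evalmx_mul evalmxC !mxE; congr (_ * _).
  rewrite /evalmx rmorph_sum; apply: eq_bigr => l' _ /=.
  by rewrite -/(evalmx iota M _) evalmx_mul evalmxC evalmxX !mxE.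
- by exists (Qa + Qb) => L iota M; rewrite !evalmxD Ha Hb.
- by exists (Qa * Qb) => L iota M; rewrite !evalmx_mul Ha Hb.
Qed.

(** [M] satisfies the same polynomial relations over [k] as the generic matrix, which makes
    [pull cst M] independent of the fraction chosen to represent a function. *)
Definition dominant (M : 'M[F]_2) : Prop :=
  forall P, evalmx cst M P = 0 <-> evg P = 0.

(** Vanishing at the generic point means vanishing at all matrices over [k] of determinant 1, and
    translations permute these. *)
Lemma dominant_transl (U V : 'M[k]_2) : \det U = 1 -> \det V = 1 ->
  dominant (map_mx cst U *m gmx *m map_mx cst V).
Proof.
move=> dU dV P; have [Q HQ] := evalmx_transl U V P.
have H h : evalmx idfun h Q = evalmx idfun (U *m h *m V) P.
  by have := HQ k idfun h; rewrite !map_mx_id.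
rewrite -HQ !gmx_generic; split=> H0 h dh; last first.
  by rewrite H H0 // !det_mulmx dU dV dh !mul1r.
have uU : U \in unitmx by rewrite unitmxE dU unitr1.
have uV : V \in unitmx by rewrite unitmxE dV unitr1.
have := H0 (invmx U *m h *m invmx V); rewrite H !mulmxA mulmxV // mul1mx.
rewrite -(mulmxA h) mulVmx // mulmx1; apply.
by rewrite !det_mulmx !det_inv dU dV dh invr1 !mulr1.
Qed.

Lemma pullE (M : 'M[F]_2) P Q : dominant M -> evg Q != 0 ->
  pull cst M (evg P / evg Q) = evalmx cst M P / evalmx cst M Q.
Proof.
move=> dM Q0; rewrite /pull; case: xgetP => [y _ [P' [Q' [Q'0 E ->]]]|/(_ (evalmx cst M P / evalmx cst M Q))]; last first.
  by case; exists P, Q.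
have M0 R : evg R != 0 -> evalmx cst M R != 0.
  by apply: contra_neq => /dM.
move: (M0 _ Q0) (M0 _ Q'0) => MQ MQ'.
have : evg (P * Q' - P' * Q) = 0.
  by rewrite !evalmxE; apply/eqP; rewrite subr_eq0 -eqr_div // E.
move/dM; rewrite !evalmxE => /eqP; rewrite subr_eq0 => /eqP E'.
by apply/eqP; rewrite eqr_div // E'.
Qed.

Lemma pull_rmorphism (M : 'M[F]_2) : dominant M ->
  exists th : {rmorphism F -> F}, [/\ th =1 pull cst M,
    forall c, th (cst c) = cst c & forall i j, th (gmx i j) = M i j].
Proof.
move=> dM; have M0 R : evg R != 0 -> evalmx cst M R != 0.
  by apply: contra_neq => /dM.
have pE P : pull cst M (evg P) = evalmx cst M P.
  rewrite -[evg P]divr1 -(evalmx1 cst gmx) pullE //.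
    by rewrite evalmx1 divr1.
  by rewrite evalmx1 oner_neq0.
have pB : zmod_morphism (pull cst M : F -> F).
  move=> f g; have [P [Q [Q0 ->]]] := gmx_generate f.
  have [P' [Q' [Q'0 ->]]] := gmx_generate g.
  have -> : evg P / evg Q - evg P' / evg Q' = evg (P * Q' - P' * Q) / evg (Q * Q').
    by rewrite !evalmxE -mulNr addf_div // mulNr.
  rewrite !pullE ?evalmxE ?mulf_neq0 //.
  by rewrite -[in RHS]mulNr addf_div ?M0 // mulNr.
have pM : monoid_morphism (pull cst M : F -> F).
  split; first by rewrite -{1}(evalmx1 cst gmx) pE evalmx1.
  move=> f g; have [P [Q [Q0 ->]]] := gmx_generate f.
  have [P' [Q' [Q'0 ->]]] := gmx_generate g.
  have -> : evg P / evg Q * (evg P' / evg Q') = evg (P * P') / evg (Q * Q').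
    by rewrite !evalmxE mulf_div.
  by rewrite !pullE ?evalmxE ?mulf_neq0 // mulf_div.
pose a := GRing.isZmodMorphism.Build F F (pull cst M : F -> F) pB.
pose b := GRing.isMonoidMorphism.Build F F (pull cst M : F -> F) pM.
pose th : {rmorphism F -> F} := HB.pack (pull cst M : F -> F) a b.
exists th; split=> //.
- by move=> c; rewrite -[LHS]/(pull cst M (cst c)) -(evalmxC cst gmx c) pE evalmxC evalmxC.
- by move=> i j; rewrite -[LHS]/(pull cst M (gmx i j)) -(evalmxX cst gmx i j) pE evalmxX.
Qed.

Lemma rmorphism_gen (th th' : {rmorphism F -> F}) :
  (forall c, th (cst c) = th' (cst c)) ->
  (forall i j, th (gmx i j) = th' (gmx i j)) -> th =1 th'.
Proof.
move=> Hc Hg f; have [P [Q [_ ->]]] := gmx_generate f; rewrite !fmorph_div.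
suff H R : th (evg R) = th' (evg R) by rewrite !H.
elim/evalmx_ind: R => [c|i j|a b Ha Hb|a b Ha Hb].
- by rewrite !evalmxE.
- by rewrite !evalmxE.
- by rewrite !evalmxE !rmorphD Ha Hb.
- by rewrite !evalmxE !rmorphM Ha Hb.
Qed.

Lemma OG_subring : subring (OG F).
Proof.
split; first by exists 1; rewrite ?evalmx1.
- by move=> _ _ [P _ <-] [Q _ <-]; exists (P - Q); rewrite ?evalmxB.
- by move=> _ _ [P _ <-] [Q _ <-]; exists (P * Q); rewrite ?evalmx_mul.
Qed.

Lemma OG_cst c : OG F (cst c). Proof. by exists c%:MP; rewrite ?evalmxC. Qed.
Lemma OG_gmx i j : OG F (gmx i j). Proof. by exists (Xmx i j); rewrite ?evalmxX. Qed.

Lemma OG_ind (A : set F) : subring A -> (forall c, A (cst c)) ->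
  (forall i j, A (gmx i j)) -> OG F `<=` A.
Proof.
move=> Ar Ac Ag _ [P _ <-]; elim/evalmx_ind: P => [c|i j|a b Ha Hb|a b Ha Hb];
  rewrite !evalmxE //; [exact: subr_D|exact: subr_M].
Qed.

Lemma OG_frac f : frac_of (OG F) f.
Proof.
have [P [Q [Q0 ->]]] := gmx_generate f.
by exists (evg P), (evg Q); split=> //; [exists P|exists Q].
Qed.

Lemma OG_stable (th : {rmorphism F -> F}) : (forall c, th (cst c) = cst c) ->
  (forall i j, OG F (th (gmx i j))) -> forall f, OG F f -> OG F (th f).
Proof.
move=> Hc Hg; apply: (OG_ind (A := [set f | OG F (th f)])) => /=.
- split; rewrite /= ?rmorph1; first exact: subr_1 OG_subring.
  + by move=> a b Ha Hb; rewrite rmorphB; exact: subr_B OG_subring _ _ _ _.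
  + by move=> a b Ha Hb; rewrite rmorphM; exact: subr_M OG_subring _ _ _ _.
- by move=> c; rewrite Hc; exact: OG_cst.
- exact: Hg.
Qed.

Lemma evg_eq0 P : evg P = 0 <-> forall h : 'M[k]_2, \det h = 1 -> evalmx idfun h P = 0.
Proof. exact: gmx_generic. Qed.

Lemma det_gmx : g1 F * g4 F - g2 F * g3 F = 1.
Proof.
pose P := Xmx 0 0 * Xmx 1 1 - Xmx 0 1 * Xmx 1 0 - 1.
have : evg P = 0.
  apply/evg_eq0 => h dh; rewrite !evalmxE; move: dh; rewrite det2E => ->.
  by rewrite subrr.
by rewrite /P !evalmxE => /eqP; rewrite subr_eq0 => /eqP.
Qed.

Lemma invmx2E (h : 'M[k]_2) : \det h = 1 ->
  invmx h = mat2 (h 1 1) (- h 0 1) (- h 1 0) (h 0 0).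
Proof.
move=> dh; have uh : h \in unitmx by rewrite unitmxE dh unitr1.
rewrite -[RHS]mul1mx -(mulVmx uh) -mulmxA -[LHS]mulmx1; congr (_ *m _).
move: dh; rewrite det2E => dh.
have E1 : fintype.lift ord0 ord0 = 1 :> 'I_2 by exact/val_inj.
apply/matrixP; apply: ord2_ind; apply: ord2_ind;
  rewrite !mxE !big_ord_recl big_ord0 !mxE E1 /= ?addr0 -?[ord0]/(0 : 'I_2).
- by rewrite -dh; ring.
- by ring.
- by ring.
- by rewrite -dh; ring.
Qed.

Lemma ltrans_rmorphism (h : 'M[k]_2) : \det h = 1 ->
  exists th : {rmorphism F -> F}, [/\ th =1 ltrans h,
    forall c, th (cst c) = cst c &
    [/\ th (g1 F) = cst (h 1 1) * g1 F - cst (h 0 1) * g3 F,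
        th (g2 F) = cst (h 1 1) * g2 F - cst (h 0 1) * g4 F,
        th (g3 F) = cst (h 0 0) * g3 F - cst (h 1 0) * g1 F &
        th (g4 F) = cst (h 0 0) * g4 F - cst (h 1 0) * g2 F]].
Proof.
move=> dh; have [|th [E Hc Hg]] := @pull_rmorphism (map_mx cst (invmx h) *m gmx).
  have := @dominant_transl (invmx h) 1%:M.
  by rewrite map_mx1 mulmx1 det_inv dh invr1 det1; apply.
exists th; split=> //.
have E1 : fintype.lift ord0 ord0 = 1 :> 'I_2 by exact/val_inj.
rewrite /g1 /g2 /g3 /g4 !Hg !mxE !big_ord_recl !big_ord0 !mxE invmx2E // !mxE E1 /=.
by rewrite !rmorphN; split; rewrite -?[ord0]/(0 : 'I_2); ring.
Qed.

Lemma rtrans_rmorphism (z : k) : z != 0 ->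
  exists th : {rmorphism F -> F}, 
    (forall c, th (cst c) = cst c) /\
    [/\ th (g1 F) = cst z * g1 F, th (g2 F) = cst z^-1 * g2 F,
        th (g3 F) = cst z * g3 F & th (g4 F) = cst z^-1 * g4 F] /\
    (forall P, th (evg P) = evalmx cst (gmx *m map_mx cst (mat2 z 0 0 z^-1)) P).
Proof.
move=> z0; have [|th [E Hc Hg]] := @pull_rmorphism (gmx *m map_mx cst (mat2 z 0 0 z^-1)).
  have := @dominant_transl 1%:M (mat2 z 0 0 z^-1).
  rewrite map_mx1 mul1mx det1; apply=> //.
  by rewrite det2E !mxE /= mulfV // mul0r subr0.
exists th; split=> //; split.
  rewrite /g1 /g2 /g3 /g4 !Hg !mxE !big_ord_recl !big_ord0 !mxE /=.
by rewrite !rmorph0 !mulr0 !addr0 !add0r; split; rewrite mulrC //; congr (_ * gmx _ _); exact/val_inj.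
move=> P; rewrite (evalmx_morph (iota' := cst) _ _ Hc); congr (evalmx _ _ _).
by apply/matrixP => i j; rewrite mxE Hg.
Qed.

End Substitution.

(** * Weights of mu_n *)

Lemma pnatr_eq0_char0 (k : fieldType) (m : nat) : [pchar k] =i pred0 ->
  (m%:R == 0 :> k) = (m == 0)%N.
Proof. by move=> H; move/pcharf0P: H => ->. Qed.

(** In characteristic 0 the polynomial ['X^n - 1] is separable, so it has [n] distinct roots in
    [k]. *)
Lemma prim_root_exists (k : closedFieldType) (n : nat) :
  [pchar k] =i pred0 -> (0 < n)%N -> exists z : k, n.-primitive_root z.
Proof.
move=> k0 n_gt0; pose p : {poly k} := 'X^n - 1.
have [r Dp] := closed_field_poly_normal p.
rewrite (monicP _) ?monicXnsubC // scale1r in Dp.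
have rn1 : all n.-unity_root r by apply/allP=> z; rewrite -root_prod_XsubC -Dp.
have sz_r : (n < (size r).+1)%N.
  by rewrite -(size_prod_XsubC r id) -Dp size_XnsubC.
have [|z] := hasP (has_prim_root n_gt0 rn1 _ sz_r); last by exists z.
by rewrite -separable_prod_XsubC -Dp separable_Xn_sub_1 // pnatr_eq0_char0 // -lt0n.
Qed.

Section Weights.
Variables (k : closedFieldType) (k0 : [pchar k] =i pred0) (F : sl2_field k).
Variables (n : nat) (n_gt0 : (0 < n)%N).
Local Notation cst := (ff_cst F).
Local Notation gmx := (ff_gmx F).

(** [R] is right translation by diag(z, z^-1), with z of order n. All its iterates are prescribed on
    O(G), so that invariance under the whole of mu_n reduces to [R f = f]. *)
Definition mu_gen (z : k) (R : {rmorphism F -> F}) : Prop :=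
  n.-primitive_root z /\ forall (j : nat) P,
    iter j R (evalmx cst gmx P)
    = evalmx cst (gmx *m map_mx cst (mat2 (z ^+ j) 0 0 (z ^+ j)^-1)) P.

Lemma mu_gen_exists : exists z R, mu_gen z R.
Proof.
have [z Hz] := prim_root_exists k0 n_gt0.
have z0 : z != 0.
  apply/eqP => z0; have := prim_expr_order Hz.
  by rewrite z0 expr0n (gtn_eqF n_gt0) => /eqP; rewrite eq_sym oner_eq0.
have [R [Hc [_ HR]]] := rtrans_rmorphism F z0.
exists z, R; split=> // j; elim: j => [|j IH] P.
  rewrite /= expr0 invr1; congr (evalmx _ _ _).
  rewrite -[LHS]mulmx1; congr (_ *m _); apply/matrixP => a b; rewrite !mxE.
  by case: a => [[|[|//]] ?]; case: b => [[|[|//]] ?] //=; rewrite ?rmorph0 ?rmorph1.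
rewrite iterSr HR; have [Q HQ] := evalmx_transl 1%:M (mat2 z 0 0 z^-1) P.
have := HQ F cst gmx; rewrite map_mx1 mul1mx => <-; rewrite IH HQ map_mx1 mul1mx.
congr (evalmx _ _ _); rewrite -mulmxA -map_mxM; congr (_ *m map_mx _ _).
apply/matrixP => a b; rewrite !mxE !big_ord_recl big_ord0 !mxE.
by case: a => [[|[|//]] ?]; case: b => [[|[|//]] ?] //=;
  rewrite ?mul0r ?mulr0 ?add0r ?addr0 // exprSr ?invfM // mulrC.
Qed.

Section MuGen.
Variables (z : k) (R : {rmorphism F -> F}) (HR : mu_gen z R).

Let zP : n.-primitive_root z. Proof. by case: HR. Qed.
Let z0 : z != 0.
Proof.
apply/eqP => z0; have := prim_expr_order zP.
by rewrite z0 expr0n (gtn_eqF n_gt0) => /eqP; rewrite eq_sym oner_eq0.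
Qed.
Let RE P : R (evalmx cst gmx P)
    = evalmx cst (gmx *m map_mx cst (mat2 z 0 0 z^-1)) P.
Proof. by case: HR => _ /(_ 1 P); rewrite /= expr1. Qed.

Lemma mu_cst c : R (cst c) = cst c.
Proof. by rewrite -(evalmxC cst gmx) RE !evalmxC. Qed.

Lemma mu_gmx : [/\ R (g1 F) = cst z * g1 F, R (g2 F) = cst z^-1 * g2 F,
        R (g3 F) = cst z * g3 F & R (g4 F) = cst z^-1 * g4 F].
Proof.
have [th [_ [H Hth]]] := rtrans_rmorphism F z0.
have E i j : R (gmx i j) = th (gmx i j).
  by rewrite -(evalmxX cst gmx) RE Hth.
by rewrite /g1 /g2 /g3 /g4 !E.
Qed.

Lemma mu_OG f : OG F f -> OG F (R f).
Proof.
move=> [P _ <-]; rewrite RE.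
have [Q HQ] := evalmx_transl 1%:M (mat2 z 0 0 z^-1) P.
by have := HQ F cst gmx; rewrite map_mx1 mul1mx => <-; exists Q.
Qed.

Lemma mu_iter_order f : iter n R f = f.
Proof.
have [P [Q [_ ->]]] := gmx_generate f.
have E j g h : iter j R (g / h) = iter j R g / iter j R h.
  by elim: j => //= j ->; rewrite fmorph_div.
rewrite E; case: HR => _ H; rewrite !H (prim_expr_order zP) invr1.
suff -> : map_mx cst (mat2 1 0 0 1) = 1%:M by rewrite mulmx1.
apply/matrixP => a b; rewrite !mxE.
by case: a => [[|[|//]] ?]; case: b => [[|[|//]] ?] //=; rewrite ?rmorph0 ?rmorph1.
Qed.

Lemma OGmuE f : OGmu F n f <-> OG F f /\ R f = f.
Proof.
split=> [[P -> H]|[[P _ <-] H]].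
  by split; [exists P|rewrite RE; apply: H; exact: prim_expr_order].
exists P => // w wn; have [j ->] := prim_rootP zP wn.
case: HR => _ <-; elim: (j : nat) => //= i ->; exact: H.
Qed.

Definition weight (w : nat) (f : F) : Prop := R f = cst (z ^+ w) * f.

Lemma weightM w w' f g : weight w f -> weight w' g -> weight (w + w')%N (f * g).
Proof. by rewrite /weight => Hf Hg; rewrite rmorphM Hf Hg exprD rmorphM mulrACA. Qed.

Lemma weightX w m f : weight w f -> weight (w * m)%N (f ^+ m).
Proof. by rewrite /weight => Hf; rewrite rmorphXn Hf exprMn exprM [in RHS]rmorphXn. Qed.

Lemma weight_n f : weight n f -> R f = f.
Proof. by rewrite /weight (prim_expr_order zP) rmorph1 mul1r. Qed.

Lemma weight_g1 : weight 1 (g1 F).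
Proof. by rewrite /weight expr1; case: mu_gmx. Qed.

(** The projector of finite Fourier analysis onto weight [w]: the average of the translates of [f]
    under mu_n, twisted by the inverse character. *)
Definition proj (w : nat) (f : F) : F :=
  (n%:R)^-1 * \sum_(j < n) cst (z ^+ (j * w))^-1 * iter j R f.

Lemma iter_mul j f g : iter j R (f * g) = iter j R f * iter j R g.
Proof. by elim: j => //= j ->; rewrite rmorphM. Qed.
Lemma iter_add j f g : iter j R (f + g) = iter j R f + iter j R g.
Proof. by elim: j => //= j ->; rewrite rmorphD. Qed.
Lemma iter_inv j f : R f = f -> iter j R f = f.
Proof. by move=> H; elim: j => //= j ->. Qed.

Lemma natF_neq0 : n%:R != 0 :> F.
Proof. by rewrite -(rmorph_nat cst) fmorph_eq0 pnatr_eq0_char0 // -lt0n. Qed.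

Lemma proj_weight w f : weight w (proj w f).
Proof.
rewrite /weight /proj rmorphM fmorphV rmorph_nat mulrCA; congr (_ * _).
rewrite rmorph_sum mulr_sumr; case: n n_gt0 mu_iter_order zP => // m _ Ho Hz.
rewrite [RHS]big_ord_recl [LHS]big_ord_recr addrC; congr (_ + _); last first.
  rewrite /= rmorphM [X in _ * X](Ho f : R (iter m R f) = f) mu_cst mul0n expr0 invr1 rmorph1 mul1r.
  congr (_ * _); congr (cst _); apply: (mulIf (expf_neq0 (m * w) z0)).
  by rewrite mulVf ?expf_neq0 // -exprD -mulSn exprM (prim_expr_order Hz) expr1n.
apply: eq_bigr => i _ /=; rewrite rmorphM mu_cst mulrA -rmorphM; congr (cst _ * _).
by rewrite /bump add1n mulSn exprD invfM mulrA mulfV ?mul1r // expf_neq0.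
Qed.

(** Orthogonality of characters: for [j] nonzero, the sum over the weights is a geometric sum of an
    n-th root of unity different from 1. *)
Lemma sum_proj f : \sum_(w < n) proj w f = f.
Proof.
rewrite /proj -mulr_sumr exchange_big /=.
rewrite (bigD1 (Ordinal n_gt0)) //= [X in _ + X]big1 ?addr0.
  under eq_bigr do rewrite mul0n expr0 invr1 rmorph1 mul1r.
  by rewrite sumr_const card_ord -[f *+ n]mulr_natl mulKf // natF_neq0.
move=> j j0; rewrite -mulr_suml -rmorph_sum /=.
suff -> : \sum_(i < n) (z ^+ (j * i))^-1 = 0 by rewrite rmorph0 mul0r.
pose y := (z ^+ j)^-1.
have y1 : y - 1 != 0.
  rewrite subr_eq0 invr_eq1 -(prim_order_dvd zP); apply: contra j0 => /dvdn_leq jn.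
  by rewrite -val_eqE /= -leqn0 leqNgt; apply/negP => /jn; rewrite leqNgt ltn_ord.
apply: (mulfI y1); rewrite mulr0.
have -> : \sum_(i < n) (z ^+ (j * i))^-1 = \sum_(i < n) y ^+ i.
  by apply: eq_bigr => i _; rewrite /y exprVn exprM.
by rewrite -subrX1 /y exprVn -exprM mulnC exprM (prim_expr_order zP) expr1n invr1 subrr.
Qed.

Lemma OG_iter j f : OG F f -> OG F (iter j R f).
Proof. by elim: j => //= j IH /IH; exact: mu_OG. Qed.

Lemma OG_invn : OG F n%:R^-1.
Proof. by rewrite -(rmorph_nat cst) -fmorphV; exact: OG_cst. Qed.

Lemma proj_OG w f : OG F f -> OG F (proj w f).
Proof.
have Gr := OG_subring F.
move=> Of; apply: (subr_M Gr OG_invn); apply: (subr_sum Gr) => j _.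
by apply: (subr_M Gr); [exact: OG_cst|exact: OG_iter].
Qed.

Lemma projM w f b : R f = f -> proj w (f * b) = f * proj w b.
Proof.
move=> Hf; rewrite /proj mulrCA; congr (_ * _); rewrite mulr_sumr.
by apply: eq_bigr => j _; rewrite iter_mul iter_inv // mulrCA.
Qed.

Lemma proj0_inv f : R f = f -> proj 0 f = f.
Proof.
move=> Hf; rewrite /proj.
under eq_bigr do rewrite muln0 expr0 invr1 rmorph1 mul1r iter_inv //.
by rewrite sumr_const card_ord -[f *+ n]mulr_natl mulKf // natF_neq0.
Qed.

(* Ideals of denominators of invariant functions are graded. *)
Lemma mu_loc (pp : set F) f a b e :
  (forall x y, pp x -> pp y -> pp (x + y)) -> pp 0 ->
  (forall x y, OG F x -> OG F y -> pp (x * y) -> pp x \/ pp y) -> ~ pp 1 ->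
  OG F e -> weight 1 e -> ~ pp e ->
  R f = f -> OG F a -> OG F b -> ~ pp b -> f = a / b ->
  exists a' b', [/\ OGmu F n a', OGmu F n b', ~ pp b' & f = a' / b'].
Proof.
move=> pD p0 pP p1 Oe We pe Hf Oa Ob pb E.
have b0 : b != 0 by apply: contra_notN pb => /eqP ->.
have [w wn pw] : exists2 w, (w < n)%N & ~ pp (proj w b).
  apply: contrapT => H; apply: pb; rewrite -(sum_proj b).
  apply: big_ind => // w _; apply: contrapT => Hw; apply: H.
  by exists w.
have Gr := OG_subring F.
(* [proj w b] has weight [w]; the factor of weight [n - w] makes the denominator invariant and stays
   outside the prime ideal. *)
set b' := proj w b * e ^+ (n - w).
have Ob' : OG F b' by apply: (subr_M Gr); [exact: proj_OG|exact: subr_X].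
have Hb' : R b' = b'.
  apply: weight_n; rewrite -[X in weight X](subnKC (ltnW wn)); apply: weightM.
    exact: proj_weight.
  by rewrite -[X in weight X]mul1n; apply/weightX.
have fb : f * b = a by rewrite E divfK.
have pb' : ~ pp b'.
  move=> /(pP _ _ (proj_OG w Ob) (subr_X Gr _ Oe)) [//|].
  elim: (n - w)%N => [|m IH]; first by rewrite expr0.
  by rewrite exprS => /(pP _ _ Oe (subr_X Gr _ Oe)) [].
have b'0 : b' != 0 by apply: contra_notN pb' => /eqP ->.
have Ofb : OG F (f * b').
  rewrite mulrA -projM // fb; apply: (subr_M Gr); [exact: proj_OG|exact: subr_X].
exists (f * b'), b'; split=> //; last by rewrite mulfK.
  by apply/OGmuE; split=> //; rewrite rmorphM Hf Hb'.
exact/OGmuE.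
Qed.

Lemma g1_neq0 : g1 F != 0.
Proof.
apply/eqP; rewrite /g1 -(evalmxX cst gmx) => /evg_eq0 /(_ 1%:M (det1 _ _)).
by rewrite evalmxX mxE /= => /eqP; rewrite oner_eq0.
Qed.

(** This is [mu_loc] for the zero ideal, with [g1] as the element of weight 1. *)
Lemma KmuE f : Kmu F n f <-> R f = f.
Proof.
split=> [[a [b [/OGmuE [_ Ha] /OGmuE [_ Hb] b0 ->]]]|Hf].
  by rewrite fmorph_div Ha Hb.
have [a [b [Oa Ob b0 E]]] := OG_frac f.
pose pp : set F := [set x | x = 0].
have pD x y : pp x -> pp y -> pp (x + y) by rewrite /pp /= => -> ->; rewrite addr0.
have pP x y : OG F x -> OG F y -> pp (x * y) -> pp x \/ pp y.
  by move=> _ _ /eqP; rewrite mulf_eq0 => /orP[] /eqP; [left|right].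
have p1 : ~ pp (g1 F) by exact/eqP/g1_neq0.
have p2 : ~ pp 1 by exact/eqP/oner_neq0.
have p3 : ~ pp b by exact/eqP.
have Og1 : OG F (g1 F) by exact: OG_gmx.
have [a' [b' [? ? b'0 ->]]] :=
  mu_loc pD erefl pP p2 Og1 weight_g1 p1 Hf Oa Ob p3 E.
by exists a', b'; split=> //; exact/eqP.
Qed.

(** The product of the translates under mu_n gives an invariant multiple of [a] inside O(G). *)
Definition mu_norm (a : F) : F := \prod_(j < n) iter j R a.

Lemma mu_norm_inv a : R (mu_norm a) = mu_norm a.
Proof.
rewrite /mu_norm; case: n n_gt0 mu_iter_order => // m _ Ho.
rewrite rmorph_prod [LHS]big_ord_recr [RHS]big_ord_recl mulrC; congr (_ * _).
exact: Ho.
Qed.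

Lemma mu_norm_OGmu a : OG F a -> OGmu F n (mu_norm a).
Proof.
move=> Oa; apply/OGmuE; split; last exact: mu_norm_inv.
by apply: (subr_prod (OG_subring F)) => j _; exact: OG_iter.
Qed.

Lemma mu_norm_eq0 a : a != 0 -> mu_norm a != 0.
Proof.
by move=> a0; apply/prodf_neq0 => j _; elim: (j : nat) => //= i; rewrite fmorph_eq0.
Qed.

Lemma mu_norm_dvd a : OG F a -> exists2 b, OG F b & mu_norm a = b * a.
Proof.
move=> Oa; exists (\prod_(j < n | j != Ordinal n_gt0) iter j R a).
  by apply: (subr_prod (OG_subring F)) => j _; exact: OG_iter.
by rewrite /mu_norm (bigD1 (Ordinal n_gt0)) //= mulrC.
Qed.

End MuGen.

Lemma OGmu_subring : subring (OGmu F n).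
Proof.
have [z [R HR]] := mu_gen_exists; have Gr := OG_subring F.
split.
- by apply/(OGmuE HR); split; [exact: subr_1|exact: rmorph1].
- move=> a b /(OGmuE HR) [? Ha] /(OGmuE HR) [? Hb]; apply/(OGmuE HR); split.
    exact: subr_B.
  by rewrite rmorphB Ha Hb.
- move=> a b /(OGmuE HR) [? Ha] /(OGmuE HR) [? Hb]; apply/(OGmuE HR); split.
    exact: subr_M.
  by rewrite rmorphM Ha Hb.
Qed.

Lemma OGmu_OG f : OGmu F n f -> OG F f.
Proof. by case=> P -> _; exists P. Qed.

Lemma OGmuP f : OGmu F n f <-> OG F f /\ Kmu F n f.
Proof.
have [z [R HR]] := mu_gen_exists.
by rewrite (OGmuE HR); split; case=> ? /(KmuE HR).
Qed.

Lemma Kmu_subfield : subfield (Kmu F n).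
Proof. exact: frac_of_subfield OGmu_subring. Qed.

Lemma OGmu_Kmu f : OGmu F n f -> Kmu F n f.
Proof. exact: frac_of_sub OGmu_subring _. Qed.

Lemma Kmu_cst c : Kmu F n (cst c).
Proof.
have [z [R HR]] := mu_gen_exists; apply/(KmuE HR); exact: mu_cst HR _.
Qed.

End Weights.

(** * Irreducible polynomials and subfields *)

Lemma irreducible_factor (K : fieldType) (p : {poly K}) : (1 < size p)%N ->
  exists2 q, irreducible_poly q & q %| p.
Proof.
have [m] := ubnP (size p); elim: m p => // m IH p /ltnSE pm p1.
have [irr|] := pselect (irreducible_poly p); first by exists p.
move=> nirr; have [q [q1 qp nqp]] : exists q : {poly K}, [/\ size q != 1%N, q %| p & ~~ (q %= p)].
  apply: contrapT => H; apply: nirr; split=> // q q1 qp.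
  by apply: contrapT => /negP nqp; apply: H; exists q.
have p0 : p != 0 by rewrite -size_poly_gt0 ltnW.
have q0 : q != 0 by apply: contraTneq qp => ->; rewrite dvd0p.
have qlt : (size q < size p)%N.
  by rewrite ltn_neqAle dvdp_leq // andbT dvdp_size_eqp.
have [r irr rq] : exists2 r, irreducible_poly r & r %| q.
  apply: IH; first exact: leq_trans qlt pm.
  by move: q0 q1; rewrite -size_poly_gt0; case: size => [|[]].
by exists r => //; exact: dvdp_trans rq qp.
Qed.

Lemma irreducible_dvdM (K : fieldType) (pi a b : {poly K}) :
  irreducible_poly pi -> pi %| a * b -> pi %| a \/ pi %| b.
Proof.
move=> irr H; case: (boolP (pi %| a)) => [|na]; first by left.
by right; rewrite -(Gauss_dvdpr _ (_ : coprimep pi a)) // irreducible_poly_coprime.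
Qed.

Lemma irreducible_mult (K : fieldType) (pi a : {poly K}) :
  irreducible_poly pi -> a != 0 -> exists m (b : {poly K}), ~~ (pi %| b) /\ a = b * pi ^+ m.
Proof.
move=> irr; have [m] := ubnP (size a); elim: m a => // m IH a /ltnSE am a0.
case: (boolP (pi %| a)) => [/dvdpP [b E]|na]; last first.
  by exists 0%N, a; rewrite expr0 mulr1.
have b0 : b != 0 by apply: contra_neq a0; rewrite E => ->; rewrite mul0r.
have [|j [c [nc Ec]]] := IH b _ b0.
  apply: leq_trans am; rewrite E size_mul ?(irredp_neq0 irr) //.
  by case: irr; case: (size pi) => [|[|j]] // _ _; rewrite !addnS ltnS leq_addr.
by exists j.+1, c; rewrite E Ec exprSr mulrA.
Qed.

Section SubfieldType.
Variables (k : closedFieldType) (F : sl2_field k) (K : set F) (HK : subfield K).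

Definition sub_pred of subfield K : {pred F} := fun x => `[< K x >].

Lemma sub_pred_divring : divring_closed (sub_pred HK).
Proof.
case: HK => Kr Ki; split.
- by apply/asboolP; exact: subr_1.
- by move=> x y /asboolP Kx /asboolP Ky; apply/asboolP; exact: subr_B.
- by move=> x y /asboolP Kx /asboolP Ky; apply/asboolP; apply: subr_M => //; exact: Ki.
Qed.

HB.instance Definition _ :=
  GRing.isDivringClosed.Build F (sub_pred HK) sub_pred_divring.

(** A genuine field type of coefficients gives access to divisibility and gcd of polynomials over
    [K]. *)
Record sub_field := SubField { sub_val :> F; sub_valP : sub_val \in sub_pred HK }.
HB.instance Definition _ := [isSub for sub_val].
HB.instance Definition _ := [Choice of sub_field by <:].
HB.instance Definition _ := [SubChoice_isSubComUnitRing of sub_field by <:].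
HB.instance Definition _ := [SubComUnitRing_isSubIntegralDomain of sub_field by <:].
HB.instance Definition _ := [SubIntegralDomain_isSubField of sub_field by <:].

Lemma sub_fieldP (x : sub_field) : K (val x).
Proof. by have /asboolP := sub_valP x. Qed.

Definition mk_sub (x : F) (Kx : K x) : sub_field := SubField (asboolT Kx).

End SubfieldType.

(** * Places of k(G) from unipotent one-parameter groups *)

Section Frames.
Variables (k : closedFieldType) (k0 : [pchar k] =i pred0) (F : sl2_field k).
Variables (n : nat) (n_gt0 : (0 < n)%N).
Local Notation cst := (ff_cst F).
Local Notation G := (OG F).
Local Notation K := (Kmu F n).

(* Coordinates on SL_2 in which a one-parameter group acts by                 *)
(* (x1, x2, x3) |-> (x1, x2, x3 + t x1); e is an invariant of weight 1.       *)
Record frame := Frame {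
  fr1 : F; fr2 : F; fr3 : F; fr4 : F; fre : F;
  fr_th : k -> {rmorphism F -> F};
  fr_det : fr1 * fr4 - fr2 * fr3 = 1;
  fr_in : [/\ G fr1, G fr2, G fr3, G fr4 & G fre];
  fr_gen : forall A : set F, subring A -> (forall c, A (cst c)) ->
    A fr1 -> A fr2 -> A fr3 -> A fr4 -> G `<=` A;
  fr_cst : forall t c, fr_th t (cst c) = cst c;
  fr_fix : forall t, [/\ fr_th t fr1 = fr1, fr_th t fr2 = fr2 & fr_th t fre = fre];
  fr_th3 : forall t, fr_th t fr3 = fr3 + cst t * fr1;
  fr1_neq0 : fr1 != 0;
  fre_neq0 : fre != 0;
  fre_weight : forall z R, mu_gen n z R -> weight z R 1 fre
}.

Variable fr : frame.
Local Notation x1 := (fr1 fr).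
Local Notation x2 := (fr2 fr).
Local Notation x3 := (fr3 fr).
Local Notation x4 := (fr4 fr).
Local Notation th := (fr_th fr).

Definition fixed : set F := [set f | forall t, th t f = f].

Let Gr := OG_subring F.

Lemma fixed_subfield : subfield fixed.
Proof.
split; first split.
- by move=> t; exact: rmorph1.
- by move=> a b Ha Hb t; rewrite rmorphB Ha Hb.
- by move=> a b Ha Hb t; rewrite rmorphM Ha Hb.
- by move=> a Ha t; rewrite fmorphV Ha.
Qed.

Let GF : set F := G `&` fixed.

Lemma Gfixed_subring : subring GF.
Proof. by apply: subringI => //; case: fixed_subfield. Qed.

(** L is made of fractions of regular invariants rather than of all invariant functions, so that the
    denominators of coefficients can be cleared inside O(G). *)
Lemma Lsub : subfield (frac_of GF).
Proof. exact/frac_of_subfield/Gfixed_subring. Qed.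

Local Notation L := (sub_field Lsub).

Lemma val_LM (a b : L) : val (a * b) = val a * val b. Proof. exact: rmorphM. Qed.
Lemma val_LV (a : L) : val a^-1 = (val a)^-1. Proof. exact: fmorphV. Qed.
Lemma val_L0 : val (0 : L) = 0. Proof. by []. Qed.

Lemma L_fixed (a : L) : fixed (val a).
Proof.
have [b [c [[_ Fb] [_ Fc] _ ->]]] := sub_fieldP a.
exact: subfield_div fixed_subfield Fb Fc.
Qed.

Lemma GF_L a : GF a -> exists l : L, val l = a.
Proof.
by move=> Ha; exists (mk_sub Lsub (frac_of_sub Gfixed_subring Ha)).
Qed.

Lemma GF_cst c : GF (cst c).
Proof. by split; [exact: OG_cst|move=> t; exact: fr_cst]. Qed.
Lemma GF_x1 : GF x1.
Proof. by split; [case: (fr_in fr)|move=> t; case: (fr_fix fr t)]. Qed.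
Lemma GF_x2 : GF x2.
Proof. by split; [case: (fr_in fr)|move=> t; case: (fr_fix fr t)]. Qed.
Lemma GF_e : GF (fre fr).
Proof. by split; [case: (fr_in fr)|move=> t; case: (fr_fix fr t)]. Qed.

Definition lift (p : {poly L}) : F := (map_poly val p).[x3].

Lemma liftD p q : lift (p + q) = lift p + lift q.
Proof. by rewrite /lift rmorphD hornerD. Qed.
Lemma liftB p q : lift (p - q) = lift p - lift q.
Proof. by rewrite /lift rmorphB hornerD hornerN. Qed.
Lemma liftM p q : lift (p * q) = lift p * lift q.
Proof. by rewrite /lift rmorphM hornerM. Qed.
Lemma liftXn p m : lift (p ^+ m) = lift p ^+ m.
Proof. by rewrite /lift rmorphXn horner_exp. Qed.
Lemma liftC c : lift c%:P = val c.
Proof. by rewrite /lift map_polyC hornerC. Qed.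
Lemma liftZ c p : lift (c *: p) = val c * lift p.
Proof. by rewrite -mul_polyC liftM liftC. Qed.
Lemma lift1 : lift 1 = 1.
Proof. by rewrite /lift rmorph1 hornerC. Qed.
Lemma lift0 : lift 0 = 0.
Proof. by rewrite /lift rmorph0 hornerC. Qed.
Lemma liftX : lift 'X = x3.
Proof. by rewrite /lift map_polyX hornerX. Qed.

(* x3 is transcendental over L: its translates x3 + t x1 are pairwise distinct. *)
Lemma lift_eq0 p : lift p = 0 -> p = 0.
Proof.
move=> E; pose q := map_poly val p; apply: (map_poly_inj val); rewrite rmorph0 -/q.
apply/eqP; apply: contraT => q0.
have rt t : root q (x3 + cst t * x1).
  rewrite /root -(fr_th3 fr t).
  have : th t q.[x3] = 0 by rewrite -/(lift p) E rmorph0.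
  rewrite -horner_map; have -> : map_poly (th t) q = q.
    by apply/polyP => i; rewrite !coef_map /=; exact: L_fixed.
  by move=> ->.
pose rs := [seq x3 + cst i%:R * x1 | i <- iota 0 (size q)].
have := max_poly_roots q0 (_ : all (root q) rs) (_ : uniq rs).
rewrite size_map size_iota ltnn => -> //.
- by apply/allP => _ /mapP [i _ ->].
- rewrite map_inj_uniq ?iota_uniq // => i j /addrI /(mulIf (fr1_neq0 fr)) /fmorph_inj.
  move=> H; wlog ij : i j H / (i <= j)%N.
    by move=> W; case: (leqP i j) => [|/ltnW] ij; [exact: W|apply/esym/W].
  apply/eqP; rewrite eqn_leq ij /= -subn_eq0 -(pnatr_eq0_char0 _ k0) natrB //.
  by rewrite H subrr.
Qed.

Lemma lift_inj : injective lift.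
Proof.
move=> p q E; apply/eqP; rewrite -subr_eq0; apply/eqP/lift_eq0.
by rewrite liftB E subrr.
Qed.

Lemma lift_neq0 p : p != 0 -> lift p != 0.
Proof. by apply: contra_neq => /lift_eq0. Qed.

Lemma G_lift f : G f -> exists p, lift p = f.
Proof.
move: f; apply: (fr_gen (f := fr) (A := [set f | exists p, lift p = f])) => /=.
- split.
  + by exists 1; exact: lift1.
  + by move=> _ _ [p <-] [q <-]; exists (p - q); exact: liftB.
  + by move=> _ _ [p <-] [q <-]; exists (p * q); exact: liftM.
- by move=> c; have [l <-] := GF_L (GF_cst c); exists l%:P; exact: liftC.
- by have [l <-] := GF_L GF_x1; exists l%:P; exact: liftC.
- by have [l <-] := GF_L GF_x2; exists l%:P; exact: liftC.
- by exists 'X; exact: liftX.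
have [l1 E1] := GF_L GF_x1; have [l2 E2] := GF_L GF_x2.
have Ev : val l1^-1 = x1^-1 by rewrite val_LV E1.
(* By the determinant relation, [x4 = (1 + x2 * x3) / x1]. *)
exists (l1^-1 *: (1 + l2 *: 'X)); rewrite liftZ liftD lift1 liftZ liftX E2 Ev.
apply: (mulfI (fr1_neq0 fr)); rewrite mulVKf ?fr1_neq0 //.
by rewrite -(fr_det fr); ring.
Qed.

Lemma F_lift f : exists p q, q != 0 /\ f = lift p / lift q.
Proof.
have [a [b [/G_lift [p <-] /G_lift [q <-] q0 ->]]] := OG_frac f.
by exists p, q; split=> //; apply: contra_neq q0 => ->; exact: lift0.
Qed.

Lemma lift_den p : exists l : L, [/\ l != 0, GF (val l) & G (lift (l *: p))].
Proof.
elim/poly_ind: p => [|p c [l [l0 Fl Hl]]].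
  exists 1; rewrite oner_neq0 scaler0 lift0; split=> //; last exact: subr_0.
  exact: subr_1 Gfixed_subring.
have [a [b [[Ga _] Hb b0 E]]] := sub_fieldP c.
have [m Em] := GF_L Hb.
have m0 : m != 0 by apply: contra_neq b0 => m0; rewrite -Em m0.
exists (m * l); split; first by rewrite mulf_neq0.
  by rewrite val_LM Em; exact: subr_M Gfixed_subring _ _ _ _.
rewrite scalerDr liftD scalerAl liftM liftX; apply: (subr_D Gr).
  apply: (subr_M Gr); last by case: (fr_in fr).
  by rewrite -scalerA liftZ Em; apply: (subr_M Gr) => //; case: Hb.
rewrite liftZ liftC val_LM Em E mulrAC mulrCA mulfV // mulr1.
by apply: (subr_M Gr) => //; case: Fl.
Qed.

(** * The place of k(G) = L(x3) at an irreducible polynomial of L[x3] *)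

Section Place.
Variables (pi : {poly L}) (irr : irreducible_poly pi).

Definition place : set F :=
  [set f | exists p q, ~~ (pi %| q) /\ f = lift p / lift q].

Let ndvd_neq0 q : ~~ (pi %| q) -> q != 0.
Proof. by apply: contraNneq => ->; exact: dvdp0. Qed.

Let ndvdM p q : ~~ (pi %| p) -> ~~ (pi %| q) -> ~~ (pi %| p * q).
Proof.
by move=> /negP np /negP nq; apply/negP => /(irreducible_dvdM irr) [].
Qed.

Let ndvd1 : ~~ (pi %| 1).
Proof.
apply/negP => /dvdp_leq; rewrite oner_neq0 size_poly1 => /(_ isT).
by case: irr => H _; rewrite leqNgt H.
Qed.

Lemma place_lift p : place (lift p).
Proof. by exists p, 1; rewrite lift1 divr1. Qed.

Lemma place_subring : subring place.
Proof.
split; first by rewrite -lift1; exact: place_lift.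
- move=> _ _ [p [q [nq ->]]] [p' [q' [nq' ->]]].
  exists (p * q' - p' * q), (q * q'); split; first exact: ndvdM.
  have := lift_neq0 (ndvd_neq0 nq); have := lift_neq0 (ndvd_neq0 nq').
  by rewrite liftB !liftM => ? ?; field; apply/andP.
- move=> _ _ [p [q [nq ->]]] [p' [q' [nq' ->]]].
  by exists (p * p'), (q * q'); split; [exact: ndvdM|rewrite !liftM mulf_div].
Qed.

Lemma place_unit p : ~~ (pi %| p) -> unit_in place (lift p).
Proof.
move=> np; split; [exact/lift_neq0/ndvd_neq0|exact: place_lift|].
by exists 1, p; rewrite lift1 div1r.
Qed.

Lemma place_max p : maxid place (lift p) <-> pi %| p.
Proof.
split=> [[_ H]|/dvdpP [q ->]].
  by apply: contraT => /place_unit /H.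
split; first exact: place_lift.
move=> [l0 _ [a [b [nb E]]]]; case/negP: (nb).
have : lift b = lift (q * pi * a).
  by rewrite liftM -[lift a](divfK (lift_neq0 (ndvd_neq0 nb))) -E mulrA mulfV // mul1r.
by move/lift_inj => ->; rewrite -mulrA dvdp_mull // dvdp_mulr.
Qed.

Lemma place_uniformizer : uniformizer setT place (lift pi).
Proof.
have pi0 := irredp_neq0 irr.
have [Mpi Npi] : maxid place (lift pi) by apply/place_max.
split=> //; first exact: lift_neq0.
move=> f _; have [p [q [q0 ->]]] := F_lift f.
move=> f0; have p0 : p != 0 by apply: contra_neq f0 => ->; rewrite lift0 mul0r.
have [i [p' [np Ep]]] := irreducible_mult irr p0.
have [j [q' [nq Eq]]] := irreducible_mult irr q0.
exists (lift p' / lift q'), (i%:Z - j%:Z); split.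
  have [a0 Oa Oa'] := place_unit np; have [b0 Ob Ob'] := place_unit nq.
  split; first by rewrite mulf_neq0 ?invr_eq0.
    exact: subr_M place_subring _ _ Oa Ob'.
  by rewrite invf_div; exact: subr_M place_subring _ _ Ob Oa'.
rewrite Ep Eq !liftM !liftXn expfzDr ?lift_neq0 // -invr_expz -!exprnP.
by rewrite invfM mulrACA.
Qed.

Lemma place_dvr : dvr setT place.
Proof.
split; [exact: subfieldT|exact: place_subring|by []|].
by exists (lift pi); exact: place_uniformizer.
Qed.

Lemma G_place : G `<=` place.
Proof. by move=> f /G_lift [p <-]; exact: place_lift. Qed.

Lemma L_place_max (l : L) : maxid place (val l) -> l = 0.
Proof.
rewrite -liftC => /place_max pil; apply/eqP; apply: contraT => l0.
have := dvdp_leq _ pil; rewrite polyC_eq0 l0 size_polyC l0 => /(_ isT).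
by case: irr => H _; rewrite leqNgt H.
Qed.

(** The denominators that clear the coefficients of a polynomial are nonzero constants of L[x3],
    hence prime to [pi]; so the place is the local ring of a point of G. *)
Lemma place_loc : place = loc G (G `&` maxid place).
Proof.
apply/seteqP; split; last exact: (loc_sub_dvr place_dvr Gr G_place).
move=> f [p [q [nq E]]].
have [l [l0 [Gl _] Glp]] := lift_den p; have [m [m0 [Gm _] Gmq]] := lift_den q.
have vl (c : L) : c != 0 -> val c != 0 by apply: contra_neq => E0; apply: val_inj; rewrite E0.
exists (val m * lift (l *: p)), (val l * lift (m *: q)); split.
- exact: subr_M.
- exact: subr_M.
- move=> [_]; rewrite -liftZ => /place_max.
  by rewrite !dvdpZr // (negPf nq).
rewrite E !liftZ; have := lift_neq0 (ndvd_neq0 nq); have := vl _ l0; have := vl _ m0.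
by move=> ? ? ?; field; apply/and3P.
Qed.

Lemma place_locals : locals G place.
Proof.
exists (G `&` maxid place); last exact: place_loc.
exact: (maxid_prime_ideal place_dvr Gr G_place).
Qed.

(** The norm over mu_n of a regular multiple of [pi] is a nonzero element of K in the maximal ideal,
    so the valuation is not trivial on K. *)
Lemma place_Kmu_dvr : dvr K (place `&` K).
Proof.
have Kf := Kmu_subfield k0 F n_gt0.
have [z [R HR]] := mu_gen_exists k0 F n_gt0.
apply: (dvr_restrict Kf place_dvr).
have [l [l0 _ Gl]] := lift_den pi.
have Ml : maxid place (lift (l *: pi)) by apply/place_max; rewrite dvdpZr.
have lp0 : lift (l *: pi) != 0.
  by apply: lift_neq0; rewrite scaler_eq0 negb_or l0 irredp_neq0.
exists (mu_norm n R (lift (l *: pi))).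
  by apply: (OGmu_Kmu k0 n_gt0); exact: (mu_norm_OGmu n_gt0 HR Gl).
split; first exact: mu_norm_eq0.
have [b Gb ->] := mu_norm_dvd n_gt0 HR Gl.
exact: (maxidM place_dvr (G_place Gb) Ml).
Qed.

Lemma maxid_place_Kmu f : maxid (place `&` K) f <-> K f /\ maxid place f.
Proof.
exact/maxid_setI/(Kmu_subfield k0 F n_gt0).
Qed.

Lemma place_Kmu_loc :
  place `&` K = loc (OGmu F n) (OGmu F n `&` maxid (place `&` K)).
Proof.
have Or := OGmu_subring k0 F n_gt0.
have OP : OGmu F n `<=` place `&` K.
  by move=> f Of; split; [apply: G_place; exact: OGmu_OG Of|exact: (OGmu_Kmu k0 n_gt0 Of)].
apply/seteqP; split; last exact: (loc_sub_dvr place_Kmu_dvr Or OP).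
move=> f [Of Kf]; have [z [R HR]] := mu_gen_exists k0 F n_gt0.
have := Of; rewrite {1}place_loc => -[a [b [Ga Gb Nb E]]].
have Ge : G (fre fr) by case: (fr_in fr).
(* [fre] is a nonzero element of L, so its powers can correct weights without entering the maximal
   ideal. *)
have pe : ~ maxid place (fre fr).
  have [l El] := GF_L GF_e; rewrite -El => /L_place_max l0.
  by move: (fre_neq0 fr); rewrite -El l0 val_L0 eqxx.
have pP x y : G x -> G y -> maxid place (x * y) -> maxid place x \/ maxid place y.
  by move=> /G_place Ox /G_place Oy; exact: (maxid_prime place_dvr Ox Oy).
have Nb' : ~ maxid place b by move=> Mb; exact: Nb.
have [a' [b' [? ? Nb'' ->]]] := mu_loc k0 n_gt0 HR
  (@maxidD _ _ _ _ place_dvr) (maxid_0 place_dvr) pP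
  (@maxid_1 _ _ _ _ place_dvr) Ge (fre_weight fr HR) pe
  (proj1 (KmuE k0 n_gt0 HR f) Kf) Ga Gb Nb' E.
exists a', b'; split=> //; move=> [_ /maxid_place_Kmu [_]]; exact.
Qed.

Lemma place_Kmu_locals : locals (OGmu F n) (place `&` K).
Proof.
have Or := OGmu_subring k0 F n_gt0.
exists (OGmu F n `&` maxid (place `&` K)); last exact: place_Kmu_loc.
apply: (maxid_prime_ideal place_Kmu_dvr Or) => f Of.
by split; [apply: G_place; exact: OGmu_OG Of|exact: (OGmu_Kmu k0 n_gt0 Of)].
Qed.

End Place.

Lemma irreducible_X : irreducible_poly ('X : {poly L}).
Proof. by rewrite -['X]subr0 -polyC0; exact: irredp_XsubC. Qed.

(* A function with neither zeros nor poles at the places has degree 0 in x3. *)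
Lemma places_unit_fixed f :
  (forall pi, irreducible_poly pi -> unit_in (place pi) f) -> fixed f.
Proof.
move=> Hf; have [p [q [q0 E]]] := F_lift f.
have p0 : p != 0.
  have [f0 _ _] := Hf _ irreducible_X.
  by apply: contra_neq f0; rewrite E => ->; rewrite lift0 mul0r.
pose d := gcdp p q; pose p' := p %/ d; pose q' := q %/ d.
have Ep : p' * d = p by rewrite divpK // dvdp_gcdl.
have Eq : q' * d = q by rewrite divpK // dvdp_gcdr.
have d0 : d != 0 by rewrite gcdp_eq0 negb_and p0.
have cop : coprimep p' q' by apply: coprimep_div_gcd; rewrite p0.
have E' : f = lift p' / lift q'.
  by rewrite E -Ep -Eq !liftM -mulf_div mulfV ?mulr1 // lift_neq0.
have p'0 : p' != 0 by apply: contra_neq p0 => p'0; rewrite -Ep p'0 mul0r.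
have q'0 : q' != 0 by apply: contra_neq q0 => q'0; rewrite -Eq q'0 mul0r.
have sz r s : f = lift r / lift s \/ f^-1 = lift r / lift s -> r != 0 -> coprimep r s ->
    (size r <= 1)%N.
  move=> Ef r0 cop'; rewrite leqNgt; apply/negP => /irreducible_factor [pi irr pir].
  have npis : ~~ (pi %| s).
    apply/negP => pis; move/coprimepP: cop' => /(_ pi pir pis).
    by rewrite -size_poly_eq1; case: irr => H _ /eqP H1; rewrite H1 in H.
  have D := place_dvr irr; have [us Os Os'] := place_unit irr npis.
  have M : maxid (place pi) (lift r / lift s).
    by rewrite mulrC; apply: (maxidM D) => //; apply/(place_max irr).
  case: M => _; apply; have := Hf pi irr.
  by case: Ef => <- // Uf; exact: unit_in_V.
have p1 : (size p' <= 1)%N by apply: (sz p' q') => //; left.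
have q1 : (size q' <= 1)%N.
  by apply: (sz q' p') => //; [right; rewrite E' invf_div|rewrite coprimep_sym].
rewrite E' (size1_polyC p1) (size1_polyC q1) !liftC.
exact: subfield_div fixed_subfield (L_fixed _) (L_fixed _).
Qed.

Definition x3_place : set F := place 'X.

Lemma x3_uniformizer : uniformizer setT x3_place x3.
Proof. by have := place_uniformizer irreducible_X; rewrite liftX. Qed.

(** Modulo [x3], every function becomes invariant after multiplication by a power of [x1]; an
    invariant in the maximal ideal is 0; and [x1] can be cancelled because [x1 * x4] is 1 modulo
    [x3]. *)
Lemma x3_place_ideal f : G f -> maxid x3_place f -> exists2 f', G f' & f = x3 * f'.
Proof.
have D := place_dvr irreducible_X.
have [G1 G2 G3 G4 _] := fr_in fr.
have Br := Gfixed_subring.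
pose A : set F := [set f | exists N a b, [/\ G a, GF b & x1 ^+ N * f = b + x3 * a]].
have AG : G `<=` A.
  apply: (fr_gen (f := fr)).
  - split.
    + exists 0%N, 0, 1; rewrite mulr0 addr0 expr0 mulr1; split=> //; exact: subr_0 || exact: subr_1.
    + move=> f1 f2 [N1 [a1 [b1 [Ga1 Gb1 E1]]]] [N2 [a2 [b2 [Ga2 Gb2 E2]]]].
      exists (N1 + N2)%N, (x1 ^+ N2 * a1 - x1 ^+ N1 * a2), (x1 ^+ N2 * b1 - x1 ^+ N1 * b2).
      split.
      * by apply: (subr_B Gr); apply: (subr_M Gr) => //; exact: (subr_X Gr).
      * by apply: (subr_B Br); apply: (subr_M Br) => //; apply: (subr_X Br); exact: GF_x1.
      * have -> : x1 ^+ (N1 + N2) * (f1 - f2) = x1 ^+ N2 * (x1 ^+ N1 * f1) - x1 ^+ N1 * (x1 ^+ N2 * f2).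
          by rewrite exprD; ring.
        by rewrite E1 E2; ring.
    + move=> f1 f2 [N1 [a1 [b1 [Ga1 Gb1 E1]]]] [N2 [a2 [b2 [Ga2 Gb2 E2]]]].
      exists (N1 + N2)%N, (a1 * b2 + b1 * a2 + x3 * a1 * a2), (b1 * b2); split.
      * have [Gb1' _] := Gb1; have [Gb2' _] := Gb2.
        by apply: (subr_D Gr); [apply: (subr_D Gr)|]; do ?apply: (subr_M Gr).
      * exact: (subr_M Br).
      * have -> : x1 ^+ (N1 + N2) * (f1 * f2) = (x1 ^+ N1 * f1) * (x1 ^+ N2 * f2).
          by rewrite exprD; ring.
        by rewrite E1 E2; ring.
  - move=> c; exists 0%N, 0, (cst c); rewrite mulr0 addr0 expr0 mul1r.
    by split=> //; [exact: subr_0|exact: GF_cst].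
  - exists 0%N, 0, x1; rewrite mulr0 addr0 expr0 mul1r.
    by split=> //; [exact: subr_0|exact: GF_x1].
  - exists 0%N, 0, x2; rewrite mulr0 addr0 expr0 mul1r.
    by split=> //; [exact: subr_0|exact: GF_x2].
  - exists 0%N, 1, 0; rewrite mulr1 add0r expr0 mul1r.
    by split=> //; [exact: subr_1|exact: (subr_0 Br)].
  - exists 1%N, x2, 1; split=> //; first exact: (subr_1 Br).
    by rewrite expr1 -(fr_det fr); ring.
move=> Gf Mf; have [N [a [b [Ga Gb E]]]] := AG _ Gf.
have b0 : b = 0.
  have [l El] := GF_L Gb; have Ob : maxid x3_place b.
    have -> : b = x1 ^+ N * f - a * x3 by rewrite E; ring.
    apply: (maxidB D); apply: (maxidM D) => //.
    - by apply: (G_place irreducible_X); exact: (subr_X Gr).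
    - exact: (G_place irreducible_X).
    - by apply: uniformizer_maxid; exact: x3_uniformizer.
  by move: Ob; rewrite -El => /(L_place_max irreducible_X) ->; exact: val_L0.
move: E; rewrite b0 add0r {b0 Gb b}.
elim: N f a Gf Ga {Mf} => [|N IH] f a Gf Ga; first by rewrite expr0 mul1r; exists a.
rewrite exprS => E.
have [f' Gf' Ef'] : exists2 f', G f' & x1 ^+ N * f = x3 * f'.
  exists (x4 * a - x2 * (x1 ^+ N * f)).
    by apply: (subr_B Gr); do ?apply: (subr_M Gr) => //; exact: (subr_X Gr).
  rewrite -[LHS]mul1r -(fr_det fr).
  have -> : (x1 * x4 - x2 * x3) * (x1 ^+ N * f) = x4 * (x1 * x1 ^+ N * f) - x2 * x3 * (x1 ^+ N * f).
    by ring.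
  by rewrite E; ring.
exact: IH Gf Gf' Ef'.
Qed.

End Frames.

(** * Units of O(G) *)

Definition lower (k : nzRingType) (t : k) : 'M[k]_2 := mat2 1 0 t 1.
Definition upper (k : nzRingType) (t : k) : 'M[k]_2 := mat2 1 t 0 1.

Lemma det_lower (k : comNzRingType) (t : k) : \det (lower t) = 1.
Proof. by rewrite det2E !mxE /= mulr1 mul0r subr0. Qed.
Lemma det_upper (k : comNzRingType) (t : k) : \det (upper t) = 1.
Proof. by rewrite det2E !mxE /= mulr1 mulr0 subr0. Qed.

Lemma mul2E (k : comNzRingType) (A B : 'M[k]_2) i j :
  (A *m B) i j = A i 0 * B 0 j + A i 1 * B 1 j.
Proof.
rewrite mxE !big_ord_recl big_ord0 addr0; congr (_ + A i _ * B _ j); exact/val_inj.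
Qed.

(** A matrix with nonzero lower left entry is a product upper, lower, upper; any other matrix is
    brought to this case by [lower 1]. *)
Lemma SL2_ind (k : fieldType) (S : 'M[k]_2 -> Prop) :
  (forall t, S (lower t)) -> (forall t, S (upper t)) ->
  (forall A B, \det A = 1 -> \det B = 1 -> S A -> S B -> S (A *m B)) ->
  forall A, \det A = 1 -> S A.
Proof.
move=> Sl Su SM.
have H A : \det A = 1 -> A 1 0 != 0 -> S A.
  move=> dA c0; move: (dA); rewrite det2E => dE.
  have -> : A = upper ((A 0 0 - 1) / A 1 0) *m (lower (A 1 0) *m upper ((A 1 1 - 1) / A 1 0)).
    apply/matrixP; apply: ord2_ind; apply: ord2_ind; rewrite !mul2E !mxE /=.
    - by field.
    - apply: (mulfI c0); have -> : A 1 0 * A 0 1 = A 0 0 * A 1 1 - 1 by rewrite -dE; ring.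
      by field.
    - by ring.
    - by field.
  apply: (SM); rewrite ?det_mulmx ?det_lower ?det_upper ?mulr1 //.
  by apply: (SM); rewrite ?det_lower ?det_upper.
move=> A dA; have [c0|] := eqVneq (A 1 0) 0; last exact: H.
have -> : A = lower (-1) *m (lower 1 *m A).
  by apply/matrixP; apply: ord2_ind; apply: ord2_ind; rewrite !mul2E !mxE /=; ring.
have dA' : \det (lower 1 *m A) = 1 by rewrite det_mulmx det_lower mul1r.
apply: SM => //; first exact: det_lower.
apply: H => //; rewrite mul2E !mxE /= c0 mul1r mulr0 addr0.
apply/eqP => a0; move: dA; rewrite det2E c0 a0 mul0r mulr0 subr0 => /esym/eqP.
by rewrite oner_eq0.
Qed.

Section Instances.
Variables (k : closedFieldType) (k0 : [pchar k] =i pred0) (F : sl2_field k).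
Variables (n : nat) (n_gt0 : (0 < n)%N).
Local Notation cst := (ff_cst F).
Local Notation gmx := (ff_gmx F).
Local Notation G := (OG F).
Local Notation K := (Kmu F n).
Local Notation g1 := (g1 F).
Local Notation g2 := (g2 F).
Local Notation g3 := (g3 F).
Local Notation g4 := (g4 F).

Lemma ltransM (h h' : 'M[k]_2) (f : F) : \det h = 1 -> \det h' = 1 ->
  ltrans (h *m h') f = ltrans h (ltrans h' f).
Proof.
move=> dh dh'; have dhh : \det (h *m h') = 1 by rewrite det_mulmx dh dh' mulr1.
have [a [Ea ac [a1 a2 a3 a4]]] := ltrans_rmorphism F dh.
have [b [Eb bc [b1 b2 b3 b4]]] := ltrans_rmorphism F dh'.
have [c [Ec cc [c1 c2 c3 c4]]] := ltrans_rmorphism F dhh.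
rewrite -Ea -Eb -Ec; rewrite -[RHS]/((a \o b) f); apply: rmorphism_gen.
  by move=> x; rewrite /= cc bc ac.
apply: ord2_ind; apply: ord2_ind; rewrite /= -/g1 -/g2 -/g3 -/g4.
- by rewrite c1 b1 rmorphB !rmorphM !ac a1 a3 !mul2E !rmorphD !rmorphM; ring.
- by rewrite c2 b2 rmorphB !rmorphM !ac a2 a4 !mul2E !rmorphD !rmorphM; ring.
- by rewrite c3 b3 rmorphB !rmorphM !ac a1 a3 !mul2E !rmorphD !rmorphM; ring.
- by rewrite c4 b4 rmorphB !rmorphM !ac a2 a4 !mul2E !rmorphD !rmorphM; ring.
Qed.

(** G acts transitively on itself: invariance under translation by [h0 *m invmx h] compares an
    arbitrary point [h] with a point [h0] where the denominator does not vanish. *)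
Lemma SL2_fixed_cst (f : F) :
  (forall h : 'M[k]_2, \det h = 1 -> ltrans h f = f) -> exists c, f = cst c.
Proof.
have [P [Q [Q0 ->]]] := gmx_generate f => Hf.
have [h0 dh0 Qh0] : exists2 h0 : 'M[k]_2, \det h0 = 1 & evalmx idfun h0 Q != 0.
  apply: contrapT => H; move/eqP: Q0; apply; apply/evg_eq0 => h dh.
  by apply/eqP; apply: contraT => Qh; case: H; exists h.
pose c := evalmx idfun h0 P / evalmx idfun h0 Q; exists c.
suff : evalmx cst gmx (P - c%:MP * Q) = 0.
  rewrite !evalmxE => /eqP; rewrite subr_eq0 => /eqP ->.
  by rewrite mulfK.
apply/evg_eq0 => h dh; rewrite !evalmxE /=.
have uh : h \in unitmx by rewrite unitmxE dh unitr1.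
have uh0 : h0 \in unitmx by rewrite unitmxE dh0 unitr1.
pose w := h0 *m invmx h.
have dw : \det w = 1 by rewrite det_mulmx det_inv dh dh0 invr1 mulr1.
have [P' HP'] := evalmx_transl (invmx w) 1%:M P.
have [Q' HQ'] := evalmx_transl (invmx w) 1%:M Q.
have dom : dominant (map_mx cst (invmx w) *m gmx).
  have := @dominant_transl _ F (invmx w) 1%:M.
  by rewrite map_mx1 mulmx1 det_inv dw invr1 det1; apply.
have := Hf w dw; rewrite /ltrans (pullE _ dom Q0).
have := HP' F cst gmx; have := HQ' F cst gmx; rewrite map_mx1 !mulmx1 => EQ EP.
have Q'0 : evalmx cst gmx Q' != 0 by rewrite EQ; apply: contra_neq Q0 => /dom.
rewrite -EQ -EP => /eqP; rewrite eqr_div // => /eqP E.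
have : evalmx cst gmx (P' * Q - P * Q') = 0 by rewrite !evalmxE E subrr.
move/evg_eq0/(_ h0 dh0); rewrite !evalmxE => /eqP; rewrite subr_eq0 => /eqP.
have := HP' k idfun h0; have := HQ' k idfun h0; rewrite !map_mx_id ?mulmx1 // => -> ->.
have -> : invmx w *m h0 = h.
  have uw : w \in unitmx by rewrite unitmxE dw unitr1.
  have E0 : w *m h = h0 by rewrite /w mulmxKV.
  by rewrite -E0 mulKmx.
move=> E2; apply/eqP; rewrite subr_eq0 /c; apply/eqP.
by apply: (mulIf Qh0); rewrite E2; field.
Qed.

Lemma frame_exists (x1 x2 x3 x4 e : F) (h : k -> 'M[k]_2) :
  (forall t, \det (h t) = 1) ->
  x1 * x4 - x2 * x3 = 1 -> [/\ G x1, G x2, G x3, G x4 & G e] ->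
  (forall A : set F, subring A -> (forall c, A (cst c)) ->
    A x1 -> A x2 -> A x3 -> A x4 -> [/\ A g1, A g2, A g3 & A g4]) ->
  (forall t, [/\ ltrans (h t) x1 = x1, ltrans (h t) x2 = x2 & ltrans (h t) e = e]) ->
  (forall t, ltrans (h t) x3 = x3 + cst t * x1) ->
  x1 != 0 -> e != 0 -> (forall z R, mu_gen n z R -> weight z R 1 e) ->
  exists fr : frame F n, [/\ fr1 fr = x1, fr2 fr = x2, fr3 fr = x3, fr4 fr = x4 &
    forall t f, fr_th fr t f = ltrans (h t) f].
Proof.
move=> dh det_x inG gen fix_x th3 x10 e0 we.
have /choice [th Hth] t : exists th : {rmorphism F -> F},
    th =1 ltrans (h t) /\ forall c, th (cst c) = cst c.
  by have [th [? ? _]] := ltrans_rmorphism F (dh t); exists th.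
have Eth t : th t =1 ltrans (h t) by case: (Hth t).
have Hgen (A : set F) : subring A -> (forall c, A (cst c)) ->
    A x1 -> A x2 -> A x3 -> A x4 -> G `<=` A.
  move=> Ar Ac A1 A2 A3 A4; have [? ? ? ?] := gen A Ar Ac A1 A2 A3 A4.
  by apply: OG_ind => //; apply: ord2_ind; apply: ord2_ind.
have Hc t c : th t (cst c) = cst c by case: (Hth t).
have Hfix t : [/\ th t x1 = x1, th t x2 = x2 & th t e = e].
  by rewrite !Eth; exact: fix_x.
have H3 t : th t x3 = x3 + cst t * x1 by rewrite Eth.
by exists (Frame det_x inG Hgen Hc Hfix H3 x10 e0 we); split=> //.
Qed.

Lemma g_neq0 : [/\ g1 != 0, g2 != 0, g3 != 0 & g4 != 0].
Proof.
have H i j (h : 'M[k]_2) : \det h = 1 -> h i j = 1 -> gmx i j != 0.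
  move=> dh hij; apply/eqP; rewrite -(evalmxX cst gmx) => /evg_eq0 /(_ h dh).
  by rewrite evalmxX hij => /eqP; rewrite oner_eq0.
split.
- by apply: (H 0 0 1%:M); rewrite ?det1 ?mxE.
- by apply: (H 0 1 (upper 1)); rewrite ?det_upper ?mxE.
- by apply: (H 1 0 (lower 1)); rewrite ?det_lower ?mxE.
- by apply: (H 1 1 1%:M); rewrite ?det1 ?mxE.
Qed.

Lemma G_g : [/\ G g1, G g2, G g3 & G g4].
Proof. by split; exact: OG_gmx. Qed.

Lemma weight_g3 z (R : {rmorphism F -> F}) : mu_gen n z R -> weight z R 1 g3.
Proof. by move=> HR; rewrite /weight expr1; case: (mu_gmx n_gt0 HR). Qed.

Lemma ltrans_lower t : [/\ ltrans (lower (- t)) g1 = g1,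
  ltrans (lower (- t)) g2 = g2, ltrans (lower (- t)) g3 = g3 + cst t * g1 &
  ltrans (lower (- t)) g4 = g4 + cst t * g2].
Proof.
have [th [E _ []]] := ltrans_rmorphism F (det_lower (- t)).
rewrite -!E !mxE /= => -> -> -> ->; rewrite rmorph0 rmorph1 rmorphN.
by split; ring.
Qed.

Lemma ltrans_upper t : [/\ ltrans (upper t) g1 = g1 - cst t * g3,
  ltrans (upper t) g2 = g2 - cst t * g4, ltrans (upper t) g3 = g3 &
  ltrans (upper t) g4 = g4].
Proof.
have [th [E _ []]] := ltrans_rmorphism F (det_upper t).
rewrite -!E !mxE /= => -> -> -> ->; rewrite rmorph0 rmorph1.
by split; ring.
Qed.

(** B multiplies [g3] and [g4] by the same constant, so [g3 - c * g4] defines a B-stable divisor of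
    G. The frame uses the opposite unipotent group, which moves this function. *)
Lemma frame_fin (c : k) : exists fr : frame F n,
  [/\ fr1 fr = g1 - cst c * g2, fr2 fr = g2, fr3 fr = g3 - cst c * g4, fr4 fr = g4 &
    forall t f, fr_th fr t f = ltrans (lower (- t)) f].
Proof.
have Gr := OG_subring F; have [G1 G2 G3 G4] := G_g; have [n1 n2 n3 n4] := g_neq0.
have Gc := OG_cst F c.
apply: (frame_exists (e := g1)) => //.
- by move=> t; exact: det_lower.
- by rewrite -(det_gmx F); ring.
- by split=> //; apply: (subr_B Gr) => //; exact: (subr_M Gr).
- move=> A Ar Ac A1 A2 A3 A4; split=> //.
    by rewrite -[g1](subrK (cst c * g2)); apply: (subr_D Ar) => //; exact: (subr_M Ar).
  by rewrite -[g3](subrK (cst c * g4)); apply: (subr_D Ar) => //; exact: (subr_M Ar).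
- move=> t; have [E1 E2 E3 E4] := ltrans_lower t.
  have [th [E Hc _]] := ltrans_rmorphism F (det_lower (- t)).
  by rewrite -!E rmorphB rmorphM Hc !E E1 E2.
- move=> t; have [E1 E2 E3 E4] := ltrans_lower t.
  have [th [E Hc _]] := ltrans_rmorphism F (det_lower (- t)).
  by rewrite -!E rmorphB rmorphM Hc !E E3 E4; ring.
- apply/eqP => E.
  have : evalmx cst gmx (Xmx k 0 0 - c%:MP * Xmx k 0 1) = 0 by rewrite !evalmxE.
  move/evg_eq0/(_ 1%:M (det1 _ _)); rewrite !evalmxE /= !mxE /= mulr0 subr0.
  by move/eqP; rewrite oner_eq0.
- by move=> z R; exact: weight_g1.
Qed.

(** The frame for the remaining B-stable divisor, [g4 = 0]. *)
Lemma frame_inf : exists fr : frame F n,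
  [/\ fr1 fr = g2, fr2 fr = - g1, fr3 fr = g4, fr4 fr = - g3 &
    forall t f, fr_th fr t f = ltrans (lower (- t)) f].
Proof.
have Gr := OG_subring F; have [G1 G2 G3 G4] := G_g; have [n1 n2 n3 n4] := g_neq0.
apply: (frame_exists (e := g1)) => //.
- by move=> t; exact: det_lower.
- by rewrite -(det_gmx F); ring.
- by split=> //; exact: (subr_N Gr).
- move=> A Ar Ac A1 A2 A3 A4; split=> //; rewrite -[X in A X]opprK; exact: (subr_N Ar).
- move=> t; have [E1 E2 E3 E4] := ltrans_lower t.
  have [th [E Hc _]] := ltrans_rmorphism F (det_lower (- t)).
  by rewrite -!E rmorphN !E E1 E2.
- by move=> t; have [] := ltrans_lower t.
- by move=> z R; exact: weight_g1.
Qed.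

Lemma frame_op : exists fr : frame F n,
  [/\ fr1 fr = g3, fr2 fr = g4, fr3 fr = - g1, fr4 fr = - g2 &
    forall t f, fr_th fr t f = ltrans (upper t) f].
Proof.
have Gr := OG_subring F; have [G1 G2 G3 G4] := G_g; have [n1 n2 n3 n4] := g_neq0.
apply: (frame_exists (e := g3)) => //.
- by move=> t; exact: det_upper.
- by rewrite -(det_gmx F); ring.
- by split=> //; exact: (subr_N Gr).
- move=> A Ar Ac A1 A2 A3 A4; split=> //; rewrite -[X in A X]opprK; exact: (subr_N Ar).
- by move=> t; have [E1 E2 E3 E4] := ltrans_upper t.
- move=> t; have [E1 E2 E3 E4] := ltrans_upper t.
  have [th [E Hc _]] := ltrans_rmorphism F (det_upper t).
  by rewrite -!E rmorphN !E E1; ring.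
- by move=> z R; exact: weight_g3.
Qed.

(* f is invariant under two opposite unipotent groups, which generate SL_2.   *)
Lemma units_cst (f : F) :
  (forall O, locals G O -> dvr setT O -> locals (OGmu F n) (O `&` K) ->
     dvr K (O `&` K) -> unit_in O f) -> exists c, f = cst c.
Proof.
move=> Hf; have H (fr : frame F n) : fixed fr f.
  apply: (places_unit_fixed k0) => pi irr.
  apply: Hf; [exact: place_locals|exact: place_dvr|
    exact: place_Kmu_locals|exact: place_Kmu_dvr].
have [fr [_ _ _ _ Efr]] := frame_fin 0; have [fr' [_ _ _ _ Efr']] := frame_op.
apply: SL2_fixed_cst; apply: SL2_ind.
- by move=> t; rewrite -[t]opprK -Efr; exact: H.
- by move=> t; rewrite -Efr'; exact: H.
- by move=> A B dA dB HA HB; rewrite ltransM // HB HA.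
Qed.

End Instances.

(** * Finiteness of the places through a given function *)

Section Noetherian.
Variables (k : closedFieldType) (F : sl2_field k).
Local Notation cst := (ff_cst F).
Implicit Types (A I J p : set F).

Definition ideal A I : Prop :=
  [/\ I `<=` A, I 0, forall a b, I a -> I b -> I (a + b) &
      forall a b, A a -> I b -> I (a * b)].

Definition span A (S : set F) : set F :=
  [set f | A f /\ forall I, ideal A I -> S `<=` I -> I f].

Lemma span_ideal A S : subring A -> ideal A (span A S).
Proof.
move=> Ar; split.
- by move=> f [].
- by split; [exact: subr_0|move=> I []].
- move=> a b [Aa Ha] [Ab Hb]; split; first exact: subr_D.
  by move=> I II SI; have [_ _ ID _] := II; apply: ID; [exact: Ha|exact: Hb].
- move=> a b Aa [Ab Hb]; split; first exact: subr_M.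
  by move=> I II SI; have [_ _ _ IM] := II; apply: IM => //; exact: Hb.
Qed.

Lemma span_sub A S : S `<=` A -> S `<=` span A S.
Proof. by move=> SA f Sf; split; [exact: SA|move=> I _; exact]. Qed.

Lemma span_min A S I : ideal A I -> S `<=` I -> span A S `<=` I.
Proof. by move=> II SI f [_]; apply. Qed.

Lemma prime_ideal_ideal A p : prime_ideal A p -> ideal A p.
Proof. by case=> pA [p0 _] pD pM _; split. Qed.

Definition noetherian A : Prop := forall I, ideal A I ->
  exists gs : seq F, [set` gs] `<=` I /\ I `<=` span A [set` gs].

Definition polys A : set {poly F} := [set P | forall i, A P`_i].

Definition adjoin A (x : F) : set F :=
  [set f | exists2 P, polys A P & f = P.[x]].

Lemma polysB A P Q : subring A -> polys A P -> polys A Q -> polys A (P - Q).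
Proof. by move=> Ar HP HQ i; rewrite coefB; exact: subr_B. Qed.
Lemma polysD A P Q : subring A -> polys A P -> polys A Q -> polys A (P + Q).
Proof. by move=> Ar HP HQ i; rewrite coefD; exact: subr_D. Qed.
Lemma polysM A P Q : subring A -> polys A P -> polys A Q -> polys A (P * Q).
Proof.
move=> Ar HP HQ i; rewrite coefM; apply: (subr_sum Ar) => j _; exact: subr_M.
Qed.
Lemma polysC A c : subring A -> A c -> polys A c%:P.
Proof. by move=> Ar Ac i; rewrite coefC; case: eqP => // _; exact: subr_0. Qed.
Lemma polysXn A m : subring A -> polys A 'X^m.
Proof.
by move=> Ar i; rewrite coefXn; case: eqP => _; [exact: subr_1|exact: subr_0].
Qed.

Lemma adjoin_subring A x : subring A -> subring (adjoin A x).
Proof.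
move=> Ar; split.
- by exists 1; [apply: polysC => //; exact: subr_1|rewrite hornerC].
- move=> _ _ [P HP ->] [Q HQ ->].
  by exists (P - Q); [exact: polysB|rewrite hornerD hornerN].
- move=> _ _ [P HP ->] [Q HQ ->].
  by exists (P * Q); [exact: polysM|rewrite hornerM].
Qed.

Lemma adjoin_sub A x : subring A -> A `<=` adjoin A x.
Proof. by move=> Ar a Aa; exists a%:P; [exact: polysC|rewrite hornerC]. Qed.

Lemma adjoin_gen A x : subring A -> adjoin A x x.
Proof. by move=> Ar; exists 'X^1; [exact: polysXn|rewrite expr1 hornerX]. Qed.

(** * Hilbert's basis theorem for a ring A[x] inside F *)

Section HilbertBasis.
Variables (A : set F) (Ar : subring A) (An : noetherian A) (x : F).
Variables (I : set F) (II : ideal (adjoin A x) I).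

Let I0 : I 0. Proof. by case: II. Qed.
Let ID a b : I a -> I b -> I (a + b). Proof. by case: II => _ _ H _; exact: H. Qed.
Let IM a b : adjoin A x a -> I b -> I (a * b). Proof. by case: II => _ _ _; apply. Qed.

Let lifts (J : set F) d (P : {poly F}) : Prop :=
  [/\ polys A P, (size P <= d.+1)%N & J P.[x]].

Let lead (J : set F) (d : nat) : set F := [set a | exists2 P, lifts J d P & P`_d = a].

Let lead_ideal J d : ideal (adjoin A x) J -> ideal A (lead J d).
Proof.
move=> [JA J0 JD JM]; split.
- by move=> _ [P [HP _ _] <-].
- exists 0; last by rewrite coef0.
  by split; [move=> i; rewrite coef0; exact: subr_0|rewrite size_poly0|rewrite horner0].
- move=> _ _ [P [HP sP JP] <-] [Q [HQ sQ JQ] <-]; exists (P + Q); last by rewrite coefD.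
  split; [exact: polysD| |by rewrite hornerD; exact: JD].
  by apply: leq_trans (size_polyD _ _) _; rewrite geq_max sP.
- move=> a _ Aa [P [HP sP JP] <-]; exists (a%:P * P); last by rewrite coefCM.
  split; [by apply: polysM => //; exact: polysC| |].
    by rewrite mul_polyC; apply: leq_trans (size_scale_leq _ _) _.
  by rewrite hornerM hornerC; apply: JM => //; exact: adjoin_sub.
Qed.

(** Finitely many elements of [I] realize generators of its leading ideal in degree [d]. [J] is left
    arbitrary because it will be generated by such elements from several degrees at once. *)
Let lead_fg d : exists hs : seq F, [set` hs] `<=` I /\
  forall J, ideal (adjoin A x) J -> J `<=` I -> [set` hs] `<=` J -> lead I d `<=` lead J d.
Proof.
have [gs [gI Ig]] := An (lead_ideal d II).
have [hs [hI hg]] : exists hs : seq F, [set` hs] `<=` I /\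
    forall J, [set` hs] `<=` J -> [set` gs] `<=` lead J d.
  elim: gs gI {Ig} => [|g gs IH] gI; first by exists [::]; split=> //.
  have [|hs [hI hg]] := IH; first by move=> f fgs; apply: gI; rewrite /= in_cons fgs orbT.
  have [|P [HP sP IP] Pg] := gI g; first by rewrite /= mem_head.
  exists (P.[x] :: hs); split.
    by move=> f; rewrite /= in_cons => /orP[/eqP -> //|]; exact: hI.
  move=> J hJ f; rewrite /= in_cons => /orP[/eqP ->|fgs].
    by exists P => //; split=> //; apply: hJ; rewrite /= mem_head.
  by apply: (hg J) => // e ehs; apply: hJ; rewrite /= in_cons ehs orbT.
exists hs; split=> // J JI _ hJ f If.
by apply: (span_min (lead_ideal d JI)) (Ig _ If); exact: hg.
Qed.

Let leadS d d' : (d <= d')%N -> lead I d `<=` lead I d'.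
Proof.
move=> dd _ [P [HP sP IP] <-]; exists (P * 'X^(d' - d)).
  split; [by apply: polysM => //; exact: polysXn| |].
    have [->|P0] := eqVneq P 0; first by rewrite mul0r size_poly0.
    by rewrite size_mulXn // -[in leqRHS](subnK dd) -addnS leq_add2l.
  by rewrite hornerM mulrC; apply: IM => //; exists 'X^(d' - d) => //; exact: polysXn.
by rewrite coefMXn ltnNge leq_subr /= subKn.
Qed.

Lemma hilbert_basis_ideal : exists gs : seq F,
  [set` gs] `<=` I /\ I `<=` span (adjoin A x) [set` gs].
Proof.
have Axr := adjoin_subring x Ar.
pose U : set F := [set a | exists d, lead I d a].
have UI : ideal A U.
  split.
  - by move=> a [d [P [HP _ _] <-]].
  - by exists 0%N; case: (lead_ideal 0 II).
  - move=> a b [d Ha] [d' Hb]; exists (maxn d d').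
    have [_ _ H _] := lead_ideal (maxn d d') II; apply: H.
      exact: leadS (leq_maxl _ _) _ Ha.
    exact: leadS (leq_maxr _ _) _ Hb.
  - by move=> a b Aa [d Hb]; exists d; case: (lead_ideal d II) => _ _ _; apply.
have [us [uU Uu]] := An UI.
have [D HD] : exists D, [set` us] `<=` lead I D.
  elim: us uU {Uu} => [|u us IH] uU; first by exists 0%N.
  have [|D HD] := IH; first by move=> f fus; apply: uU; rewrite /= in_cons fus orbT.
  have [|d Hd] := uU u; first by rewrite /= mem_head.
  exists (maxn d D) => f; rewrite /= in_cons => /orP[/eqP ->|fus].
    exact: leadS (leq_maxl _ _) _ Hd.
  exact: leadS (leq_maxr _ _) _ (HD _ fus).
have UD : U `<=` lead I D by move=> a /Uu; apply: (span_min (lead_ideal D II)).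
have /choice [hs Hhs] := lead_fg.
pose gs := flatten [seq hs d | d <- iota 0 D.+1].
have gI : [set` gs] `<=` I.
  move=> f /= /flattenP [s /mapP [d _ ->]]; by case: (Hhs d) => H _ /H.
pose J := span (adjoin A x) [set` gs].
have JJ : ideal (adjoin A x) J by exact: span_ideal.
have JI : J `<=` I by exact: span_min.
have leadJ d : (d <= D)%N -> lead I d `<=` lead J d.
  move=> dD; have [_ H] := Hhs d; apply: H => // f fd.
  apply: span_sub; first by move=> g /gI; case: II => H _ _ _; exact: H.
  by apply/flattenP; exists (hs d) => //; apply: map_f; rewrite mem_iota.
exists gs; split=> // f If; have [IA _ _ _] := II; have [P HP E] := IA _ If.
rewrite E in If *; rewrite -/J {f E}.
have [_ J0 JD JM] := JJ.
(* Subtracting an element of [J] with the same leading coefficient lowers the size; beyond degree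
   [D] this element is one of degree [D] shifted by a power of [x]. *)
have [m] := ubnP (size P); elim: m P HP If => // m IH P HP IP /ltnSE sP.
have [P0|P0] := eqVneq P 0; first by rewrite P0 horner0.
pose d := (size P).-1; have sPd : size P = d.+1 by rewrite prednK // size_poly_gt0.
have Ld : lead I d P`_d by exists P => //; split=> //; rewrite sPd.
have [Q [HQ sQ JQ] EQ] : lead J d P`_d.
  case: (leqP d D) => dD; first exact: leadJ.
  have [Q [HQ sQ JQ] EQ] := leadJ D (leqnn D) _ (UD _ (ex_intro _ d Ld)).
  exists (Q * 'X^(d - D)).
    split; [by apply: polysM => //; exact: polysXn| |].
      have [->|Q0] := eqVneq Q 0; first by rewrite mul0r size_poly0.
      by rewrite size_mulXn // -[in leqRHS](subnK (ltnW dD)) -addnS leq_add2l.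
    by rewrite hornerM mulrC; apply: JM => //; exists 'X^(d - D) => //; exact: polysXn.
  by rewrite coefMXn ltnNge leq_subr /= subKn // ltnW.
have -> : P.[x] = (P - Q).[x] + Q.[x] by rewrite hornerD hornerN subrK.
apply: (JD) => //; apply: IH.
- exact: polysB.
- rewrite hornerD hornerN; apply: ID => //; rewrite -mulN1r; apply: IM; last exact: JI.
  by apply: (subr_N Axr); exact: subr_1.
- apply: leq_trans sP; rewrite sPd ltnS; apply/leq_sizeP => j dj.
  rewrite coefB; have [->|jd] := eqVneq j d; first by rewrite EQ subrr.
  have {}dj : (d < j)%N by rewrite ltn_neqAle eq_sym jd.
  by rewrite !nth_default ?subrr // ?sPd // (leq_trans sQ).
Qed.
End HilbertBasis.

Lemma adjoin_noetherian A x : subring A -> noetherian A -> noetherian (adjoin A x).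
Proof. move=> Ar An I II; exact: hilbert_basis_ideal. Qed.

Fixpoint alg (xs : seq F) : set F :=
  if xs is x :: s then adjoin (alg s) x else range cst.

Lemma alg_subring xs : subring (alg xs).
Proof.
elim: xs => [|x s IH] /=; last exact: adjoin_subring.
split; first by exists 1; rewrite ?rmorph1.
- by move=> _ _ [a _ <-] [b _ <-]; exists (a - b); rewrite ?rmorphB.
- by move=> _ _ [a _ <-] [b _ <-]; exists (a * b); rewrite ?rmorphM.
Qed.

Lemma alg_noetherian xs : noetherian (alg xs).
Proof.
elim: xs => [|x s IH] /=; last by apply: adjoin_noetherian => //; exact: alg_subring.
move=> I [IA I0 ID IM].
case: (pselect (exists2 a, I a & a != 0)) => [[a Ia a0]|H]; last first.
  exists [::]; split=> // f If.
  have -> : f = 0 by apply: contrapT => /eqP f0; apply: H; exists f.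
  by case: (span_ideal [set` [::]] (alg_subring [::])).
exists [:: a]; split; first by move=> f; rewrite /= inE => /eqP ->.
move=> f If; split; first exact: IA.
move=> J [_ _ _ JM] aJ; rewrite -[f](divfK a0); apply: JM; last first.
  by apply: aJ; rewrite /= mem_head.
have [c _ <-] := IA _ If; have [c' _ <-] := IA _ Ia.
by exists (c / c') => //; rewrite fmorph_div.
Qed.

Lemma affine_algE A : affine_alg A -> exists xs, A = alg xs.
Proof.
move=> [r [x ->]]; exists [seq x i | i <- enum 'I_r].
apply/seteqP; split.
  move=> _ [P _ <-]; have Ar := alg_subring [seq x i | i <- enum 'I_r].
  elim/mpoly_ring_ind: P => [c|i|a b Ha Hb|a b Ha Hb].
  - rewrite mmapC; elim: (map _ _) => [|y s IH] /=; first by exists c.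
    by apply: adjoin_sub => //; exact: alg_subring.
  - rewrite mmapX mmap1U {Ar}; have : x i \in [seq x i | i <- enum 'I_r].
      by apply: map_f; rewrite mem_enum.
    elim: (map _ _) => [|y s IH] //=; rewrite in_cons => /orP[/eqP ->|/IH].
      by apply: adjoin_gen; exact: alg_subring.
    by apply: adjoin_sub; exact: alg_subring.
  - by rewrite rmorphD; exact: (subr_D Ar).
  - by rewrite rmorphM; exact: (subr_M Ar).
set B := range _; have Br : subring B.
  split; first by exists 1; rewrite ?rmorph1.
  - by move=> _ _ [P _ <-] [Q _ <-]; exists (P - Q); rewrite ?rmorphB.
  - by move=> _ _ [P _ <-] [Q _ <-]; exists (P * Q); rewrite ?rmorphM.
have : forall y, y \in [seq x i | i <- enum 'I_r] -> B y.
  by move=> _ /mapP [i _ ->]; exists 'X_i => //; rewrite mmapX mmap1U.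
elim: (map _ _) => [|y s IH] yB /=; first by move=> _ [c _ <-]; exists c%:MP; rewrite ?mmapC.
move=> _ [P HP ->]; rewrite horner_coef; apply: (subr_sum Br) => i _.
apply: (subr_M Br); last by apply: (subr_X Br); apply: yB; rewrite mem_head.
by apply: IH (HP i) => z zs; apply: yB; rewrite in_cons zs orbT.
Qed.

(** * Finiteness of the divisorial primes containing a given function *)

Section FinitelyManyPlaces.
Variables (A K : set F) (Ar : subring A) (An : noetherian A).
Variables (b : F) (b0 : b != 0).

Let T : set (set F) := [set p | [/\ prime_ideal A p, dvr K (loc A p) & p b]].

(* A power of each generator g of p becomes a multiple of b after             *)
(* multiplication by some c outside p: every other p' through b contains c.   *)
Let separate p : T p -> exists2 c, A c & ~ p c /\ forall p', T p' -> p' <> p -> p' c.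
Proof.
move=> [Pp D pb]; have [pA [p0 p1] pD pM pP] := Pp.
have [gs [gp pg]] := An (prime_ideal_ideal Pp).
have [c Ac [npc Hc]] : exists2 c, A c & ~ p c /\
    forall p', T p' -> (exists2 g, g \in gs & ~ p' g) -> p' c.
  elim: gs gp {pg} => [|g gs IH] gp.
    by exists 1; [exact: subr_1|split=> // p' _ []].
  have [|c' Ac' [npc' Hc']] := IH; first by move=> f fgs; apply: gp; rewrite /= in_cons fgs orbT.
  have pg : p g by apply: gp; rewrite /= mem_head.
  have [c Ac [npc [m [a [Aa E]]]]] : exists2 c, A c & ~ p c /\ exists m a, A a /\ g ^+ m * c = b * a.
    have [->|g0] := eqVneq g 0.
      exists 1; [exact: subr_1|split=> //]; exists 1%N, 0; rewrite mul0r mulr0; split=> //.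
      exact: subr_0.
    have inK f : A f -> K f by move=> Af; apply: (dvr_sub D); exact: loc_sub.
    have [Kf _ _ _] := D; have [Kr Ki] := Kf.
    have Kg := inK _ (pA _ pg); have Kb := inK _ (pA _ pb).
    have og : 0 < ord K (loc A p) g by apply/(ord_gt0 D) => //; apply/loc_maxid => //; exact: pA.
    have ob : 0 <= ord K (loc A p) b by apply/(ord_ge0 D) => //; apply: loc_sub => //; exact: pA.
    pose m := `|ord K (loc A p) b|%N.
    have : loc A p (g ^+ m / b).
      apply/(ord_ge0 D); rewrite ?mulf_neq0 ?expf_neq0 ?invr_eq0 //.
        by apply: subfield_div => //; exact: subr_X.
      rewrite (ordM D) ?(ordX D) ?(ordV D) ?expf_neq0 ?invr_eq0 //; last 2 first.
      - exact: subr_X.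
      - exact: Ki.
      by rewrite subr_ge0 -[X in X <= _](gez0_abs ob) -mulr_natl natz ler_peMr.
    move=> [a [c [Aa Ac npc E]]]; exists c => //; split=> //; exists m, a; split=> //.
    have c0 : c != 0 by apply/eqP => c0; apply: npc; rewrite c0.
    by move/(congr1 (fun y => y * b * c)): E; rewrite divfK // => ->; field.
  exists (c * c'); first exact: subr_M.
  split; first exact: prime_ideal_notin Pp _ _ _ _.
  move=> p' Tp' [f]; have [[pA' _ _ pM' pP'] _ pb'] := Tp'.
  rewrite in_cons => /orP[/eqP ->|fgs] nf; last first.
    by apply: (pM') => //; apply: Hc' => //; exists f.
  rewrite mulrC; apply: (pM') => //.
  have : p' (g ^+ m * c) by rewrite E mulrC; exact: pM'.
  case/(pP' _ _ (subr_X Ar m (pA _ pg)) Ac) => //.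
  by have [Pp' _ _] := Tp'; move/(prime_idealX Ar Pp' (pA _ pg)).
exists c => //; split=> // p' Tp' p'p; apply: Hc => //.
apply: contrapT => H; apply: p'p; have [Pp' D' pb'] := Tp'.
(* All generators of [p] lie in [p'], so [p] is contained in [p'], which has height one. *)
symmetry; apply: (dvr_loc_height1 Ar Pp' D' Pp); last by exists b.
move=> f /pg; apply: span_min; first exact: prime_ideal_ideal.
by move=> g ggs; apply: contrapT => ng; apply: H; exists g.
Qed.

(** By noetherianity the ideal of all separating elements [c p] is generated by those of a finite
    list [ps]. If [p] were outside the list, these would all lie in [p], and so would [c p]. *)
Lemma finitely_many_places : exists ps : seq (set F), forall p,
  prime_ideal A p -> dvr K (loc A p) -> p b -> p \in ps.
Proof.
have [c Hc] : exists c : set F -> F, forall p, T p ->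
    [/\ A (c p), ~ p (c p) & forall p', T p' -> p' <> p -> p' (c p)].
  have /choice [c Hc] p : exists c, T p ->
      [/\ A c, ~ p c & forall p', T p' -> p' <> p -> p' c].
    by case: (pselect (T p)) => [/separate [c Ac []]|]; [exists c|exists 0].
  by exists c.
pose J := span A [set c p | p in T].
have cA : [set c p | p in T] `<=` A by move=> _ [p /Hc [? _ _] <-].
have [gs [gJ Jg]] := An (span_ideal [set c p | p in T] Ar).
pose fin (ps : seq (set F)) := span A [set c p | p in [set p | T p /\ p \in ps]].
have finA ps : [set c p | p in [set p | T p /\ p \in ps]] `<=` A.
  by move=> _ [p [Tp _] <-]; apply: cA; exists p.
have finS (ps qs : seq (set F)) : {subset ps <= qs} -> fin ps `<=` fin qs.
  move=> sub; apply: span_min; first exact: span_ideal.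
  move=> _ [p [Tp pps] <-]; apply: span_sub; first exact: finA.
  by exists p => //; split=> //; exact: sub.
have UI : ideal A [set f | exists ps, fin ps f].
  have fI ps : ideal A (fin ps) by exact: span_ideal.
  split.
  - by move=> f [ps]; case: (fI ps) => H _ _ _; exact: H.
  - by exists [::]; case: (fI [::]).
  - move=> f g [ps Hf] [qs Hg]; exists (ps ++ qs); case: (fI (ps ++ qs)) => _ _ H _; apply: H.
      by apply: finS Hf => p pps; rewrite mem_cat pps.
    by apply: finS Hg => p pps; rewrite mem_cat pps orbT.
  - by move=> f g Af [ps Hg]; exists ps; case: (fI ps) => _ _ _; apply.
have JU : J `<=` [set f | exists ps, fin ps f].
  apply: span_min => // _ [p Tp <-]; exists [:: p]; apply: span_sub; first exact: finA.
  by exists p => //; split=> //; rewrite mem_head.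
have [ps Hps] : exists ps, [set` gs] `<=` fin ps.
  have : forall g, g \in gs -> exists ps, fin ps g by move=> g /gJ /JU.
  elim: gs {gJ Jg} => [|g gs IH] H; first by exists [::].
  have [|ps Hps] := IH; first by move=> f fgs; apply: H; rewrite in_cons fgs orbT.
  have [|qs Hqs] := H g; first exact: mem_head.
  exists (qs ++ ps) => f; rewrite /= in_cons => /orP[/eqP ->|fgs].
    by apply: finS Hqs => p pps; rewrite mem_cat pps.
  by apply: finS (Hps _ fgs) => p pps; rewrite mem_cat pps orbT.
exists ps => p Pp D pb; have Tp : T p by [].
apply: contraT => /negP npps; have [_ npc _] := Hc p Tp; case: npc.
have : J (c p) by apply: span_sub => //; exists p.
move/Jg; apply: span_min; first exact: prime_ideal_ideal.
apply: subset_trans Hps _; apply: span_min; first exact: prime_ideal_ideal.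
move=> _ [p' [Tp' p'ps] <-]; have [_ _ H] := Hc p' Tp'; apply: H => // pp'.
by apply: npps; rewrite pp'.
Qed.

End FinitelyManyPlaces.
End Noetherian.

(** * Boundary divisors *)

Section Embedding.
Variables (k : closedFieldType) (k0 : [pchar k] =i pred0) (F : sl2_field k).
Variables (n : nat) (n_gt0 : (0 < n)%N) (X : embedding F n).
Local Notation cst := (ff_cst F).
Local Notation gmx := (ff_gmx F).
Local Notation G := (OG F).
Local Notation K := (Kmu F n).
Local Notation g1 := (g1 F).
Local Notation g2 := (g2 F).
Local Notation g3 := (g3 F).
Local Notation g4 := (g4 F).
Local Notation OGn := (OGmu F n).
Implicit Types (P Q : prime_divisor X).

Let Kf : subfield K := Kmu_subfield k0 F n_gt0.
Let Kr : subring K. Proof. by case: Kf. Qed.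
Let OGnr : subring OGn := OGmu_subring k0 F n_gt0.

Lemma affine_alg_subring (A : set F) : affine_alg A -> subring A.
Proof. by move=> /affine_algE [xs ->]; exact: alg_subring. Qed.

Lemma affine_alg_cst (A : set F) c : affine_alg A -> A (cst c).
Proof. by move=> [r [x ->]]; exists c%:MP; rewrite ?mmapC. Qed.

Lemma pd_is_dvr P : dvr K P.
Proof.
have [r [A [Aaff Afr XE]]] := emb_charts X.
have := pd_point P; rewrite XE => -[i [p Pp E]]; rewrite E.
split=> //; first exact: loc_subring (affine_alg_subring (Aaff i)) Pp.
  by rewrite -(Afr i); exact: loc_frac.
by rewrite -E; exact: pd_dvr.
Qed.

Lemma pd_cst P c : pd_ring P (cst c).
Proof.
have [r [A [Aaff Afr XE]]] := emb_charts X.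
have := pd_point P; rewrite XE => -[i [p Pp ->]].
by apply: loc_sub => //; [exact: affine_alg_subring|exact: affine_alg_cst].
Qed.

Lemma pd_inj P Q : pd_ring P = pd_ring Q -> P = Q.
Proof.
case: P Q => [p Pp dp] [q Qq dq] /= pq; subst q.
by congr PrimeDivisor; exact: Prop_irrelevance.
Qed.

Lemma pd_of_locals O : locals OGn O -> dvr K O -> exists P, pd_ring P = O.
Proof.
by move=> lO [_ _ _ D]; exists (PrimeDivisor (emb_open X lO) D).
Qed.

Lemma cst_unit P c : c != 0 -> unit_in P (cst c).
Proof.
by move=> c0; split; rewrite -?fmorphV ?fmorph_eq0 //; exact: pd_cst.
Qed.

Lemma cst_max P c : maxid P (cst c) -> c = 0.
Proof. by move=> [_ H]; apply/eqP; apply: contraT => /cst_unit. Qed.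

(* By separatedness, P is the local ring of its centre on any open subset.    *)
Lemma centre P (A : set F) : subring A -> A `<=` P ->
  pts X (loc A (A `&` maxid P)) -> pd_ring P = loc A (A `&` maxid P).
Proof.
move=> Ar AP; have D := pd_is_dvr P; set p := A `&` maxid P => Xp.
have Pp : prime_ideal A p by exact: (maxid_prime_ideal D Ar AP).
apply: (emb_separated (valuation_ring_dvr D _) (pd_point P) Xp) => //.
- by move=> _ [c _ <-]; exact: pd_cst.
- by split.
- split; first exact: (loc_sub_dvr D Ar AP).
move=> f [Lf nU]; split; first exact: (loc_sub_dvr D Ar AP Lf).
move=> Uf; apply: nU; move: Lf Uf => [a [b [Aa Ab pb ->]]] [f0 Of Of'].
split=> //; first by exists a, b.
rewrite invf_div; exists b, a; split=> // -[_ Ma]; apply: pb; split=> //.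
have a0 : a != 0 by apply: contra_neq f0 => ->; rewrite mul0r.
have -> : b = (a / b)^-1 * a by rewrite invf_div divfK.
exact: (maxidM D).
Qed.

Lemma centre_open P : OGn `<=` P -> pd_ring P = loc OGn (OGn `&` maxid P).
Proof.
move=> OP; apply: centre => //; apply: emb_open; exists (OGn `&` maxid P) => //.
exact: (maxid_prime_ideal (pd_is_dvr P) OGnr OP).
Qed.

Lemma OGn_pow i j : OGn (gmx i j ^+ n).
Proof.
have [z [R HR]] := mu_gen_exists k0 F n_gt0; apply/(OGmuE HR); split.
  by apply: (subr_X (OG_subring F)); exact: OG_gmx.
have zn : z ^+ n = 1 by apply: prim_expr_order; case: HR.
have [e1 e2 e3 e4] := mu_gmx n_gt0 HR; rewrite rmorphXn.
move: i j; apply: ord2_ind; apply: ord2_ind;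
  rewrite ?e1 ?e2 ?e3 ?e4 exprMn -rmorphXn ?exprVn zn ?invr1 rmorph1 mul1r //.
Qed.

(* O(G/mu_n) is spanned by invariant monomials, whose n-th powers are products *)
(* of n-th powers of coordinates.                                             *)
Lemma OGn_sub P : (forall i j, pd_ring P (gmx i j ^+ n)) -> OGn `<=` P.
Proof.
move=> HP; have D := pd_is_dvr P; have [_ Pr _ _] := D.
have [z [R HR]] := mu_gen_exists k0 F n_gt0.
pose Mon (f : F) := (exists l, R f = cst l * f) /\ pd_ring P (f ^+ n).
have Mon1 : Mon 1.
  by split; [exists 1; rewrite !rmorph1 mul1r|rewrite expr1n; exact: subr_1].
have MonM f g : Mon f -> Mon g -> Mon (f * g).
  move=> [[l El] Pf] [[l' El'] Pg]; split; last by rewrite exprMn; exact: subr_M.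
  by exists (l * l'); rewrite !rmorphM El El'; ring.
have Mong i j : Mon (gmx i j).
  split=> //; have [e1 e2 e3 e4] := mu_gmx n_gt0 HR.
  by move: i j; apply: ord2_ind; apply: ord2_ind; eexists; eassumption.
have projP f : Mon f -> pd_ring P (proj n z R 0 f).
  move=> [[l El] Pf]; have Eit j : iter j R f = cst (l ^+ j) * f.
    elim: j => [|j IH]; first by rewrite expr0 rmorph1 mul1r.
    by rewrite iterS IH rmorphM (mu_cst HR) El exprSr rmorphM mulrA.
  have [m Em] : exists m, proj n z R 0 f = cst m * f.
    exists (n%:R^-1 * \sum_(j < n) (z ^+ (j * 0))^-1 * l ^+ j).
    rewrite /proj rmorphM fmorphV rmorph_nat -mulrA; congr (_ * _).
    rewrite rmorph_sum mulr_suml; apply: eq_bigr => j _.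
    by rewrite Eit rmorphM mulrA.
  have KP : K (proj n z R 0 f).
    apply/(KmuE k0 n_gt0 HR); have := proj_weight n_gt0 HR 0 f.
    by rewrite /weight expr0 rmorph1 mul1r.
  apply: (dvr_root D n_gt0 KP).
  by rewrite Em exprMn -rmorphXn; apply: subr_M => //; exact: pd_cst.
move=> f /(OGmuE HR) [[Q _ <-] HQ]; rewrite -(proj0_inv k0 n_gt0 z HQ) {HQ}.
have projD u v : proj n z R 0 (u + v) = proj n z R 0 u + proj n z R 0 v.
  rewrite /proj -mulrDr -big_split; congr (_ * _); apply: eq_bigr => j _.
  by rewrite iter_add mulrDr.
have projZ c u : proj n z R 0 (cst c * u) = cst c * proj n z R 0 u.
  by apply: projM; exact: mu_cst HR _.
elim/mpolyind: Q => [|c m Q _ _ IH].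
  rewrite evalmx0 -(mul0r 0) -(rmorph0 cst) projZ rmorph0 mul0r; exact: subr_0.
rewrite evalmxD projD; apply: (subr_D Pr) => //.
rewrite -mul_mpolyC evalmx_mul evalmxC projZ.
apply: (subr_M Pr); [exact: pd_cst|apply: projP].
rewrite mpolyXE_id /evalmx rmorph_prod /=; apply: (big_ind Mon) => // i _.
rewrite rmorphXn /=; elim: (m i) => [|j IHj]; first by rewrite expr0.
rewrite exprS; apply: MonM => //; rewrite mmapX mmap1U.
by case/mxvec_indexP: i {j IHj} => i j; rewrite mxvecE.
Qed.

(** In each chart let [b] be a common denominator of the functions [gmx i j ^+ n]. Where [b] is a
    unit, the ring of [P] contains these powers, hence O(G/mu_n); so the boundary divisors met by
    the chart all pass through [b]. *)
Lemma boundary_finite : exists s : seq (prime_divisor X),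
  forall P, ~ (OGn `<=` P) -> P \in s.
Proof.
have [r [A [Aaff Afr XE]]] := emb_charts X.
have chart i : exists s : seq (prime_divisor X), forall P p, prime_ideal (A i) p ->
    pd_ring P = loc (A i) p -> ~ (OGn `<=` P) -> P \in s.
  have Ar := affine_alg_subring (Aaff i).
  have [b [Ab b0 Hb]] : exists b, [/\ A i b, b != 0 &
      forall a c, A i (b * gmx a c ^+ n)].
    have den f : OGn f -> exists2 b, A i b /\ b != 0 & A i (b * f).
      move=> Of; have : K f by exact: (OGmu_Kmu k0 n_gt0).
      by rewrite -(Afr i) => -[x [y [Ax Ay y0 ->]]]; exists y => //; rewrite mulrC divfK.
    have [b1 [A1 n1] H1] := den _ (OGn_pow 0 0); have [b2 [A2 n2] H2] := den _ (OGn_pow 0 1).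
    have [b3 [A3 n3] H3] := den _ (OGn_pow 1 0); have [b4 [A4 n4] H4] := den _ (OGn_pow 1 1).
    exists (b1 * b2 * b3 * b4); split; [by do ?apply: (subr_M Ar)|by rewrite !mulf_neq0|].
    apply: ord2_ind; apply: ord2_ind.
    - have -> u : b1 * b2 * b3 * b4 * u = b2 * b3 * b4 * (b1 * u) by ring.
      by apply: (subr_M Ar) => //; do ?apply: (subr_M Ar).
    - have -> u : b1 * b2 * b3 * b4 * u = b1 * b3 * b4 * (b2 * u) by ring.
      by apply: (subr_M Ar) => //; do ?apply: (subr_M Ar).
    - have -> u : b1 * b2 * b3 * b4 * u = b1 * b2 * b4 * (b3 * u) by ring.
      by apply: (subr_M Ar) => //; do ?apply: (subr_M Ar).
    - have -> u : b1 * b2 * b3 * b4 * u = b1 * b2 * b3 * (b4 * u) by ring.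
      by apply: (subr_M Ar) => //; do ?apply: (subr_M Ar).
  have An : noetherian (A i) by have [xs ->] := affine_algE (Aaff i); exact: alg_noetherian.
  have [ps Hps] := finitely_many_places K Ar An b0.
  have [s Hs] : exists s : seq (prime_divisor X),
      forall P p, p \in ps -> pd_ring P = loc (A i) p -> P \in s.
    elim: ps {Hps} => [|p ps [s Hs]]; first by exists [::].
    case: (pselect (exists P, pd_ring P = loc (A i) p)) => [[P EP]|H].
      exists (P :: s) => Q q; rewrite !in_cons => /orP[/eqP -> EQ|qs EQ].
        by apply/orP; left; apply/eqP/pd_inj; rewrite EQ.
      by rewrite (Hs Q q) // orbT.
    exists s => Q q; rewrite in_cons => /orP[/eqP -> EQ|]; last exact: Hs.
    by case: H; exists Q.
  exists s => P p Pp EP nP; apply: (Hs P p) => //; apply: Hps => //.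
    by rewrite -EP; exact: pd_is_dvr.
  apply: contrapT => npb; apply: nP; apply: OGn_sub => a c; rewrite EP.
  by exists (b * gmx a c ^+ n), b; split=> //; rewrite mulrC mulKf.
have /choice [s Hs] := chart.
exists (flatten [seq s i | i <- enum 'I_r]) => P nP.
have := pd_point P; rewrite XE => -[i [p Pp EP]].
apply/flattenP; exists (s i); last exact: Hs Pp EP nP.
by apply: map_f; rewrite mem_enum.
Qed.

(** * The action of G on the prime divisors of X *)

Lemma ltrans1 (f : F) : ltrans 1%:M f = f.
Proof.
have [th [E Hc [e1 e2 e3 e4]]] := ltrans_rmorphism F (det1 k 2).
rewrite -E -[RHS]/((idfun : {rmorphism F -> F}) f); apply: rmorphism_gen => //.
apply: ord2_ind; apply: ord2_ind; rewrite ?e1 ?e2 ?e3 ?e4 !mxE /= rmorph0 rmorph1;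
  by rewrite mul1r mul0r subr0.
Qed.

Definition act (h : 'M[k]_2) (O : set F) : set F := ltrans h @` O.

Lemma act1 O : act 1%:M O = O.
Proof.
by apply/seteqP; split=> [_ [f Of <-]|f Of]; [rewrite ltrans1|exists f; rewrite ?ltrans1].
Qed.

Lemma actM h h' O : \det h = 1 -> \det h' = 1 -> act (h *m h') O = act h (act h' O).
Proof.
move=> dh dh'; apply/seteqP; split.
  by move=> _ [f Of <-]; exists (ltrans h' f); [exists f|rewrite ltransM].
by move=> _ [_ [f Of <-] <-]; exists f; rewrite ?ltransM.
Qed.

Lemma actP h (O : set F) f : \det h = 1 -> act h O f <-> O (ltrans (invmx h) f).
Proof.
move=> dh; have uh : h \in unitmx by rewrite unitmxE dh unitr1.
have dh' : \det (invmx h) = 1 by rewrite det_inv dh invr1.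
split=> [[g Og <-]|Og]; first by rewrite -ltransM // mulVmx // ltrans1.
by exists (ltrans (invmx h) f) => //; rewrite -ltransM // mulmxV // ltrans1.
Qed.

Lemma ltrans_G h f : \det h = 1 -> G f -> G (ltrans h f).
Proof.
move=> dh; have [th [E Hc [e1 e2 e3 e4]]] := ltrans_rmorphism F dh; rewrite -E.
have Gr := OG_subring F.
apply: OG_stable => //; apply: ord2_ind; apply: ord2_ind;
  rewrite ?e1 ?e2 ?e3 ?e4; apply: (subr_B Gr); apply: (subr_M Gr);
  by [exact: OG_cst|exact: OG_gmx].
Qed.

Lemma ltrans_K h f : \det h = 1 -> K f -> K (ltrans h f).
Proof.
move=> dh; have [th [E Hc [e1 e2 e3 e4]]] := ltrans_rmorphism F dh; rewrite -E.
have [z [R HR]] := mu_gen_exists k0 F n_gt0.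
move=> /(KmuE k0 n_gt0 HR) Rf; apply/(KmuE k0 n_gt0 HR).
have C := mu_cst HR; have [r1 r2 r3 r4] := mu_gmx n_gt0 HR.
rewrite -[in RHS]Rf -[LHS]/((R \o th) f) -[RHS]/((th \o R) f).
apply: rmorphism_gen => [c|]; first by rewrite /= Hc !C Hc.
apply: ord2_ind; apply: ord2_ind; rewrite /= ?e1 ?e2 ?e3 ?e4 ?r1 ?r2 ?r3 ?r4
  rmorphB !rmorphM !C !Hc ?e1 ?e2 ?e3 ?e4 ?r1 ?r2 ?r3 ?r4; ring.
Qed.

Lemma ltrans_OGn h f : \det h = 1 -> OGn f -> OGn (ltrans h f).
Proof.
move=> dh /(OGmuP k0 n_gt0) [Gf KF]; apply/(OGmuP k0 n_gt0).
by split; [exact: ltrans_G|exact: ltrans_K].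
Qed.

Lemma act_unit h (O : set F) f : \det h = 1 ->
  unit_in (act h O) f <-> unit_in O (ltrans (invmx h) f).
Proof.
move=> dh; have dh' : \det (invmx h) = 1 by rewrite det_inv dh invr1.
have [th [E _ _]] := ltrans_rmorphism F dh'.
have H1 := actP O f dh; have H2 := actP O f^-1 dh.
have EV : ltrans (invmx h) f^-1 = (ltrans (invmx h) f)^-1 by rewrite -!E fmorphV.
have E0 : (ltrans (invmx h) f == 0) = (f == 0) by rewrite -E fmorph_eq0.
split=> -[f0 O1 O2]; split; rewrite ?E0 // -?E0 //.
- exact/H1.
- by rewrite -EV; exact/H2.
- exact/H1.
- by apply/H2; rewrite EV.
Qed.

Lemma act_pd h P : \det h = 1 -> exists Q, pd_ring Q = act h P.
Proof.
move=> dh; have Xh : pts X (act h P) by apply: emb_stable => //; exact: pd_point.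
have uh : h \in unitmx by rewrite unitmxE dh unitr1.
have dh' : \det (invmx h) = 1 by rewrite det_inv dh invr1.
have [t [t0 Ot Nt Ht]] := pd_dvr P.
have [th [E _ _]] := ltrans_rmorphism F dh.
have [th' [E' _ _]] := ltrans_rmorphism F dh'.
have thK f : th' (th f) = f by rewrite E E' -ltransM // mulVmx // ltrans1.
have th'K f : th (th' f) = f by rewrite E E' -ltransM // mulmxV // ltrans1.
suff D : is_dvr K (act h P) by exists (PrimeDivisor Xh D).
exists (th t); split.
- by rewrite fmorph_eq0.
- by exists t; rewrite ?E.
- by move=> /(act_unit _ _ dh); rewrite -E' thK.
move=> f Kff f0; have [||u [w [Hu Ef]]] := Ht (th' f).
- by rewrite E'; exact: ltrans_K.
- by rewrite fmorph_eq0.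
exists (th u), w; split; first by apply/(act_unit _ _ dh); rewrite -E' thK.
by rewrite -[LHS]th'K Ef rmorphM fmorphXz.
Qed.

(* The translates of a boundary divisor under a one-parameter group are       *)
(* finite in number; as k is divisible, they all coincide.                    *)
Lemma boundary_stable_1ps (u : k -> 'M[k]_2) P :
  (forall t, \det (u t) = 1) -> (forall s t, u (s + t) = u s *m u t) -> u 0 = 1%:M ->
  ~ (OGn `<=` P) -> forall t, act (u t) P = P.
Proof.
move=> du uD u0 nP t; have [s Hs] := boundary_finite.
(* Among the N translates by [u (v *+ j)], j < N, two agree, so [u (v *+ d)] fixes [P] for some
   positive d < N. As d divides N!, so does [u t], where t is N! times v. *)
pose N := (size s).+1; pose v := t / N`!%:R.
have uV x : invmx (u x) = u (- x).
  have ux : u x \in unitmx by rewrite unitmxE du unitr1.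
  by rewrite -[RHS]mul1mx -(mulVmx ux) -mulmxA -uD subrr u0 mulmx1.
have /choice [Q HQ] (j : nat) := act_pd P (du (v *+ j)).
have Qs j : Q j \in s.
  apply: Hs => OQ; apply: nP => f Of.
  have /OQ : OGn (ltrans (u (v *+ j)) f) by exact: ltrans_OGn.
  rewrite HQ => /(actP _ _ (du _)).
  by rewrite -ltransM ?uV // -uD addNr u0 ltrans1.
have [i [j [ij jN Eij]]] : exists i j, [/\ (i < j)%N, (j < N)%N & Q i = Q j].
  apply: contrapT => H; have : uniq [seq Q i | i <- iota 0 N].
    rewrite map_inj_in_uniq ?iota_uniq // => i j; rewrite !mem_iota !add0n /= => iN jN Eij.
    by case: (ltngtP i j) => // ij; case: H; [exists i, j|exists j, i].
  move/uniq_leq_size => /(_ s); rewrite size_map size_iota ltnn => /(_ _)/negP; apply=> //.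
  by move=> _ /mapP [i _ ->].
have Ed : act (u (v *+ (j - i))) P = P.
  have := congr1 (act (u (- (v *+ i)))) (congr1 (@pd_ring _ _ _ _) Eij).
  rewrite !HQ -!actM // -!uD addNr u0 act1 => E.
  by rewrite mulrnBr ?(ltnW ij) // addrC -E.
have Em m : act (u (v *+ ((j - i) * m))) P = P.
  elim: m => [|m IH]; first by rewrite muln0 mulr0n u0 act1.
  by rewrite mulnS mulrnDr uD actM // IH Ed.
have : (j - i %| N`!)%N.
  by apply: dvdn_fact; rewrite subn_gt0 ij /= (leq_trans (leq_subr _ _) (ltnW jN)).
move=> /dvdnP [m Em']; have := Em m; rewrite mulnC -Em' /v -mulr_natr divfK //.
by rewrite pnatr_eq0_char0 // -lt0n fact_gt0.
Qed.

Lemma boundary_G_stable P : ~ (OGn `<=` P) -> G_stable P.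
Proof.
move=> nP; apply: (SL2_ind (S := fun h => act h P = P)).
- apply: boundary_stable_1ps => //; first exact: det_lower.
    by move=> s t; apply/matrixP; apply: ord2_ind; apply: ord2_ind;
      rewrite !mul2E !mxE /=; ring.
  by apply/matrixP; apply: ord2_ind; apply: ord2_ind; rewrite !mxE.
- apply: boundary_stable_1ps => //; first exact: det_upper.
    by move=> s t; apply/matrixP; apply: ord2_ind; apply: ord2_ind;
      rewrite !mul2E !mxE /=; ring.
  by apply/matrixP; apply: ord2_ind; apply: ord2_ind; rewrite !mxE.
- by move=> A B dA dB HA HB; rewrite actM // HB HA.
Qed.

End Embedding.

(** * Colors *)

Section Colors.
Variables (k : closedFieldType) (k0 : [pchar k] =i pred0) (F : sl2_field k).
Variables (n : nat) (n_gt0 : (0 < n)%N).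
Local Notation cst := (ff_cst F).
Local Notation gmx := (ff_gmx F).
Local Notation G := (OG F).
Local Notation K := (Kmu F n).
Local Notation g1 := (g1 F).
Local Notation g2 := (g2 F).
Local Notation g3 := (g3 F).
Local Notation g4 := (g4 F).
Local Notation OGn := (OGmu F n).
Local Notation y := (ycoord F n).

Let Kf : subfield K := Kmu_subfield k0 F n_gt0.
Let Kr : subring K. Proof. by case: Kf. Qed.
Let OGnr : subring OGn := OGmu_subring k0 F n_gt0.
Let Gr : subring G := OG_subring F.

Lemma nbar_gt0 : (0 < nbar n)%N.
Proof. by rewrite /nbar; case: ifP => // on; case: n n_gt0 on => [|[]]. Qed.

(** The quotient of [n] by [nbar n], that is the power of [ycoord] which is a fraction of the
    elements [g3 ^+ n] and [g4 ^+ n] of O(G/mu_n). *)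
Definition nquot : nat := if odd n then 1 else 2.

Lemma nbar_quot : (nbar n * nquot)%N = n.
Proof.
rewrite /nbar /nquot; case: ifP => on; first by rewrite muln1.
by rewrite muln2; have := odd_double_half n; rewrite on add0n.
Qed.

Lemma OGn_weight0 f g (w : nat) :
  (forall z R, mu_gen n z R -> R f = cst (z ^+ w) * f) ->
  (forall z R, mu_gen n z R -> R g = (cst (z ^+ w))^-1 * g) -> K (f * g).
Proof.
move=> Hf Hg; have [z [R HR]] := mu_gen_exists k0 F n_gt0.
apply/(KmuE k0 n_gt0 HR); rewrite rmorphM (Hf _ _ HR) (Hg _ _ HR) mulrACA mulfV ?mul1r //.
have [zP _] := HR; rewrite fmorph_eq0 expf_neq0 //.
by apply/eqP => z0; have := prim_expr_order zP;
   rewrite z0 expr0n (gtn_eqF n_gt0) => /eqP; rewrite eq_sym oner_eq0.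
Qed.

Let w1 (f : F) := forall z (R : {rmorphism F -> F}), mu_gen n z R -> R f = cst z * f.
Let w1' (f : F) := forall z (R : {rmorphism F -> F}), mu_gen n z R -> R f = (cst z)^-1 * f.

Let wg : [/\ w1 g1, w1' g2, w1 g3 & w1' g4].
Proof.
by split=> z R HR; have [e1 e2 e3 e4] := mu_gmx n_gt0 HR; rewrite ?e1 ?e2 ?e3 ?e4 ?fmorphV.
Qed.

Let wM f g : w1 f -> w1' g -> K (f * g).
Proof.
move=> Hf Hg; apply: (OGn_weight0 (w := 1)) => z R HR; rewrite expr1; [exact: Hf|exact: Hg].
Qed.

Let wV f : w1 f -> w1' f^-1.
Proof. by move=> Hf z R HR; rewrite fmorphV (Hf z R HR) invfM. Qed.
Let wV' f : w1' f -> w1 f^-1.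
Proof. by move=> Hf z R HR; rewrite fmorphV (Hf z R HR) invfM invrK. Qed.

Lemma K_gg : [/\ K (g1 * g4), K (g3 * g4), K (g2 * g3) & K (g1 * g2)].
Proof. by have [? ? ? ?] := wg; split; rewrite 1?[g2 * _]mulrC; exact: wM. Qed.

Lemma K_quot : K (g1 / g3) /\ K (g2 / g4).
Proof.
have [? ? ? ?] := wg; split; first by apply: wM => //; exact: wV.
by rewrite mulrC; apply: wM => //; exact: wV'.
Qed.

Lemma OGn_gg : [/\ OGn (g1 * g4), OGn (g3 * g4), OGn (g2 * g3) & OGn (g1 * g2)].
Proof.
have [? ? ? ?] := K_gg; have [? ? ? ?] := G_g F.
by split; apply/(OGmuP k0 n_gt0); split=> //; exact: (subr_M Gr).
Qed.

Lemma y_n : y ^+ nquot = g3 ^+ n / g4 ^+ n.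
Proof. by rewrite /ycoord -exprM nbar_quot expr_div_n. Qed.

(** [g3 / g4] has weight 2, and [n] divides [2 * nbar n]. *)
Lemma K_y : K y.
Proof.
have [z [R HR]] := mu_gen_exists k0 F n_gt0; apply/(KmuE k0 n_gt0 HR).
have [_ _ e3 e4] := mu_gmx n_gt0 HR; have [zP _] := HR.
have z0 : z != 0.
  by apply/eqP => z0; have := prim_expr_order zP;
   rewrite z0 expr0n (gtn_eqF n_gt0) => /eqP; rewrite eq_sym oner_eq0.
rewrite /ycoord rmorphXn fmorph_div e3 e4 fmorphV.
have -> : cst z * g3 / ((cst z)^-1 * g4) = cst (z ^+ 2) * (g3 / g4).
  have [_ _ _ g40] := g_neq0 F.
  by rewrite rmorphXn; field; rewrite g40 fmorph_eq0.
rewrite exprMn -rmorphXn -exprM; have -> : z ^+ (2 * nbar n) = 1.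
  have -> : (2 * nbar n)%N = (n * (if odd n then 2 else 1))%N.
    have := nbar_quot; rewrite /nquot; case: (odd n); first by rewrite muln1 mulnC => ->.
    by rewrite muln1 mulnC.
  by rewrite exprM (prim_expr_order zP) expr1n.
by rewrite rmorph1 mul1r.
Qed.

Lemma y_neq0 : y != 0.
Proof.
have [_ _ g30 g40] := g_neq0 F.
by rewrite expf_neq0 // mulf_neq0 ?invr_eq0.
Qed.

(** [ycoord] takes the values 0 and 1 at the identity matrix and at [lower 1]. *)
Lemma y_neq_cst c : y != cst c.
Proof.
have [_ _ g30 g40] := g_neq0 F; apply/eqP => E.
have : evalmx cst gmx (Xmx k 1 0 ^+ nbar n - c%:MP * Xmx k 1 1 ^+ nbar n) = 0.
  rewrite !evalmxE -/g3 -/g4 -E /ycoord expr_div_n divfK ?subrr // expf_neq0 //.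
move/evg_eq0 => H; have := H _ (det1 _ _); have := H _ (det_lower 1).
rewrite !evalmxE /= !mxE /= !expr1n expr0n (gtn_eqF nbar_gt0) !mulr1 sub0r.
move=> E1 /eqP; rewrite oppr_eq0 => /eqP c0; move: E1 => /eqP.
by rewrite c0 subr0 oner_eq0.
Qed.

Lemma local_param_K x : K (local_param F n x).
Proof.
case: x => [c|] /=; last by case: Kf => _; apply; exact: K_y.
by apply: subr_B => //; [exact: K_y|exact: Kmu_cst].
Qed.

Lemma local_param_neq0 x : local_param F n x != 0.
Proof.
case: x => [c|] /=; last by rewrite invr_eq0 y_neq0.
by rewrite subr_eq0 y_neq_cst.
Qed.

(** * The place x3 = 0: its uniformizers, and its uniqueness on G and on G/mu_n *)

Section Frame3.
Variable fr : frame F n.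
Local Notation x3 := (fr3 fr).
Local Notation x4 := (fr4 fr).
Local Notation O := (x3_place fr).

Let irr := irreducible_X fr.
Let D : dvr setT O := place_dvr k0 irr.
Let DK : dvr K (O `&` K) := place_Kmu_dvr k0 n_gt0 irr.

Lemma x4_unit : unit_in O x4.
Proof.
have [G1 G2 G3 G4 _] := fr_in fr.
have M3 : maxid O x3 := uniformizer_maxid (x3_uniformizer k0 fr).
have O1 : O (fr1 fr) by exact: (G_place irr).
have O4 : O x4 by exact: (G_place irr).
apply: (unit_in_mull D O4 O1); have -> : x4 * fr1 fr = 1 + fr2 fr * x3.
  by rewrite -(fr_det fr); ring.
have O2 : O (fr2 fr) by exact: (G_place irr).
have M23 := maxidM D O2 M3; have [_ Or _ _] := D.
have O1' : O (1 + fr2 fr * x3) by apply: (subr_D Or); [exact: subr_1|case: M23].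
have [//|M] := dvr_unit_or_max O1'.
case: (maxid_1 D); have -> : (1 : F) = (1 + fr2 fr * x3) - fr2 fr * x3 by rewrite addrK.
exact: (maxidB D).
Qed.

(** The invariant function [t] has order one upstairs, so the same factorization serves in K: there
    is no ramification at this place. *)
Lemma uniformizer_restrict t u : unit_in O u -> t = u * x3 -> K t ->
  uniformizer K (O `&` K) t.
Proof.
move=> Uu Et Kt; have U3 := x3_uniformizer k0 fr.
have [u0 Ou Ou'] := Uu.
have Mt : maxid O t by rewrite Et; exact: (maxidM D Ou (uniformizer_maxid U3)).
have x30 : x3 != 0 by case: U3.
have t0 : t != 0 by rewrite Et mulf_neq0.
split=> //; first by split=> //; case: Mt.
  by move=> [_ [_ _] [Ot _]]; case: Mt => Ot' H; apply: H.
move=> f Kff f0; have [v [z [Uv Ef]]] : exists v (z : int), unit_in O v /\ f = v * x3 ^ z.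
  by have [_ _ _ H] := U3; exact: H.
have Ef' : f = v / u ^ z * t ^ z.
  by rewrite Et expfzMl {1}Ef; field; rewrite expfz_neq0.
have Kv : K (v / u ^ z).
  have -> : v / u ^ z = f / t ^ z by rewrite Ef' mulfK // expfz_neq0.
  apply: subfield_div => //; case: (z) => j; first exact: subr_X.
  by case: Kf => _; apply; exact: subr_X.
exists (v / u ^ z), z; split=> //.
have [v0 Ov Ov'] := unit_in_div D Uv (unit_in_Xz D z Uu).
by split=> //; split=> //; case: Kf => _; apply.
Qed.

(** The prime of [O'] contains [x3], hence the principal ideal it generates, which is the prime of
    [O]; as the former has height one, they are equal. *)
Lemma x3_place_unique O' : locals G O' -> dvr setT O' -> maxid O' x3 -> O' = O.
Proof.
move=> [q Pq ->] D' M3.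
have GO : G `<=` O by exact: (G_place irr).
have Pp := maxid_prime_ideal D Gr GO.
have qE f : G f -> maxid (loc G q) f -> q f by move=> Gf /loc_maxid; apply.
have [G1 G2 G3 G4 _] := fr_in fr.
have <- : G `&` maxid O = q.
  apply: (dvr_loc_height1 Gr Pq D' Pp).
    move=> f [Gf /(x3_place_ideal k0 Gf) [f' Gf' ->]].
    by have [_ _ _ qM _] := Pq; rewrite mulrC; apply: qM => //; exact: qE.
  exists x3; last by case: (x3_uniformizer k0 fr).
  by split=> //; exact: uniformizer_maxid (x3_uniformizer k0 fr).
exact: esym (place_loc k0 irr).
Qed.

(** [x3] need not be invariant, so the argument on G is applied to n-th powers: [f = x3 * f'] gives
    [f ^+ n = x3 ^+ n * f' ^+ n], with [f' ^+ n] in O(G/mu_n). *)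
Lemma x3_place_Kmu_unique P (A := OGn) : locals A P -> dvr K P -> K (x3 ^+ n) ->
  maxid P (x3 ^+ n) -> P = O `&` K.
Proof.
move=> [q Pq ->] DP K3 M3.
have OGO : A `<=` O `&` K.
  move=> f Af; split; last exact: (OGmu_Kmu k0 n_gt0).
  by apply: (G_place irr); exact: OGmu_OG Af.
have Pp := maxid_prime_ideal DK OGnr OGO.
have [G1 G2 G3 G4 _] := fr_in fr.
have x30 : x3 != 0 by case: (x3_uniformizer k0 fr).
have A3 : A (x3 ^+ n) by apply/(OGmuP k0 n_gt0); split=> //; exact: subr_X.
have q3 : q (x3 ^+ n) by apply/(loc_maxid OGnr Pq A3).
have [_ _ _ qM _] := Pq.
have <- : A `&` maxid (O `&` K) = q.
  apply: (dvr_loc_height1 OGnr Pq DP Pp).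
    move=> f [Af /maxid_place_Kmu].
    move=> /(_ k0 n_gt0) [Kff Mf].
    have [f' Gf' Ef] := x3_place_ideal k0 (OGmu_OG Af) Mf.
    apply: (prime_idealX (m := n) OGnr Pq Af).
    rewrite Ef exprMn mulrC; apply: qM => //.
    apply/(OGmuP k0 n_gt0); split; first exact: subr_X.
    have -> : f' ^+ n = f ^+ n / x3 ^+ n by rewrite Ef exprMn mulrAC mulfV ?mul1r // expf_neq0.
    by apply: subfield_div => //; exact: subr_X.
  exists (x3 ^+ n); last exact: expf_neq0.
  split=> //; apply/(maxid_place_Kmu k0 n_gt0); split=> //.
  by apply: (maxidXn D) => //; exact: uniformizer_maxid (x3_uniformizer k0 fr).
exact: esym (place_Kmu_loc k0 n_gt0 irr).
Qed.

End Frame3.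

Variable X : embedding F n.
Implicit Types (P Q : prime_divisor X).

Lemma overE x P : Defs.over x P <-> maxid P (local_param F n x).
Proof.
rewrite /Defs.over /pi_star.
have -> : (0 < Num.max 0 (ordP P (local_param F n x))) = (0 < ordP P (local_param F n x)).
  by rewrite lt_max ltxx.
exact: (ord_gt0 (pd_is_dvr k0 n_gt0 P) (local_param_K x) (local_param_neq0 x)).
Qed.

Lemma locals_open P : OGn `<=` P -> locals OGn P.
Proof.
move=> OP; exists (OGn `&` maxid P); last exact: (centre_open k0 n_gt0).
exact: (maxid_prime_ideal (pd_is_dvr k0 n_gt0 P) OGnr OP).
Qed.

Lemma over_zero P : OGn `<=` P -> Defs.over (x_zero k) P -> maxid P (g3 ^+ n).
Proof.
move=> OP /overE; rewrite /= rmorph0 subr0 => My; have D := pd_is_dvr k0 n_gt0 P.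
have [_ _ g30 g40] := g_neq0 F.
have -> : g3 ^+ n = g4 ^+ n * y ^+ nquot by rewrite y_n mulrCA mulfV ?mulr1 // expf_neq0.
apply: (maxidM D); first exact/OP/(OGn_pow k0 F n_gt0).
by apply: (maxidXn D) => //; rewrite /nquot; case: ifP.
Qed.

Lemma over_infty P : OGn `<=` P -> Defs.over (x_infty k) P -> maxid P (g4 ^+ n).
Proof.
move=> OP /overE /= My; have D := pd_is_dvr k0 n_gt0 P.
have [_ _ g30 g40] := g_neq0 F.
have -> : g4 ^+ n = g3 ^+ n * y^-1 ^+ nquot.
  by rewrite exprVn y_n invf_div mulrCA mulfV ?mulr1 // expf_neq0.
apply: (maxidM D); first exact/OP/(OGn_pow k0 F n_gt0).
by apply: (maxidXn D) => //; rewrite /nquot; case: ifP.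
Qed.

(* The Weyl group inverts g1/g3 and g2/g4 up to sign.                         *)
Lemma G_stable_quot P : G_stable P -> unit_in P (g1 / g3) /\ unit_in P (g2 / g4).
Proof.
move=> SP; pose w : 'M[k]_2 := mat2 0 1 (-1) 0.
have dw : \det w = 1 by rewrite det2E !mxE /=; ring.
have [th [E Hc [e1 e2 e3 e4]]] := ltrans_rmorphism F dw.
have [n1 n2 n3 n4] := g_neq0 F.
rewrite !mxE /= ?rmorph0 ?rmorph1 ?rmorphN ?rmorph1 in e1 e2 e3 e4.
have D := pd_is_dvr k0 n_gt0 P; have [_ Pr _ _] := D.
have H f : K f -> f != 0 -> th f = - f^-1 -> unit_in P f.
  move=> KF f0 Ef.
  have st g : pd_ring P g -> pd_ring P (th g).
    by move=> Pg; rewrite -(SP w dw); exists g; rewrite ?E.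
  have [Pf|[Pf _]] := dvr_total D KF.
    by split=> //; rewrite -[_^-1]opprK -Ef; apply: (subr_N Pr); exact: st.
  split=> //; rewrite -[f]opprK -[f]invrK -invrN; apply: (subr_N Pr).
  have -> : (- f^-1)^-1 = th f^-1 by rewrite fmorphV Ef.
  exact: st.
have [K13 K24] := K_quot.
split; apply: H; rewrite ?mulf_neq0 ?invr_eq0 // fmorph_div ?e1 ?e2 ?e3 ?e4;
  by field; rewrite ?n1 ?n2 ?n3 ?n4.
Qed.

(* 1 = g1 g4 - g2 g3, both terms of which have the order of g3 g4. *)
Lemma G_stable_ord P : G_stable P -> ordP P (g3 * g4) <= 0.
Proof.
move=> SP; have [U13 U24] := G_stable_quot SP; have D := pd_is_dvr k0 n_gt0 P.
have [n1 n2 n3 n4] := g_neq0 F; have [K14 K34 K23 _] := K_gg.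
rewrite leNgt; apply/negP => /(ord_gt0 D K34 (mulf_neq0 n3 n4)) M.
apply: (maxid_1 D); rewrite -(det_gmx F).
have -> : g1 * g4 = g1 / g3 * (g3 * g4) by field.
have -> : g2 * g3 = g2 / g4 * (g3 * g4) by field.
by apply: (maxidB D); apply: (maxidM D) => //; [case: U13|case: U24].
Qed.

(** If [ycoord] is not in the ring, its inverse is in the maximal ideal and [P] lies over infinity.
    Otherwise a polynomial in [ycoord] that is not a unit has a linear factor in the maximal ideal,
    as [k] is algebraically closed. *)
Lemma not_dominates_over P : ~ dominates_P1 P -> exists x, Defs.over x P.
Proof.
move=> nD; have D := pd_is_dvr k0 n_gt0 P; have [_ Pr _ _] := D.
have [Py|My] := dvr_total D K_y; last by exists (x_infty k); exact/overE.
have [q [q0 nU]] : exists q : {poly k}, q != 0 /\ ~ unit_in P (map_poly cst q).[y].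
  apply: contrapT => H; apply: nD => q q0; apply: contrapT => nU; apply: H.
  by exists q.
have [r Er] := closed_field_poly_normal q.
have : exists2 c, c \in r & maxid P (y - cst c).
  apply: contrapT => H; apply: nU; rewrite Er map_polyZ hornerZ.
  apply: (unit_in_M D); first by apply: cst_unit; rewrite lead_coef_eq0.
  rewrite rmorph_prod horner_prod big_seq.
  apply: big_ind => [|a b|c cr]; [exact: (unit_in_1 D)|exact: (unit_in_M D)|].
  rewrite rmorphB /= map_polyX map_polyC hornerXsubC.
  have Pyc : pd_ring P (y - cst c) by apply: subr_B => //; exact: pd_cst.
  have [//|M] := dvr_unit_or_max Pyc; by case: H; exists c.
by move=> [c _ M]; exists (Some c); exact/overE.
Qed.

(* Over c <> 0 there is the color g3 = c' g4, where c' ^ nbar = c.            *)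
Lemma color_over_fin c : c != 0 -> exists2 Q : prime_divisor X, Defs.over (Some c) Q & ~ G_stable Q.
Proof.
move=> c0; have /closed_rootP [c' Hc'] : size ('X^(nbar n) - c%:P) != 1%N.
  by rewrite size_XnsubC ?nbar_gt0 //; case: (nbar n) nbar_gt0.
have {Hc'}Ec : c' ^+ nbar n = c.
  by move: Hc'; rewrite /root !hornerE subr_eq0 => /eqP.
have [fr [f1 f2 f3 f4 _]] := frame_fin F n_gt0 c'.
have irr := irreducible_X fr.
have D := place_dvr k0 irr; have [_ Or _ _] := D.
have [Q EQ] := pd_of_locals X (place_Kmu_locals k0 n_gt0 irr) (place_Kmu_dvr k0 n_gt0 irr).
have [n1 n2 n3 n4] := g_neq0 F.
have U4 : unit_in (x3_place fr) g4 by rewrite -f4; exact: x4_unit.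
have GO : G `<=` x3_place fr by exact: (G_place irr).
have MQ : maxid Q (y - cst c).
  rewrite EQ; apply/(maxid_place_Kmu k0 n_gt0); split; first exact: (local_param_K (Some c)).
  have e3 : g3 / g4 = cst c' + fr3 fr / g4 by rewrite f3; field.
  (* A difference of powers of [g3 / g4] and [c'] is divisible by the difference [g3 / g4 - c'],
     which is [fr3 fr / g4]. *)
  have -> : y - cst c = fr3 fr / g4 * \sum_(i < nbar n) (g3 / g4) ^+ ((nbar n).-1 - i) * cst c' ^+ i.
    by rewrite -Ec rmorphXn /ycoord subrXX; congr (_ * _); rewrite e3 addrC addKr.
  have [_ _ O4'] := U4.
  have O34 : x3_place fr (g3 / g4).
    by apply: (subr_M Or) => //; apply: GO; exact: OG_gmx.
  have M3 := uniformizer_maxid (x3_uniformizer k0 fr).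
  have M34 : maxid (x3_place fr) (fr3 fr / g4) by rewrite mulrC; exact: (maxidM D O4' M3).
  rewrite mulrC; apply: (maxidM D) => //; apply: (subr_sum Or) => i _; apply: (subr_M Or).
    exact: subr_X.
  by apply: (subr_X Or); apply: GO; exact: OG_cst.
exists Q; first exact/overE.
(* If the Weyl element stabilized [Q], then [(g1 / g2) ^+ nbar n - cst c] would be in the maximal
   ideal; being an element of L it would be 0, which fails at the identity matrix. *)
move=> SQ; pose w : 'M[k]_2 := mat2 0 1 (-1) 0.
have dw : \det w = 1 by rewrite det2E !mxE /=; ring.
have [th [E Hc [e1 e2 e3 e4]]] := ltrans_rmorphism F dw.
rewrite !mxE /= ?rmorph0 ?rmorph1 ?rmorphN ?rmorph1 in e1 e2 e3 e4.
have e3' : th g3 = g1 by rewrite e3; ring.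
have e4' : th g4 = g2 by rewrite e4; ring.
have Sth f : pd_ring Q (th f) <-> pd_ring Q f.
  split=> [|Qf]; last by rewrite -(SQ w dw); exists f; rewrite ?E.
  by rewrite -{1}(SQ w dw) => -[g Qg]; rewrite -E => /fmorph_inj <-.
have : maxid Q (th (y - cst c)).
  move: MQ => [Qy nU]; split; first exact/Sth.
  move=> [y0 _ Uy]; apply: nU; split=> //; first by rewrite -(fmorph_eq0 th).
  by apply/Sth; rewrite fmorphV.
have -> : th (y - cst c) = (g1 / g2) ^+ nbar n - cst c.
  by rewrite rmorphB rmorphXn fmorph_div Hc e3' e4'.
rewrite EQ => /(maxid_place_Kmu k0 n_gt0) [_ M].
have Lf := Lsub fr; have [Lr _] := Lf.
have Lin f : G f -> fixed fr f -> frac_of (G `&` fixed fr) f.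
  by move=> Gf Ff; apply: (frac_of_sub (Gfixed_subring fr)).
have L2 : frac_of (G `&` fixed fr) g2.
  by rewrite -f2; apply: (frac_of_sub (Gfixed_subring fr)); exact: GF_x2.
have Lc a : frac_of (G `&` fixed fr) (cst a).
  by apply: (frac_of_sub (Gfixed_subring fr)); exact: GF_cst.
have L1 : frac_of (G `&` fixed fr) g1.
  rewrite -[g1](subrK (cst c' * g2)) -f1; apply: (subr_D Lr).
    by apply: (frac_of_sub (Gfixed_subring fr)); exact: GF_x1.
  exact: subr_M.
have Lv : frac_of (G `&` fixed fr) ((g1 / g2) ^+ nbar n - cst c).
  by apply: (subr_B Lr) => //; apply: (subr_X Lr); exact: subfield_div.
have := @L_place_max _ k0 _ _ _ _ irr (mk_sub (Lsub fr) Lv) M.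
move=> /(congr1 val) /= /eqP; rewrite subr_eq0 => /eqP E12.
have : evalmx cst gmx (Xmx k 0 0 ^+ nbar n - c%:MP * Xmx k 0 1 ^+ nbar n) = 0.
  by rewrite !evalmxE -/g1 -/g2 -E12 expr_div_n divfK ?subrr // expf_neq0.
move/evg_eq0/(_ _ (det1 _ _)); rewrite !evalmxE /= !mxE /= expr1n expr0n.
by rewrite (gtn_eqF nbar_gt0) mulr0 subr0 => /eqP; rewrite oner_eq0.
Qed.

End Colors.

(** * The kernel *)

Section Independence.
Variables (k : closedFieldType) (k0 : [pchar k] =i pred0).

Lemma poly_eq0_char0 (P : {poly k}) : (forall x, x != 0 -> P.[x] = 0) -> P = 0.
Proof.
move=> HP; apply/eqP; apply: contraT => P0.
pose rs := [seq i.+1%:R | i <- iota 0 (size P)] : seq k.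
have := max_poly_roots P0 (_ : all (root P) rs) (_ : uniq rs).
rewrite size_map size_iota ltnn => -> //.
- apply/allP => _ /mapP [i _ ->]; apply/rootP/HP.
  by rewrite pnatr_eq0_char0.
- rewrite map_inj_uniq ?iota_uniq // => i j; rewrite !mulrS => /addrI.
  move=> H; wlog ij : i j H / (i <= j)%N.
    by move=> W; case: (leqP i j) => [|/ltnW] ij; [exact: W|apply/esym/W].
  apply/eqP; rewrite eqn_leq ij /= -subn_eq0 -(pnatr_eq0_char0 _ k0) natrB //.
  by rewrite H subrr.
Qed.

Lemma sum_coef_fiber (I : eqType) (s : seq I) (w : I -> k) (d : I -> nat) :
  (forall x, x != 0 -> \sum_(i <- s) w i * x ^+ d i = 0) ->
  forall e, \sum_(i <- s | d i == e) w i = 0.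
Proof.
move=> H e; pose P : {poly k} := \sum_(i <- s) w i *: 'X^(d i).
have P0 : P = 0.
  apply: poly_eq0_char0 => x x0; rewrite /P horner_sum -[RHS](H x x0).
  by apply: eq_bigr => i _; rewrite hornerZ hornerXn.
have := congr1 (fun Q : {poly k} => Q`_e) P0; rewrite coef0 /P coef_sum => {2}<-.
rewrite [RHS](bigID (fun i => d i == e)) /= [X in _ = _ + X]big1 ?addr0.
  by apply: eq_bigr => i /eqP ->; rewrite coefZ coefXn eqxx mulr1.
by move=> i /negPf de; rewrite coefZ coefXn eq_sym de mulr0.
Qed.

(* Substitute g4 = (1 + g2 g3) / g1.                                          *)
Lemma SL2_monomials_free (I : eqType) (s : seq I) (w : I -> k) (a b c d : I -> nat) :
  (forall i, i \in s -> a i = 0%N \/ d i = 0%N) ->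
  (forall h : 'M[k]_2, \det h = 1 ->
     \sum_(i <- s) w i * (h 0 0 ^+ a i * h 1 0 ^+ b i * h 0 1 ^+ c i * h 1 1 ^+ d i) = 0) ->
  forall j, j \in s ->
    \sum_(i <- s | [&& a i == a j, b i == b j, c i == c j & d i == d j]) w i = 0.
Proof.
move=> had H j js.
(* Multiplication by [x ^+ N] clears the denominators of the entry [(1 + y * z) / x]. *)
pose N := \max_(i <- s) d i.
have dN i : i \in s -> (d i <= N)%N by move=> si; exact: leq_bigmax_seq.
have H1 (y z x : k) : x != 0 ->
    \sum_(i <- s) (w i * (y ^+ c i * z ^+ b i * (1 + y * z) ^+ d i)) * x ^+ (N + a i - d i) = 0.
  move=> x0; pose h : 'M[k]_2 := mat2 x y z ((1 + y * z) / x).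
  have dh : \det h = 1 by rewrite det2E !mxE /=; field.
  have := congr1 (fun u => x ^+ N * u) (H h dh); rewrite mulr0 mulr_sumr => {2}<-.
  rewrite big_seq [RHS]big_seq; apply: eq_bigr => i si; rewrite !mxE /=.
  have E : x ^+ (N + a i - d i) * x ^+ d i = x ^+ N * x ^+ a i.
    by rewrite -!exprD subnK // (leq_trans (dN i si)) // leq_addr.
  have xd0 : x ^+ d i != 0 by exact: expf_neq0.
  rewrite expr_div_n; apply: (mulIf xd0).
  transitivity (w i * (y ^+ c i * z ^+ b i * (1 + y * z) ^+ d i) * (x ^+ N * x ^+ a i)).
    by rewrite -E; ring.
  by field.
have H2 (y z : k) : (1 + y * z) ^+ d j *
    \sum_(i <- s | (a i == a j) && (d i == d j)) w i * y ^+ c i * z ^+ b i = 0.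
  have := @sum_coef_fiber I s (fun i => w i * (y ^+ c i * z ^+ b i * (1 + y * z) ^+ d i))
    (fun i => N + a i - d i)%N (H1 y z) (N + a j - d j)%N.
  move=> {2}<-; rewrite mulr_sumr big_seq_cond [RHS]big_seq_cond.
  (* As [a i] or [d i] is 0, their difference determines both. *)
  have eqc i : (i \in s) && ((a i == a j) && (d i == d j))
      = (i \in s) && (N + a i - d i == N + a j - d j)%N.
    case si : (i \in s) => //=; have := dN i si; have := dN j js.
    have := had i si; have := had j js => hj hi Nj Ni.
    apply/andP/eqP; first by move=> [/eqP -> /eqP ->].
    by move=> E; split; apply/eqP; lia.
  rewrite (eq_bigl _ _ eqc); apply: eq_bigr => i; rewrite -eqc => /and3P [_ _ /eqP ->].
  by ring.
have H3 (y : k) : \sum_(i <- s | (a i == a j) && (d i == d j) && (b i == b j)) w i * y ^+ c i = 0.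
  pose Q : {poly k} := \sum_(i <- s | (a i == a j) && (d i == d j)) (w i * y ^+ c i) *: 'X^(b i).
  have Q0 : Q = 0.
    (* This power is a nonzero polynomial for every [y], since its constant term is 1, and can be
       cancelled. *)
    have : (1 + y *: 'X) ^+ d j * Q = 0.
      apply: poly_eq0_char0 => z _; rewrite hornerM horner_exp hornerD hornerC hornerZ hornerX.
      rewrite -[RHS](H2 y z) /Q horner_sum; congr (_ * _).
      by apply: eq_bigr => i _; rewrite hornerZ hornerXn.
    move/eqP; rewrite mulf_eq0 expf_eq0 => /orP[/andP[_ /eqP E]|/eqP //].
    have := congr1 (fun P : {poly k} => P.[0]) E.
    by rewrite hornerD hornerC hornerZ hornerX mulr0 addr0 horner0 => /eqP; rewrite oner_eq0.
  have := congr1 (fun P : {poly k} => P`_(b j)) Q0; rewrite coef0 /Q coef_sum => {2}<-.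
  rewrite [RHS](bigID (fun i => b i == b j)) /= [X in _ = _ + X]big1 ?addr0.
    by apply: eq_bigr => i /andP[_ /eqP ->]; rewrite coefZ coefXn eqxx mulr1.
  by move=> i /andP[_ /negPf de]; rewrite coefZ coefXn eq_sym de mulr0.
pose s' := [seq i <- s | (a i == a j) && (d i == d j) && (b i == b j)].
rewrite -[RHS](@sum_coef_fiber I s' w c _ (c j)); last first.
  by move=> y _; rewrite big_filter; exact: H3.
rewrite big_filter_cond; apply: eq_bigl => i.
by case: (a i == _); case: (b i == _); case: (c i == _); case: (d i == _).
Qed.
End Independence.

Section Cases.
Variables (T : Type) (a b : nat) (f : 'I_a -> T) (f' : 'I_b -> T).
Lemma casesL i : cases f f' (lshift b i) = f i.
Proof. by rewrite /cases (unsplitK (inl i)). Qed.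
Lemma casesR i : cases f f' (rshift a i) = f' i.
Proof. by rewrite /cases (unsplitK (inr i)). Qed.
End Cases.

(** * The morphism phi in terms of monomials and degrees *)

Section Kernel.
Variables (k : closedFieldType) (k0 : [pchar k] =i pred0) (F : sl2_field k).
Variables (n : nat) (X : embedding F n) (E0 Einf : prime_divisor X).
Variables (p q : nat) (Y0 : 'I_p -> prime_divisor X) (Yinf : 'I_q -> prime_divisor X).
Local Notation cst := (ff_cst F).
Local Notation gmx := (ff_gmx F).
Local Notation g1 := (g1 F).
Local Notation g2 := (g2 F).
Local Notation g3 := (g3 F).
Local Notation g4 := (g4 F).
Local Notation Cl := (class_group X).
Local Notation S := (symS k p q).
Local Notation N := ((2 + 2) + (p + q))%N.
Local Notation phi := (phi E0 Einf Y0 Yinf).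
Implicit Types (m : 'X_{1..N}).

Lemma echarM f g (c d : Cl) : echar f c * echar g d = echar (f * g) (c + d).
Proof. exact: galg_mulUU. Qed.

Lemma echarX f (c : Cl) j : echar f c ^+ j = echar (f ^+ j) (c *+ j).
Proof. by elim: j => [|j IH]; rewrite ?expr0 ?mulr0n // !exprS IH echarM mulrS. Qed.

Lemma echar_prod r (f : 'I_r -> F) (c : 'I_r -> Cl) :
  \prod_i echar (f i) (c i) = echar (\prod_i f i) (\sum_i c i).
Proof.
elim: r f c => [|r IH] f c; first by rewrite !big_ord0.
by rewrite !big_ord_recl IH echarM.
Qed.

Lemma coeff_echar f (c d : Cl) : coeff d (echar f c) = f * (c == d)%:R.
Proof. exact: coeffU. Qed.

Definition echar_cst (c : k) : cox_ambient X := echar (cst c) 0.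

Lemma echar_cst_zmod : zmod_morphism echar_cst.
Proof.
move=> a b; apply/eqP/freeg_eqP => d; rewrite coeffB !coeff_echar rmorphB; ring.
Qed.

Lemma echar_cst_monoid : monoid_morphism echar_cst.
Proof.
split; first by rewrite /echar_cst rmorph1.
by move=> a b; rewrite /echar_cst echarM rmorphM addr0.
Qed.

HB.instance Definition _ := GRing.isZmodMorphism.Build k (cox_ambient X) echar_cst echar_cst_zmod.
HB.instance Definition _ := GRing.isMonoidMorphism.Build k (cox_ambient X) echar_cst echar_cst_monoid.

Definition var_image : 'I_N -> cox_ambient X :=
  cases (cases (fun i => echar (gmx i 0) (class_of E0))
               (fun i => echar (gmx i 1) (class_of Einf)))
        (cases (fun j => echar 1 (class_of (Y0 j)))
               (fun j => echar 1 (class_of (Yinf j)))).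

Lemma phiE f : phi f = mmap echar_cst var_image f. Proof. by []. Qed.

Lemma phiD f g : phi (f + g) = phi f + phi g.
Proof. by rewrite !phiE rmorphD. Qed.
Lemma phiM f g : phi (f * g) = phi f * phi g.
Proof. by rewrite !phiE rmorphM. Qed.

Lemma phi_sum I (r : seq I) (u : I -> S) : phi (\sum_(i <- r) u i) = \sum_(i <- r) phi (u i).
Proof. by apply: (big_morph _ phiD); rewrite phiE rmorph0. Qed.

Definition it0 : 'I_N := lshift (p + q) (lshift 2 (0 : 'I_2)).
Definition is0 : 'I_N := lshift (p + q) (lshift 2 (1 : 'I_2)).
Definition itinf : 'I_N := lshift (p + q) (rshift 2 (0 : 'I_2)).
Definition isinf : 'I_N := lshift (p + q) (rshift 2 (1 : 'I_2)).
Definition ir0 (j : 'I_p) : 'I_N := rshift (2 + 2) (lshift q j).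
Definition irinf (j : 'I_q) : 'I_N := rshift (2 + 2) (rshift p j).

Lemma ord1E : fintype.lift ord0 ord0 = 1 :> 'I_2. Proof. exact/val_inj. Qed.

Lemma prod_var (R : comNzRingType) (h : 'I_N -> R) :
  \prod_i h i = h it0 * h is0 * (h itinf * h isinf)
    * (\prod_j h (ir0 j) * \prod_j h (irinf j)).
Proof.
rewrite big_split_ord /= !big_split_ord /= !big_ord_recl !big_ord0 ord1E !mulr1.
by [].
Qed.

Definition mon_fun m : F :=
  g1 ^+ m it0 * g3 ^+ m is0 * g2 ^+ m itinf * g4 ^+ m isinf.

Definition mon_class m : Cl :=
  class_of E0 *+ (m it0 + m is0) + class_of Einf *+ (m itinf + m isinf)
  + (\sum_j class_of (Y0 j) *+ m (ir0 j) + \sum_j class_of (Yinf j) *+ m (irinf j)).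

Lemma phi_monomial m : phi 'X_[m] = echar (mon_fun m) (mon_class m).
Proof.
rewrite phiE mmapX /mmap1 prod_var /var_image /it0 /is0 /itinf /isinf.
rewrite !(casesL, casesR).
have -> : \prod_j cases (cases (fun i => echar (gmx i 0) (class_of E0))
               (fun i => echar (gmx i 1) (class_of Einf)))
        (cases (fun j => echar 1 (class_of (Y0 j)))
               (fun j => echar 1 (class_of (Yinf j)))) (ir0 j) ^+ m (ir0 j)
   = echar 1 (\sum_j class_of (Y0 j) *+ m (ir0 j)).
  under eq_bigr do rewrite /ir0 casesR casesL echarX expr1n.
  by rewrite echar_prod big1.
have -> : \prod_j cases (cases (fun i => echar (gmx i 0) (class_of E0))
               (fun i => echar (gmx i 1) (class_of Einf)))
        (cases (fun j => echar 1 (class_of (Y0 j)))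
               (fun j => echar 1 (class_of (Yinf j)))) (irinf j) ^+ m (irinf j)
   = echar 1 (\sum_j class_of (Yinf j) *+ m (irinf j)).
  under eq_bigr do rewrite /irinf !casesR echarX expr1n.
  by rewrite echar_prod big1.
rewrite !echarX !echarM !mulr1 /mon_fun /mon_class /= -!mulrnDr !mulrA.
by [].
Qed.

Lemma phi_term c m : phi (c *: 'X_[m]) = echar (cst c * mon_fun m) (mon_class m).
Proof.
by rewrite -mul_mpolyC phiM phi_monomial phiE mmapC /echar_cst echarM add0r.
Qed.

Lemma coeff_phi f (c : Cl) :
  coeff c (phi f) = \sum_(m <- msupp f | mon_class m == c) cst f@_m * mon_fun m.
Proof.
have coeffS (r : seq 'X_{1..N}) (u : 'X_{1..N} -> cox_ambient X) :
    coeff c (\sum_(m <- r) u m) = \sum_(m <- r) coeff c (u m).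
  by elim: r => [|m r IH]; rewrite ?big_nil ?coeff0 // !big_cons -IH; exact: coeffD.
rewrite {1}[f]mpolyE phi_sum coeffS [RHS]big_mkcond; apply: eq_bigr => m _.
rewrite phi_term coeff_echar.
by case: eqP => _; rewrite ?mulr1 ?mulr0.
Qed.

Definition normal (f : S) : Prop :=
  forall m, m \in msupp f -> m it0 = 0%N \/ m isinf = 0%N.

(* Distinct normal monomials of the same class have distinct images. *)
Lemma phi_normal_inj f :
  (forall e e' d d', \sum_j class_of (Y0 j) *+ e j + \sum_j class_of (Yinf j) *+ e' j
     = \sum_j class_of (Y0 j) *+ d j + \sum_j class_of (Yinf j) *+ d' j ->
     e =1 d /\ e' =1 d') ->
  normal f -> phi f = 0 -> f = 0.
Proof.
move=> indep nf Hf; apply/mpolyP => m; rewrite mcoeff0.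
case: (boolP (m \in msupp f)) => [mf|]; last exact: memN_msupp_eq0.
have := coeff_phi f (mon_class m); rewrite Hf coeff0.
pose s := [seq m' <- msupp f | mon_class m' == mon_class m] => E.
have ms : m \in s by rewrite mem_filter eqxx.
have had m' : m' \in s -> m' it0 = 0%N \/ m' isinf = 0%N.
  by rewrite mem_filter => /andP[_]; exact: nf.
have Hh (h : 'M[k]_2) : \det h = 1 -> \sum_(m' <- s) f@_m' *
    (h 0 0 ^+ m' it0 * h 1 0 ^+ m' is0 * h 0 1 ^+ m' itinf * h 1 1 ^+ m' isinf) = 0.
  move=> dh; pose P : {mpoly k[2 * 2]} := \sum_(m' <- s) (f@_m')%:MP *
    (Xmx k 0 0 ^+ m' it0 * Xmx k 1 0 ^+ m' is0 * Xmx k 0 1 ^+ m' itinf * Xmx k 1 1 ^+ m' isinf).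
  have evP (L : comNzRingType) (iota : {rmorphism k -> L}) (M : 'M[L]_2) :
      evalmx iota M P = \sum_(m' <- s) iota f@_m' *
    (M 0 0 ^+ m' it0 * M 1 0 ^+ m' is0 * M 0 1 ^+ m' itinf * M 1 1 ^+ m' isinf).
    rewrite /evalmx rmorph_sum; apply: eq_bigr => m' _ /=.
    by rewrite -/(evalmx iota M _) !evalmxE.
  have : evalmx cst gmx P = 0.
    by rewrite evP [RHS]E big_filter; apply: eq_bigr => m' _; rewrite /mon_fun.
  by move/evg_eq0/(_ h dh); rewrite evP.
have := SL2_monomials_free k0 had Hh ms.
have uniq_m m' : [&& m' it0 == m it0, m' is0 == m is0, m' itinf == m itinf & m' isinf == m isinf]
    -> mon_class m' = mon_class m -> m' = m.
  move=> /and4P [/eqP e1 /eqP e2 /eqP e3 /eqP e4]; rewrite /mon_class e1 e2 e3 e4 => /addrI.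
  move=> /indep [r0 rinf]; apply/mnmP => i.
  case: (split_ordP i) => {}i ->; case: (split_ordP i) => {}i ->.
  - by move: i; apply: ord2_ind.
  - by move: i; apply: ord2_ind.
  - exact: r0.
  - exact: rinf.
rewrite big_filter_cond big_mkcond (bigD1_seq m) ?msupp_uniq //= !eqxx /=.
rewrite big1 ?addr0 // => m' /eqP m'm.
by case: ifP => // /andP[/eqP cm' em']; case: m'm; exact: uniq_m.
Qed.

(** * The relation, division by it, and its invariance *)

Section Relation.
Variables (m0 : 'I_p -> nat) (minf : 'I_q -> nat).
Local Notation rel := (cox_relation k m0 minf).

Definition rmon : 'X_{1..N} :=
  [multinom cases (cases (fun _ : 'I_2 => 0%N) (fun _ : 'I_2 => 0%N)) (cases m0 minf) i | i < N].

Lemma rmonE : 'X_[rmon] = (\prod_j r_zero k q j ^+ m0 j) * (\prod_j r_infty k p j ^+ minf j) :> S.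
Proof.
rewrite mpolyXE_id prod_var /rmon !mnmE /it0 /is0 /itinf /isinf !(casesL, casesR).
rewrite !expr0 !mul1r; congr (_ * _); apply: eq_bigr => j _; rewrite mnmE.
  by rewrite /ir0 casesR casesL.
by rewrite /irinf !casesR.
Qed.

Lemma relE : rel = 'X_it0 * 'X_isinf - 'X_is0 * 'X_itinf - 'X_[rmon].
Proof. by rewrite /cox_relation rmonE [s_infty _ _ _ * _]mulrC. Qed.

(* Division by the relation, whose leading monomial is t_0 s_infty. *)
Lemma cox_relation_division f : exists f' g, normal g /\ f = f' * rel + g.
Proof.
pose W (f : S) := exists f' g, normal g /\ f = f' * rel + g.
have WD a b : W a -> W b -> W (a + b).
  move=> [a' [ga [na ->]]] [b' [gb [nb ->]]]; exists (a' + b'), (ga + gb); split; last by ring.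
  by move=> m /msuppD_le; rewrite mem_cat => /orP[/na|/nb].
have WM a b : W b -> W (a * rel + b).
  by move=> [b' [gb [nb ->]]]; exists (a + b'), gb; split=> //; ring.
(* Induction on the exponent of t_0: each of the two monomials that replace ['X_[m]] has one factor
   t_0 less. *)
have WX j m : (m it0 <= j)%N -> W 'X_[m].
  elim: j m => [|j IH] m mj.
    exists 0, 'X_[m]; rewrite mul0r add0r; split=> // m'; rewrite msuppX inE => /eqP ->.
    by left; apply/eqP; rewrite -leqn0.
  have [ms|ms] := posnP (m isinf).
    exists 0, 'X_[m]; rewrite mul0r add0r; split=> // m'; rewrite msuppX inE => /eqP ->.
    by right.
  have [mt|mt] := posnP (m it0); first by apply: IH; rewrite mt.
  pose m' := (m - U_(it0) - U_(isinf))%MM.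
  have ne : it0 != isinf by [].
  have Em : m = (m' + U_(it0) + U_(isinf))%MM.
    apply/mnmP => i; rewrite !mnmDE !mnmBE !mnm1E.
    have [<-|_] := eqVneq it0 i; first by rewrite (_ : (isinf == it0) = false) //=; lia.
    by have [<-|_] := eqVneq isinf i; rewrite /=; lia.
  have -> : 'X_[m] = 'X_[m'] * rel + ('X_[m' + U_(is0) + U_(itinf)] + 'X_[m' + rmon]) :> S.
    by rewrite {1}Em relE !mpolyXD; ring.
  have m't : (m' it0 <= j)%N by rewrite /m' !mnmBE !mnm1E eqxx /=; lia.
  apply: WM; apply: WD; apply: IH; rewrite !mnmDE.
    by rewrite !mnm1E /= !addn0.
  by rewrite /rmon mnmE /it0 !casesL addn0.
have WZ c a : W a -> W (c *: a).
  move=> [a' [ga [na ->]]]; exists (c *: a'), (c *: ga); split.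
    by move=> m /msuppZ_le; exact: na.
  by rewrite scalerDr scalerAl.
rewrite -/(W f) [f]mpolyE; apply: (big_ind W) => //.
  by exists 0, 0; split; [move=> m; rewrite msupp0|rewrite mul0r addr0].
by move=> m _; apply: WZ; exact: (WX (m it0)).
Qed.

(** The image is det(g) - 1 times the character of degree [E_0] + [E_infty]; the hypothesis puts the
    boundary monomial in this degree. *)
Lemma phi_relation : multiplicities E0 Einf Y0 Yinf m0 minf -> phi rel = 0.
Proof.
move=> Hm; rewrite relE.
have phiN f : phi (- f) = - phi f by rewrite !phiE rmorphN.
have phiX i : phi 'X_i = var_image i by rewrite phiE mmapX mmap1U.
rewrite !phiD !phiN !phiM !phiX phi_monomial.
rewrite /var_image /it0 /is0 /itinf /isinf !(casesL, casesR) !echarM.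
have -> : mon_fun rmon = 1.
  by rewrite /mon_fun /rmon !mnmE /it0 /is0 /itinf /isinf !(casesL, casesR) !expr0 !mulr1.
have -> : mon_class rmon = class_of E0 + class_of Einf.
  rewrite /mon_class Hm /rmon !mnmE /it0 /is0 /itinf /isinf !(casesL, casesR).
  rewrite !mulr0n !add0r; congr (_ + _); apply: eq_bigr => j _; rewrite mnmE.
    by rewrite /ir0 casesR casesL.
  by rewrite /irinf !casesR.
apply/eqP/freeg_eqP => d; rewrite coeff0 !coeffB !coeff_echar -!mulrBl.
have := det_gmx F; rewrite /g1 /g2 /g3 /g4 => dg.
by rewrite [gmx 1 0 * _]mulrC dg subrr mul0r.
Qed.

(** The quadratic part is the determinant of the matrix with columns (t_0, s_0) and (t_infty,
    s_infty), on which [h] acts through left multiplication by [invmx h]; the boundary variables are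
    fixed. *)
Lemma symS_act_relation (h : 'M[k]_2) : \det h = 1 -> symS_act h rel = rel :> S.
Proof.
move=> dh; rewrite {1}relE /symS_act.
set vi := cases _ _; have E1 (u : 'I_N) : mmap (fun c => c%:MP : S) vi 'X_u = vi u.
  by rewrite (mmapX vi (@mpolyC _ k)) mmap1U.
have mB a b : mmap (fun c => c%:MP : S) vi (a - b) = mmap (fun c => c%:MP : S) vi a - mmap (fun c => c%:MP : S) vi b.
  exact: (rmorphB (mmap (@mpolyC _ k) vi)).
have mM a b : mmap (fun c => c%:MP : S) vi (a * b) = mmap (fun c => c%:MP : S) vi a * mmap (fun c => c%:MP : S) vi b.
  exact: (rmorphM (mmap (@mpolyC _ k) vi)).
rewrite !mB !mM !E1.
have -> : mmap (fun c => c%:MP : S) vi 'X_[rmon] = 'X_[rmon].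
  rewrite (mmapX vi (@mpolyC _ k)) /mmap1 mpolyXE_id !prod_var /rmon !mnmE.
  rewrite /it0 /is0 /itinf /isinf !(casesL, casesR) !expr0; congr (_ * (_ * _)).
    by apply: eq_bigr => j _; rewrite /vi /ir0 casesR casesL.
  by apply: eq_bigr => j _; rewrite /vi /irinf !casesR.
rewrite relE; congr (_ - _).
rewrite /vi /it0 /is0 /itinf /isinf !(casesL, casesR) invmx2E //.
rewrite !big_ord_recl !big_ord0 ord1E !mxE /= !addr0.
rewrite /v_zero /v_infty -/it0 -/is0 -/itinf -/isinf.
have := congr1 (fun c => c%:MP : S) dh; rewrite det2E rmorphB !rmorphM rmorph1 => dh'.
have -> : 'X_it0 * 'X_isinf - 'X_is0 * 'X_itinf = 1 * ('X_it0 * 'X_isinf - 'X_is0 * 'X_itinf) :> S.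
  by rewrite mul1r.
by rewrite -dh' !rmorphN; ring.
Qed.

End Relation.
End Kernel.

(** * Divisors and the Cox ring *)

Section ClassGroup.
Variables (k : closedFieldType) (F : sl2_field k) (n : nat) (X : embedding F n).
Implicit Types (D : div_group X) (P : prime_divisor X).
Local Notation princ := (GRing.ZmodClosed.clone (div_group X) (@principal k F n X) _).

Lemma cls_eq D D' : cls D = cls D' <-> principal (D - D').
Proof.
have H := Quotient.idealrBE princ D D'.
have E : ((D - D') \in (princ : {pred _})) = principal (D - D') by [].
by rewrite -E H; split=> h; apply/eqP.
Qed.

Lemma cls_zmod_morphism : zmod_morphism (@cls k F n X).
Proof.
move=> D D'; rewrite /cls.
have -> : \pi_(class_group X)%qT (D - D')
    = Quotient.add (\pi_(class_group X)%qT D) (\pi_(class_group X)%qT (- D')).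
  exact: (Quotient.pi_add princ).
by congr (_ + _); exact: (Quotient.pi_opp princ).
Qed.

HB.instance Definition _ :=
  GRing.isZmodMorphism.Build (div_group X) (class_group X) (@cls k F n X)
    cls_zmod_morphism.

Lemma cls_add D D' : cls (D + D') = cls D + cls D'.
Proof. exact: raddfD. Qed.

Lemma coeff_div1 P Q : coeff Q (<< P >> : div_group X) = (P == Q)%:R.
Proof. by rewrite coeffU mul1r. Qed.

Lemma coeff_divD P D D' : coeff P (D + D') = coeff P D + coeff P D'.
Proof. exact: coeffD. Qed.
Lemma coeff_divB P D D' : coeff P (D - D') = coeff P D - coeff P D'.
Proof. exact: coeffB. Qed.
Lemma coeff_divMn P D m : coeff P (D *+ m) = coeff P D *+ m.
Proof. exact: coeffMn. Qed.
Lemma coeff_div0 P : coeff P (0 : div_group X) = 0.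
Proof. exact: coeff0. Qed.

Definition fam_div (m : nat) (Y : 'I_m -> prime_divisor X) (e : 'I_m -> nat) :
  div_group X := \sum_j << Y j >> *+ e j.

Lemma cls_fam_div m (Y : 'I_m -> prime_divisor X) e :
  cls (fam_div Y e) = \sum_j class_of (Y j) *+ e j.
Proof. by rewrite raddf_sum; apply: eq_bigr => j _; rewrite raddfMn. Qed.

Lemma coeff_fam_div m (Y : 'I_m -> prime_divisor X) e P :
  coeff P (fam_div Y e) = \sum_j ((Y j == P)%:R *+ e j).
Proof.
rewrite /fam_div (big_morph _ (coeff_divD P) (coeff_div0 P)).
by apply: eq_bigr => j _; rewrite coeff_divMn coeff_div1.
Qed.

Lemma coeff_fam_div_at m (Y : 'I_m -> prime_divisor X) e i : injective Y ->
  coeff (Y i) (fam_div Y e) = (e i)%:Z.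
Proof.
move=> inj; rewrite coeff_fam_div (bigD1 i) //= eqxx big1 ?addr0 ?natz // => j ji.
by rewrite (inj_eq inj) (negPf ji) mul0rn.
Qed.

Lemma coeff_fam_div_out m (Y : 'I_m -> prime_divisor X) e P :
  (forall j, P <> Y j) -> coeff P (fam_div Y e) = 0.
Proof.
move=> nP; rewrite coeff_fam_div big1 // => j _.
by case: eqP => [E|]; [case: (nP j)|rewrite mul0rn].
Qed.

End ClassGroup.

(** * The prime divisors of X and the divisor of g_3 g_4 *)

Section Main.
Variables (k : closedFieldType) (k0 : [pchar k] =i pred0) (F : sl2_field k).
Variables (n : nat) (n_gt0 : (0 < n)%N) (X : embedding F n).
Hypothesis not_dominating : forall P : prime_divisor X, G_stable P -> ~ dominates_P1 P.
Hypothesis exceptional_points : forall x : P1 k,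
  exceptional_point X x -> x = x_zero k \/ x = x_infty k.
Variables (E0 Einf : prime_divisor X).
Hypothesis E0_color : color_over (x_zero k) E0.
Hypothesis Einf_color : color_over (x_infty k) Einf.
Variables (p q : nat).
Variables (Y0 : 'I_p -> prime_divisor X) (Yinf : 'I_q -> prime_divisor X).
Hypothesis Y0_enum : enum_G_stable_over (x_zero k) Y0.
Hypothesis Yinf_enum : enum_G_stable_over (x_infty k) Yinf.

Local Notation cst := (ff_cst F).
Local Notation gmx := (ff_gmx F).
Local Notation G := (OG F).
Local Notation K := (Kmu F n).
Local Notation g1 := (g1 F).
Local Notation g2 := (g2 F).
Local Notation g3 := (g3 F).
Local Notation g4 := (g4 F).
Local Notation OGn := (OGmu F n).
Local Notation y := (ycoord F n).
Implicit Types (P Q : prime_divisor X) (D : div_group X).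

Let Kf : subfield K := Kmu_subfield k0 F n_gt0.
Let Kr : subring K. Proof. by case: Kf. Qed.
Let OGnr : subring OGn := OGmu_subring k0 F n_gt0.
Let Gr : subring G := OG_subring F.
Let dP P : dvr K P := pd_is_dvr k0 n_gt0 P.

Let gn0 : [/\ g1 != 0, g2 != 0, g3 != 0 & g4 != 0] := g_neq0 F.

Lemma not_G_stable_open P : ~ G_stable P -> OGn `<=` P.
Proof.
by move=> nS; apply: contrapT => nP; apply: nS; exact: (boundary_G_stable k0 n_gt0 nP).
Qed.

Let E0_open : OGn `<=` E0.
Proof. by apply: not_G_stable_open; case: E0_color. Qed.
Let Einf_open : OGn `<=` Einf.
Proof. by apply: not_G_stable_open; case: Einf_color. Qed.
Let E0_max : maxid E0 (g3 ^+ n).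
Proof. by apply: (over_zero k0 n_gt0 E0_open); case: E0_color. Qed.
Let Einf_max : maxid Einf (g4 ^+ n).
Proof. by apply: (over_infty k0 n_gt0 Einf_open); case: Einf_color. Qed.

Lemma frame0_exists : exists fr : frame F n, fr3 fr = g3 /\ fr4 fr = g4.
Proof.
have [fr [_ _ f3 f4 _]] := frame_fin F n_gt0 0; exists fr; rewrite f3 f4.
by rewrite rmorph0 mul0r subr0.
Qed.

Lemma OGn_g i j : OGn (gmx i j ^+ n). Proof. exact: OGn_pow. Qed.

Lemma K_g i j : K (gmx i j ^+ n).
Proof. by apply: (OGmu_Kmu k0 n_gt0); exact: OGn_g. Qed.

(** Both rings are the restriction to K of the place [g3 = 0] of G. *)
Lemma open_zero_eq P : OGn `<=` P -> maxid P (g3 ^+ n) -> P = E0.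
Proof.
move=> OP MP; have [fr [f3 f4]] := frame0_exists.
have H Q : OGn `<=` Q -> maxid Q (g3 ^+ n) -> pd_ring Q = x3_place fr `&` K.
  move=> OQ MQ; apply: (x3_place_Kmu_unique k0 n_gt0) => //;
    rewrite ?f3 //; [exact: locals_open|exact: K_g].
by apply: pd_inj; rewrite (H P OP MP) (H E0 E0_open E0_max).
Qed.

Lemma open_infty_eq P : OGn `<=` P -> maxid P (g4 ^+ n) -> P = Einf.
Proof.
move=> OP MP; have [fr [_ _ f3 f4 _]] := frame_inf F n_gt0.
have H Q : OGn `<=` Q -> maxid Q (g4 ^+ n) -> pd_ring Q = x3_place fr `&` K.
  move=> OQ MQ; apply: (x3_place_Kmu_unique k0 n_gt0) => //;
    rewrite ?f3 //; [exact: locals_open|exact: K_g].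
by apply: pd_inj; rewrite (H P OP MP) (H Einf Einf_open Einf_max).
Qed.

(** The equation [g3] on G need not be invariant; [g4] is a unit at this place and has the opposite
    weight, so the product is invariant of order one. *)
Lemma E0_uniformizer : uniformizer K E0 (g3 * g4).
Proof.
have [fr [f3 f4]] := frame0_exists; have [_ K34 _ _] := K_gg k0 F n_gt0.
have -> : pd_ring E0 = x3_place fr `&` K.
  by apply: (x3_place_Kmu_unique k0 n_gt0) => //; rewrite ?f3 //; [exact: locals_open|exact: K_g].
apply: (uniformizer_restrict k0 n_gt0 (u := g4)) => //; last by rewrite f3 mulrC.
by rewrite -f4; exact: x4_unit.
Qed.

Lemma Einf_uniformizer : uniformizer K Einf (g3 * g4).
Proof.
have [fr [_ _ f3 f4 _]] := frame_inf F n_gt0; have [_ K34 _ _] := K_gg k0 F n_gt0.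
have D := place_dvr k0 (irreducible_X fr).
have -> : pd_ring Einf = x3_place fr `&` K.
  by apply: (x3_place_Kmu_unique k0 n_gt0) => //; rewrite ?f3 //; [exact: locals_open|exact: K_g].
apply: (uniformizer_restrict k0 n_gt0 (u := g3)) => //; last by rewrite f3.
by rewrite -[g3]opprK -f4; apply: (unit_in_N D); exact: x4_unit.
Qed.

(** Otherwise the n-th powers of [g1 * g4] and [g2 * g3] would be in the maximal ideal, hence these
    products and their difference 1. *)
Lemma E0_neq_Einf : E0 <> Einf.
Proof.
move=> E; have M4 : maxid E0 (g4 ^+ n) by rewrite E.
have [O14 _ O23 _] := OGn_gg k0 F n_gt0; have D := dP E0.
apply: (maxid_1 D); rewrite -(det_gmx F); apply: (maxidB D).
  apply: (maxidX (m := n) D); first exact: E0_open.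
  by rewrite exprMn; apply: (maxidM D) => //; apply: E0_open; exact: OGn_g.
apply: (maxidX (m := n) D); first exact: E0_open.
by rewrite exprMn; apply: (maxidM D) => //; apply: E0_open; exact: OGn_g.
Qed.

Let Y0_stable j : G_stable (Y0 j). Proof. by have [_ H] := Y0_enum; have [] := proj2 (H (Y0 j)) (ex_intro _ j erefl). Qed.
Let Y0_over j : Defs.over (x_zero k) (Y0 j).
Proof. by have [_ H] := Y0_enum; have [] := proj2 (H (Y0 j)) (ex_intro _ j erefl). Qed.
Let Yinf_stable j : G_stable (Yinf j).
Proof. by have [_ H] := Yinf_enum; have [] := proj2 (H (Yinf j)) (ex_intro _ j erefl). Qed.
Let Yinf_over j : Defs.over (x_infty k) (Yinf j).
Proof. by have [_ H] := Yinf_enum; have [] := proj2 (H (Yinf j)) (ex_intro _ j erefl). Qed.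

Lemma G_stable_neq P : G_stable P -> P <> E0 /\ P <> Einf.
Proof.
by move=> SP; split=> E; [have [_ + _] := E0_color|have [_ + _] := Einf_color]; rewrite -E.
Qed.

Lemma over_disjoint P : Defs.over (x_zero k) P -> ~ Defs.over (x_infty k) P.
Proof.
move=> /(overE k0 n_gt0) /=; rewrite rmorph0 subr0 => My /(overE k0 n_gt0) /= [Oy' _].
by apply: (maxid_1 (dP P)); rewrite -(mulVf (y_neq0 F n)); exact: maxidM.
Qed.

Lemma Y0_neq_Yinf i j : Y0 i <> Yinf j.
Proof. by move=> E; apply: (over_disjoint (Y0_over i)); rewrite E; exact: Yinf_over. Qed.

Lemma Y0_not_open j : ~ (OGn `<=` Y0 j).
Proof.
move=> O; have [H _] := G_stable_neq (Y0_stable j); apply: H.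
exact: (open_zero_eq O (over_zero k0 n_gt0 O (Y0_over j))).
Qed.

Lemma Yinf_not_open j : ~ (OGn `<=` Yinf j).
Proof.
move=> O; have [_ H] := G_stable_neq (Yinf_stable j); apply: H.
exact: (open_infty_eq O (over_infty k0 n_gt0 O (Yinf_over j))).
Qed.

(* A G-stable divisor over another point x would be all of pi^* x, since x is *)
(* not exceptional; but pi^* x contains the color over x.                     *)
Lemma G_stable_enum P : G_stable P -> (exists j, P = Y0 j) \/ (exists j, P = Yinf j).
Proof.
move=> SP; have [[c|] ox] := not_dominates_over k0 n_gt0 (not_dominating SP); last first.
  by right; apply/(proj2 Yinf_enum).
have [c0|c0] := eqVneq c 0; first by left; apply/(proj2 Y0_enum); split=> //; rewrite c0 in ox.
exfalso; have D := dP P.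
have BP : B_stable P by move=> h dh _; exact: SP.
have [x' Ex'] : exists x, pi_star x = (fun Q => (Q == P)%:Z).
  apply: contrapT => nx; have [] : Some c = x_zero k \/ Some c = x_infty k => //.
    by apply: exceptional_points; exists P.
  by move=> [] /eqP; rewrite (negPf c0).
have /(overE k0 n_gt0) Mc := ox.
have ox' : Defs.over x' P by rewrite /Defs.over Ex' eqxx.
have Ec : x' = Some c.
  move: ox' => /(overE k0 n_gt0) Mc'; case: x' Ex' Mc' => [c'|] _ /= Mc'.
    have /cst_max /eqP : maxid P (cst (c' - c)).
      have -> : cst (c' - c) = (y - cst c) - (y - cst c') by rewrite rmorphB; ring.
      exact: (maxidB D).
    by rewrite subr_eq0 => /eqP ->.
  have Oy : pd_ring P y.
    have [_ Pr _ _] := D; rewrite -[y](subrK (cst c)); apply: (subr_D Pr); first by case: Mc.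
    exact: pd_cst.
  by case: (maxid_1 D); rewrite -(mulfV (y_neq0 F n)); exact: maxidM.
have [Q oQ nQ] := color_over_fin k0 n_gt0 X c0.
move: oQ; rewrite /Defs.over -Ec Ex'; case: eqP => // QP _.
by apply: nQ; rewrite QP.
Qed.

Variant place_spec P : Prop :=
| PlaceE0 of P = E0
| PlaceEinf of P = Einf
| PlaceY0 j of P = Y0 j
| PlaceYinf j of P = Yinf j
| PlaceOpen of OGn `<=` P & unit_in P (g3 ^+ n) & unit_in P (g4 ^+ n) & P <> E0 & P <> Einf.

Lemma placeP P : place_spec P.
Proof.
case: (pselect (G_stable P)) => [/G_stable_enum [[j E]|[j E]]|/not_G_stable_open OP].
- exact: PlaceY0 E.
- exact: PlaceYinf E.
case: (pselect (P = E0)) => [|n0]; first exact: PlaceE0.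
case: (pselect (P = Einf)) => [|ninf]; first exact: PlaceEinf.
apply: PlaceOpen => //.
- have [//|M] := dvr_unit_or_max (OP _ (OGn_g 1 0)); by case: n0; exact: open_zero_eq.
- have [//|M] := dvr_unit_or_max (OP _ (OGn_g 1 1)); by case: ninf; exact: open_infty_eq.
Qed.

Lemma open_spec P : OGn `<=` P -> [/\ forall j, P <> Y0 j & forall j, P <> Yinf j].
Proof.
by move=> OP; split=> j E; [apply: (@Y0_not_open j)|apply: (@Yinf_not_open j)]; rewrite -E.
Qed.

Let K34 : K (g3 * g4). Proof. by case: (K_gg k0 F n_gt0). Qed.
Let g34_0 : g3 * g4 != 0. Proof. by case: gn0 => *; rewrite mulf_neq0. Qed.

(** A pole order: the order of [g3 * g4] along a G-stable divisor is at most 0 by [G_stable_ord], so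
    the absolute value only changes the sign. *)
Definition mult0 (j : 'I_p) : nat := `|ordP (Y0 j) (g3 * g4)|%N.
Definition multinf (j : 'I_q) : nat := `|ordP (Yinf j) (g3 * g4)|%N.

Lemma ord_g34 P : ordP P (g3 * g4) = coeff P (<< E0 >> + << Einf >>
  - (fam_div Y0 mult0 + fam_div Yinf multinf)).
Proof.
have [inj0 _] := Y0_enum; have [injinf _] := Yinf_enum.
have eqF Q Q' : Q <> Q' -> (Q == Q') = false by move=> /eqP/negPf.
have negZ (z : int) : z <= 0 -> z = - (`|z|%N)%:Z by move=> z0; rewrite abszE ler0_norm ?opprK.
rewrite coeff_divB !coeff_divD !coeff_div1; case: (placeP P) => [->|->|j ->|j ->|OP U3 U4 n0 ninf].
- have [O1 O2] := open_spec E0_open.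
  rewrite !coeff_fam_div_out // eqxx (eqF Einf E0); last by move/esym/E0_neq_Einf.
  by rewrite /ordP (ord_uniformizer (dP E0) E0_uniformizer).
- have [O1 O2] := open_spec Einf_open.
  rewrite !coeff_fam_div_out // eqxx (eqF E0 Einf); last exact: E0_neq_Einf.
  by rewrite /ordP (ord_uniformizer (dP Einf) Einf_uniformizer).
- have [nE0 nEinf] := G_stable_neq (Y0_stable j).
  rewrite coeff_fam_div_at // coeff_fam_div_out => [|i]; last exact: Y0_neq_Yinf.
  rewrite !eqF; [|exact/nesym|exact/nesym].
  by rewrite [LHS](negZ _ (G_stable_ord k0 n_gt0 (Y0_stable j))) [X in X - _](_ : _ = 0) // sub0r addr0.
- have [nE0 nEinf] := G_stable_neq (Yinf_stable j).
  rewrite coeff_fam_div_at // coeff_fam_div_out => [|i]; last exact/nesym/Y0_neq_Yinf.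
  rewrite !eqF; [|exact/nesym|exact/nesym].
  by rewrite [LHS](negZ _ (G_stable_ord k0 n_gt0 (Yinf_stable j))) [X in X - _](_ : _ = 0) // sub0r add0r.
- have [O1 O2] := open_spec OP.
  rewrite !coeff_fam_div_out // !eqF; [|exact/nesym|exact/nesym].
  apply: (ord_unit (dP P)); apply: (unit_in_root (dP P) n_gt0).
    by apply: OP; case: (OGn_gg k0 F n_gt0).
  by rewrite exprMn; exact: (unit_in_M (dP P)).
Qed.

Lemma mult_exists : multiplicities E0 Einf Y0 Yinf mult0 multinf.
Proof.
rewrite /multiplicities -!cls_fam_div -!raddfD; apply/cls_eq/asboolP.
by exists (g3 * g4); split=> // P; rewrite ord_g34.
Qed.

(** [f] is a unit at all divisors of the open orbit, hence at the places of G above them, and units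
    of O(G) are constant. *)
Lemma boundary_div_cst f : K f -> f != 0 -> (forall P, OGn `<=` P -> unit_in P f) ->
  exists c, f = cst c.
Proof.
move=> Kff f0 Hf; apply: (units_cst k0 n_gt0) => O _ _ lO DO.
have [P EP] := pd_of_locals X lO DO.
have OP : OGn `<=` P.
  by rewrite EP; move: lO => [r Pr ->]; exact: loc_sub.
by have [_ H1 H2] := Hf P OP; rewrite EP in H1 H2; split=> //; [case: H1|case: H2].
Qed.

Lemma class_independent e e' d d' :
  cls (fam_div Y0 e + fam_div Yinf e') = cls (fam_div Y0 d + fam_div Yinf d') ->
  e =1 d /\ e' =1 d'.
Proof.
have [inj0 _] := Y0_enum; have [injinf _] := Yinf_enum.
move=> /cls_eq /asboolP [f [Kff f0 Hf]].
have [c Ec] : exists c, f = cst c.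
  apply: boundary_div_cst => // P OP; have [O1 O2] := open_spec OP.
  apply/(ord_eq0 (dP P)) => //; rewrite -[ord _ _ _]/(ordP P f) -Hf.
  by rewrite coeff_divB !coeff_divD !coeff_fam_div_out.
have H P : coeff P (fam_div Y0 e + fam_div Yinf e') = coeff P (fam_div Y0 d + fam_div Yinf d').
  apply/eqP; rewrite -subr_eq0 -coeff_divB Hf; apply/eqP.
  by apply: (ord_unit (dP P)); rewrite Ec; apply: cst_unit; rewrite -(fmorph_eq0 cst) -Ec.
split=> j.
  have := H (Y0 j); rewrite !coeff_divD !coeff_fam_div_at // !(coeff_fam_div_out (Y := Yinf)).
  - by rewrite !addr0 => -[].
  - by move=> i; exact: Y0_neq_Yinf.
  - by move=> i; exact: Y0_neq_Yinf.
have := H (Yinf j); rewrite !coeff_divD !coeff_fam_div_at // !(coeff_fam_div_out (Y := Y0)).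
- by rewrite !add0r => -[].
- by move=> i; exact/nesym/Y0_neq_Yinf.
- by move=> i; exact/nesym/Y0_neq_Yinf.
Qed.

Lemma locals_dvr O : locals G O -> is_dvr setT O -> dvr setT O.
Proof.
by move=> [r Pr ->] D; split; [exact: subfieldT|exact: loc_subring| |].
Qed.

(** * Points of codimension one of G above prime divisors of X *)

Section Restriction.
Variables (O : set F) (P : prime_divisor X).
Hypotheses (lO : locals G O) (DO : is_dvr setT O) (EP : pd_ring P = O `&` K).

Let D : dvr setT O := locals_dvr lO DO.

Lemma locals_sub : G `<=` O.
Proof. by case: lO => r Pr ->; exact: loc_sub. Qed.

Lemma restrict_open : OGn `<=` P.
Proof.
move=> f Of; rewrite EP; split; last exact: (OGmu_Kmu k0 n_gt0).
by apply: locals_sub; exact: OGmu_OG Of.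
Qed.

Lemma max_restrict f : maxid P f <-> K f /\ maxid O f.
Proof. by rewrite EP; exact: maxid_setI. Qed.

Lemma unit_restrict f : unit_in P f <-> K f /\ unit_in O f.
Proof. by rewrite EP; exact: unit_in_setI. Qed.

Lemma restrict_E0 : maxid O g3 -> P = E0 /\ uniformizer setT O g3 /\ unit_in O g4.
Proof.
move=> M3; have [fr [f3 f4]] := frame0_exists.
have EO : O = x3_place fr by apply: (x3_place_unique k0); rewrite ?f3.
split; last first.
  by rewrite -f3 -f4 EO; split; [exact: x3_uniformizer|exact: x4_unit].
apply: open_zero_eq; first exact: restrict_open.
by apply/max_restrict; split; [exact: K_g|exact: (maxidXn D)].
Qed.

Lemma restrict_Einf : maxid O g4 -> P = Einf /\ uniformizer setT O g4 /\ unit_in O g3.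
Proof.
move=> M4; have [fr [_ _ f3 f4 _]] := frame_inf F n_gt0.
have EO : O = x3_place fr by apply: (x3_place_unique k0); rewrite ?f3.
split; last first.
  rewrite -f3 -[g3]opprK -f4; split; first by rewrite EO; exact: x3_uniformizer.
  by apply: (unit_in_N D); rewrite EO; exact: x4_unit.
apply: open_infty_eq; first exact: restrict_open.
by apply/max_restrict; split; [exact: K_g|exact: (maxidXn D)].
Qed.

Lemma restrict_E0_max : P = E0 -> maxid O g3.
Proof.
move=> PE; have /max_restrict [_ M] : maxid P (g3 ^+ n) by rewrite PE.
by apply: (maxidX (m := n) D) => //; apply: locals_sub; exact: OG_gmx.
Qed.

Lemma restrict_Einf_max : P = Einf -> maxid O g4.
Proof.
move=> PE; have /max_restrict [_ M] : maxid P (g4 ^+ n) by rewrite PE.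
by apply: (maxidX (m := n) D) => //; apply: locals_sub; exact: OG_gmx.
Qed.

(* G -> G/mu_n is unramified along E0 and Einf. *)
Lemma ord_restrict f : K f -> f != 0 -> (P <> E0 -> P <> Einf -> ordP P f = 0) ->
  ord setT O f = ordP P f.
Proof.
move=> Kff f0 Hf.
have H u t : uniformizer K P t -> uniformizer setT O t -> u = f -> ord setT O f = ordP P f.
  move=> Ut UtO _; have [v Uv Ef] := ord_uniformizerE (dP P) Ut Kff f0.
  by rewrite {1}Ef (ordE D) //; have /unit_restrict [] := Uv.
case: (pselect (P = E0)) => [PE|n0].
  have [_ [U3 U4]] := restrict_E0 (restrict_E0_max PE).
  apply: (H f (g3 * g4)) => //; first by rewrite PE; exact: E0_uniformizer.
  by rewrite mulrC; exact: (uniformizer_mul D).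
case: (pselect (P = Einf)) => [PE|ninf].
  have [_ [U4 U3]] := restrict_Einf (restrict_Einf_max PE).
  apply: (H f (g3 * g4)) => //; first by rewrite PE; exact: Einf_uniformizer.
  exact: (uniformizer_mul D).
have := Hf n0 ninf => E; rewrite E; apply: (ord_unit D).
by move/(ord_eq0 (dP P) Kff f0)/unit_restrict: E => [].
Qed.

End Restriction.

(** Orders on G and on G/mu_n are compared only along the two colors and where a function is a unit.
    For divisors supported on the colors and the boundary this is enough to compare equations of
    linearly equivalent divisors. *)
Definition supported D : Prop :=
  forall P, OGn `<=` P -> P <> E0 -> P <> Einf -> coeff P D = 0.

Lemma equation_add D D' f f' : equation_on_G D f -> equation_on_G D' f' ->
  equation_on_G (D + D') (f * f').
Proof.
move=> [f0 Hf] [f'0 Hf']; split; first exact: mulf_neq0.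
move=> O P lO DO EP; rewrite (ordM (locals_dvr lO DO)) // (Hf O P) // (Hf' O P) //.
by rewrite coeff_divD.
Qed.

Lemma equation_0 : equation_on_G (0 : div_group X) 1.
Proof.
split; first exact: oner_neq0.
move=> O P lO DO _; rewrite coeff_div0; apply: (ord_unit (locals_dvr lO DO)).
exact: (unit_in_1 (locals_dvr lO DO)).
Qed.

Lemma equation_E0 : equation_on_G (<< E0 >> : div_group X) g3.
Proof.
split; first by case: gn0.
move=> O P lO DO EP; have D := locals_dvr lO DO; rewrite coeff_div1.
have O3 : O g3 by apply: (locals_sub lO); exact: OG_gmx.
case: (dvr_unit_or_max O3) => [U|M].
  rewrite (ord_unit D U); case: eqP => // PE.
  by have [] := restrict_E0_max lO DO EP (esym PE).
by have [-> [U _]] := restrict_E0 lO DO EP M; rewrite eqxx (ord_uniformizer D U).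
Qed.

Lemma equation_Einf : equation_on_G (<< Einf >> : div_group X) g4.
Proof.
split; first by case: gn0.
move=> O P lO DO EP; have D := locals_dvr lO DO; rewrite coeff_div1.
have O4 : O g4 by apply: (locals_sub lO); exact: OG_gmx.
case: (dvr_unit_or_max O4) => [U|M].
  rewrite (ord_unit D U); case: eqP => // PE.
  by have [] := restrict_Einf_max lO DO EP (esym PE).
by have [-> [U _]] := restrict_Einf lO DO EP M; rewrite eqxx (ord_uniformizer D U).
Qed.

Lemma equation_boundary Q : ~ (OGn `<=` Q) -> equation_on_G (<< Q >> : div_group X) 1.
Proof.
move=> nQ; split; first exact: oner_neq0.
move=> O P lO DO EP; have D := locals_dvr lO DO; rewrite coeff_div1.
rewrite (ord_unit D (unit_in_1 D)); case: eqP => // QP.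
by case: nQ; rewrite QP; exact: (restrict_open lO EP).
Qed.

(** * Sections of divisors, and the values of phi in the Cox ring *)

Lemma sections_mul D D' s s' : sections D s -> sections D' s' ->
  sections (D + D') (s * s').
Proof.
move=> [Ks Hs] [Ks' Hs']; split; first exact: subr_M.
move=> ss0 P; have [s0 s'0] : s != 0 /\ s' != 0.
  by apply/andP; rewrite -negb_or -mulf_eq0.
rewrite /ordP (ordM (dP P)) // coeff_divD addrACA; apply: addr_ge0; [exact: Hs|exact: Hs'].
Qed.

Lemma sections_add D s s' : sections D s -> sections D s' -> sections D (s + s').
Proof.
move=> [Ks Hs] [Ks' Hs']; split; first exact: subr_D.
move=> ss0 P; rewrite -lerBlDr sub0r; apply: (ordD_ge (dP P)) => // n0.
  by rewrite -sub0r lerBlDr; exact: Hs.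
by rewrite -sub0r lerBlDr; exact: Hs'.
Qed.

Lemma sections_cst D c : (forall P, 0 <= coeff P D) -> sections D (cst c).
Proof.
move=> D0; split; first exact: Kmu_cst.
rewrite fmorph_eq0 => c0 P; rewrite /ordP (ord_unit (dP P)) ?add0r //.
exact: cst_unit.
Qed.

Lemma div1_ge0 Q P : 0 <= coeff P (<< Q >> : div_group X).
Proof. by rewrite coeff_div1 ler0n. Qed.

Lemma sections_quot Q (f : F) : K f -> f != 0 ->
  (forall P, G_stable P -> unit_in P f) ->
  (forall P, OGn `<=` P -> P <> Q -> pd_ring P f) -> -1 <= ordP Q f ->
  sections << Q >> f.
Proof.
move=> Kff f0 Hst Hop HQ; split=> // _ P; rewrite coeff_div1.
case: eqP => [<-|nQ]; first by rewrite -lerBlDr sub0r.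
rewrite addr0; apply/(ord_ge0 (dP P)) => //.
case: (pselect (G_stable P)) => [/Hst []//|/not_G_stable_open OP].
by apply: Hop => // PQ; apply: nQ.
Qed.

(** Along G-stable divisors [g1 / g3] is a unit by Weyl symmetry; elsewhere off [E0] its n-th power
    is regular; along [E0] it is the regular function [g1 * g4] over the uniformizer [g3 * g4].
    Multiplied by the equation [g3], this section becomes [g1]. *)
Lemma sections_E0 : sections << E0 >> (g1 / g3).
Proof.
have [n1 n2 n3 n4] := gn0; have [K13 _] := K_quot k0 F n_gt0.
apply: sections_quot => //; first by rewrite mulf_neq0 ?invr_eq0.
- by move=> P SP; case: (G_stable_quot k0 n_gt0 SP).
- move=> P OP nP; apply: (dvr_root (dP P) n_gt0) => //; rewrite expr_div_n.
  have [[_ _ U]|M] := dvr_unit_or_max (OP _ (OGn_g 1 0)); last by case: nP; exact: open_zero_eq.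
  by have [_ Pr _ _] := dP P; apply: (subr_M Pr) => //; exact: OP (OGn_g 0 0).
have [K14 _ _ _] := K_gg k0 F n_gt0; have [O14 _ _ _] := OGn_gg k0 F n_gt0.
have -> : g1 / g3 = (g1 * g4) * (g3 * g4)^-1 by field; rewrite n3 n4.
have i0 : (g3 * g4)^-1 != 0 by rewrite invr_eq0.
have Ki : K (g3 * g4)^-1 by case: Kf => _; apply.
rewrite /ordP (ordM (dP E0)) ?mulf_neq0 // (ordV (dP E0)) //.
rewrite (ord_uniformizer (dP E0) E0_uniformizer) lerDr.
by apply/(ord_ge0 (dP E0)); rewrite ?mulf_neq0 //; exact: E0_open.
Qed.

(** As for [E0], now with [g2 * g3] over the uniformizer [g3 * g4]. *)
Lemma sections_Einf : sections << Einf >> (g2 / g4).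
Proof.
have [n1 n2 n3 n4] := gn0; have [_ K24] := K_quot k0 F n_gt0.
apply: sections_quot => //; first by rewrite mulf_neq0 ?invr_eq0.
- by move=> P SP; case: (G_stable_quot k0 n_gt0 SP).
- move=> P OP nP; apply: (dvr_root (dP P) n_gt0) => //; rewrite expr_div_n.
  have [[_ _ U]|M] := dvr_unit_or_max (OP _ (OGn_g 1 1)); last by case: nP; exact: open_infty_eq.
  by have [_ Pr _ _] := dP P; apply: (subr_M Pr) => //; exact: OP (OGn_g 0 1).
have [_ _ K23 _] := K_gg k0 F n_gt0; have [_ _ O23 _] := OGn_gg k0 F n_gt0.
have -> : g2 / g4 = (g2 * g3) * (g3 * g4)^-1 by field; rewrite n3 n4.
have i0 : (g3 * g4)^-1 != 0 by rewrite invr_eq0.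
have Ki : K (g3 * g4)^-1 by case: Kf => _; apply.
rewrite /ordP (ordM (dP Einf)) ?mulf_neq0 // (ordV (dP Einf)) //.
rewrite (ord_uniformizer (dP Einf) Einf_uniformizer) lerDr.
by apply/(ord_ge0 (dP Einf)); rewrite ?mulf_neq0 //; exact: Einf_open.
Qed.

Definition cox_part_supp (c : class_group X) (f : F) : Prop :=
  exists D s fD, [/\ supported D, cls D = c, sections D s, equation_on_G D fD & f = s * fD].

Lemma cox_part_suppP c f : cox_part_supp c f -> cox_part c f.
Proof. by move=> [D [s [fD [? ? ? ? ?]]]]; exists D, s, fD. Qed.

Lemma cox_part_supp_mul c c' f f' : cox_part_supp c f -> cox_part_supp c' f' ->
  cox_part_supp (c + c') (f * f').
Proof.
move=> [D [s [fD [SD cD sD eD ->]]]] [D' [s' [fD' [SD' cD' sD' eD' ->]]]].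
exists (D + D'), (s * s'), (fD * fD'); split.
- by move=> P OP n0 ninf; rewrite coeff_divD SD // SD'.
- by rewrite cls_add cD cD'.
- exact: sections_mul.
- exact: equation_add.
- by rewrite mulrACA.
Qed.

(* Equations of linearly equivalent divisors D' = D + div g differ by g, up   *)
(* to a unit of O(G), i.e. a constant.                                        *)
Lemma cox_part_supp_add c f f' : cox_part_supp c f -> cox_part_supp c f' ->
  cox_part_supp c (f + f').
Proof.
move=> [D [s [fD [SD cD sD eD ->]]]] [D' [s' [fD' [SD' cD' [Ks' Hs'] eD' ->]]]].
have /asboolP [g [Kg g0 Hg]] : principal (D' - D) by apply/cls_eq; rewrite cD cD'.
have [fD0 HD] := eD; have [fD'0 HD'] := eD'.
have Kinv (x : F) : setT x by [].
have [a Ea] : exists a, fD' / (fD * g) = cst a.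
  apply: (units_cst k0 n_gt0) => O lO DO lOK DOK.
  have [P EP] := pd_of_locals X lOK DOK; have [_ _ _ iDO] := DO.
  apply/(ord_eq0 DO); rewrite ?mulf_neq0 ?invr_eq0 ?mulf_neq0 //.
  rewrite (ordM DO) ?invr_eq0 ?mulf_neq0 // (ordV DO) ?mulf_neq0 // (ordM DO) //.
  rewrite (HD O P) // (HD' O P) // (ord_restrict lO iDO EP Kg g0); last first.
    by move=> n0 ninf; have OP := restrict_open lO EP; rewrite -Hg coeff_divB SD // SD' // subrr.
  by rewrite -Hg coeff_divB; ring.
have EfD' : fD' = cst a * (fD * g) by rewrite -Ea divfK // mulf_neq0.
(* Multiplication by [cst a * g] carries sections of [D'] to sections of [D], so that both terms
   share the equation [fD]. *)
exists D, (s + s' * (cst a * g)), fD; split=> //; last by rewrite EfD'; ring.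
apply: sections_add => //.
have Kag : K (cst a * g) by apply: (subr_M Kr) => //; exact: Kmu_cst.
split; first exact: subr_M.
rewrite !mulf_eq0 !negb_or => /and3P [s'0 a0 _] P.
rewrite /ordP (ordM (dP P)) // ?mulf_neq0 // (ordM (dP P)) //; last exact: Kmu_cst.
rewrite (ord_unit (dP P) (cst_unit P _)) -?(fmorph_eq0 cst) // add0r.
rewrite -[ord K P g]/(ordP P g) -Hg coeff_divB -addrA subrK.
exact: Hs'.
Qed.

Lemma supported_E0 : supported << E0 >>.
Proof. by move=> P _ n0 _; rewrite coeff_div1; case: eqP => // E; case: n0. Qed.

Lemma supported_Einf : supported << Einf >>.
Proof. by move=> P _ _ n0; rewrite coeff_div1; case: eqP => // E; case: n0. Qed.

Lemma cox_part_cst c : cox_part_supp 0 (cst c).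
Proof.
exists 0, (cst c), 1; rewrite mulr1; split=> //; last exact: equation_0.
- by move=> P _ _ _; exact: coeff_div0.
- exact: raddf0.
- by apply: sections_cst => P; rewrite coeff_div0.
Qed.

Lemma cox_part_E0 i : cox_part_supp (class_of E0) (gmx i 0).
Proof.
have [_ _ n3 _] := gn0; move: i; apply: ord2_ind.
  exists << E0 >>, (g1 / g3), g3; split=> //; last by rewrite divfK.
  - exact: supported_E0.
  - exact: sections_E0.
  - exact: equation_E0.
exists << E0 >>, (cst 1), g3; split=> //; last by rewrite rmorph1 mul1r.
- exact: supported_E0.
- by apply: sections_cst => P; exact: div1_ge0.
- exact: equation_E0.
Qed.

Lemma cox_part_Einf i : cox_part_supp (class_of Einf) (gmx i 1).
Proof.
have [_ _ _ n4] := gn0; move: i; apply: ord2_ind.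
  exists << Einf >>, (g2 / g4), g4; split=> //; last by rewrite divfK.
  - exact: supported_Einf.
  - exact: sections_Einf.
  - exact: equation_Einf.
exists << Einf >>, (cst 1), g4; split=> //; last by rewrite rmorph1 mul1r.
- exact: supported_Einf.
- by apply: sections_cst => P; exact: div1_ge0.
- exact: equation_Einf.
Qed.

Lemma cox_part_boundary Q : ~ (OGn `<=` Q) -> cox_part_supp (class_of Q) 1.
Proof.
move=> nQ; exists << Q >>, (cst 1), 1; split=> //; last by rewrite rmorph1 mul1r.
- by move=> P OP _ _; rewrite coeff_div1; case: eqP => // E; case: nQ; rewrite E.
- by apply: sections_cst => P; exact: div1_ge0.
- exact: equation_boundary.
Qed.

(** Each term maps to a single homogeneous element, and sums are treated degree by degree. The
    induction carries [cox_part_supp], whose closure under sums has been established. *)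
Lemma phi_cox (f : symS k p q) : cox (phi E0 Einf Y0 Yinf f).
Proof.
pose cs (u : cox_ambient X) := forall c, c \in dom u -> cox_part_supp c (coeff c u).
suff : cs (phi E0 Einf Y0 Yinf f) by move=> H c /H; exact: cox_part_suppP.
pose hom (u : cox_ambient X) := exists g c, u = echar g c /\ cox_part_supp c g.
have hom1 : hom 1 by exists 1, 0; split=> //; rewrite -(rmorph1 cst); exact: cox_part_cst.
have homM u v : hom u -> hom v -> hom (u * v).
  move=> [g [c [-> Hg]]] [g' [c' [-> Hg']]]; exists (g * g'), (c + c').
  by rewrite echarM; split=> //; exact: cox_part_supp_mul.
have homcs u : hom u -> cs u.
  move=> [g [c [-> Hg]]] c'; rewrite mem_dom coeff_echar.
  by have [<-|_] := eqVneq c c'; rewrite ?mulr1 ?mulr0 ?eqxx.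
have hom_var i : hom (var_image E0 Einf Y0 Yinf i).
  rewrite /var_image; case: (split_ordP i) => {}i ->; rewrite ?casesL ?casesR;
    case: (split_ordP i) => {}i ->; rewrite ?casesL ?casesR.
  - by exists (gmx i 0), (class_of E0); split=> //; exact: cox_part_E0.
  - by exists (gmx i 1), (class_of Einf); split=> //; exact: cox_part_Einf.
  - by exists 1, (class_of (Y0 i)); split=> //; apply: cox_part_boundary; exact: Y0_not_open.
  - by exists 1, (class_of (Yinf i)); split=> //; apply: cox_part_boundary; exact: Yinf_not_open.
elim/mpolyind: f => [|c m f _ _ IH].
  by rewrite phiE rmorph0 => c; rewrite dom0.
rewrite phiD; set u := phi _ _ _ _ (_ *: _).
have Hu : cs u.
  apply: homcs; rewrite /u -mul_mpolyC phiM; apply: (homM).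
    by rewrite phiE mmapC; exists (cst c), 0; split=> //; exact: cox_part_cst.
  rewrite phiE mmapX /mmap1; apply: (big_ind hom) => // i _.
  by elim: (m i) => [|j IHj]; rewrite ?expr0 // exprS; exact: (homM).
move=> d; rewrite mem_dom (coeffD d u) => uv0.
have [u0|u0] := eqVneq (coeff d u) 0.
  by rewrite u0 add0r in uv0 *; apply: IH; rewrite mem_dom.
have [v0|v0] := eqVneq (coeff d (phi E0 Einf Y0 Yinf f)) 0.
  by rewrite v0 addr0; apply: Hu; rewrite mem_dom.
by apply: cox_part_supp_add; [apply: Hu|apply: IH]; rewrite mem_dom.
Qed.

End Main.

Local Close Scope classical_set_scope.

Theorem proposition4p5p2
    (k : closedFieldType) (k_char0 : [pchar k] =i pred0)
    (F : sl2_field k)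
    (n : nat) (n_gt0 : (0 < n)%N)
    (X : embedding F n)
    (not_dominating : forall P : prime_divisor X,
       G_stable P -> ~ dominates_P1 P)
    (exceptional_points : forall x : P1 k,
       exceptional_point X x <-> x = x_zero k \/ x = x_infty k)
    (E0 Einf : prime_divisor X)
    (E0_color : color_over (x_zero k) E0)
    (Einf_color : color_over (x_infty k) Einf)
    (p q : nat)
    (Y0 : 'I_p -> prime_divisor X) (Yinf : 'I_q -> prime_divisor X)
    (Y0_enum : enum_G_stable_over (x_zero k) Y0)
    (Yinf_enum : enum_G_stable_over (x_infty k) Yinf) :
  (forall f : symS k p q, cox (phi E0 Einf Y0 Yinf f)) /\
  exists (m0 : 'I_p -> nat) (minf : 'I_q -> nat),
    [/\ multiplicities E0 Einf Y0 Yinf m0 minf,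
        forall m0' minf', multiplicities E0 Einf Y0 Yinf m0' minf' ->
          m0' = m0 /\ minf' = minf,
        forall h : 'M[k]_2, \det h = 1 ->
          symS_act h (cox_relation k m0 minf) = cox_relation k m0 minf
      & forall f : symS k p q,
          phi E0 Einf Y0 Yinf f = 0 <->
          exists f' : symS k p q, f = f' * cox_relation k m0 minf].
Proof.
have exc x : exceptional_point X x -> x = x_zero k \/ x = x_infty k.
  by move/exceptional_points.
split; first exact: (phi_cox k_char0 n_gt0 E0_color Einf_color Y0_enum Yinf_enum).
have indep e e' d d' : \sum_j class_of (Y0 j) *+ e j + \sum_j class_of (Yinf j) *+ e' j
    = \sum_j class_of (Y0 j) *+ d j + \sum_j class_of (Yinf j) *+ d' j ->
    e =1 d /\ e' =1 d'.
  rewrite -!cls_fam_div -!cls_add.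
  exact: (class_independent k_char0 n_gt0 E0_color Einf_color Y0_enum Yinf_enum).
have Hm := mult_exists k_char0 n_gt0 not_dominating exc E0_color Einf_color Y0_enum Yinf_enum.
set m0 := mult0 Y0 in Hm; set minf := multinf Yinf in Hm.
exists m0, minf; split=> //.
- move=> m0' minf'; rewrite /multiplicities Hm => /indep [e0 einf].
  by split; apply/funext => j; rewrite ?e0 ?einf.
- exact: symS_act_relation.
move=> f; split=> [f0|[f' ->]]; last by rewrite phiM phi_relation // mulr0.
have [f' [g [ng Ef]]] := cox_relation_division m0 minf f.
suff g0 : g = 0 by exists f'; rewrite Ef g0 addr0.
apply: (phi_normal_inj (E0 := E0) (Einf := Einf) k_char0 indep ng).
by move: f0; rewrite Ef phiD phiM phi_relation // mulr0 add0r.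
Qed.
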